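(* If $F(t_0)<1$ and $F$ has the density function $f$, then (i) for $n\in\mathbb{N}$ the limit $\tau^{*}_n=\lim_{K\to\infty}\tau^{*}_{n,K}$ exists a.s., and $\tau^{*}_n\le t_0$ is an optimal stopping rule in the set $\mathcal{T}^s\cap\{\tau\ge T^{\{3\}}_n\}$ (that is, it maximizes $E[Z(s,\tau)\mid\mathcal{F}^s_n]$ over all $\tau\in\mathcal{T}^s$ with $\tau\ge T^{\{3\}}_n$); (ii) $E[Z(s,\tau^{*}_n)\mid\mathcal{F}^s_n]=\gamma^{s,m}(M^s_n,T^{\{3\}}_n)$ a.s., with $m=M_s$, where $$\gamma^{s,m}(\tilde m,t)=\mathbf{1}_{\{t\le t_0\}}\big[\hat w^{b}(m,s,\tilde m,t)+y^{b}(\tilde m-m,\,t-s,\,t_0-t)\big]-C\,\mathbf{1}_{\{t>t_0\}} .$$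
   Context: Setting. Fix $t_0>0$. On a probability space $(\Omega,\mathcal{F},P)$ there are three mutually independent renewal--reward streams. For $i=1,2$: $N_i$ is a renewal counting process with i.i.d. holding times $S^{\{i\}}_k$ of continuous c.d.f. $F_i$, and i.i.d. nonnegative rewards $X^{\{i\}}_k$ of c.d.f. $H_i$, independent of the holding times. The third stream has i.i.d. holding times $S^{\{3\}}_k$ with continuous c.d.f. $F$ with density $f$, and i.i.d. nonnegative rewards $X^{\{3\}}_k$ with c.d.f. $H$, independent of the holding times. Put $\bar F=1-F$ and let $\alpha_2=f/\bar F$ be the hazard rate of $F$. Let $M_t=\sum_{i=1}^2\sum_{k=1}^{N_i(t)}X^{\{i\}}_k$ and let $\mathcal{F}_t$ be the $\sigma$-field generated by the event times, marks (which stream $i\in\{1,2\}$) and rewards of streams $1,2$ up to time $t$. Fix $s\ge 0$, the time at which streams $1,2$ are replaced by stream 3, and put $m=M_s$. Put $T^{\{3\}}_0=s$, $T^{\{3\}}_n=s+\sum_{k=1}^nS^{\{3\}}_k$, let $N_3$ be the counting process of stream 3 (time measured from $s$), $M^s_t=M_{s\wedge t}+\sum_{k=1}^{N_3((t-s)^+)}X^{\{3\}}_k$ and $M^s_n=M^s_{T^{\{3\}}_n}$. For $t\ge s$ let $\mathcal{F}_{s,t}$ be the $\sigma$-field generated by $\mathcal{F}_s$ and by the event times and rewards of stream 3 up to $t$; $\mathcal{F}^s_n=\mathcal{F}_{s,T^{\{3\}}_n}$; $\mathcal{T}^s$ is the set of stopping times $\tau\ge s$ with respect to $(\mathcal{F}_{s,t})_{t\ge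 s}$. Pay-off. $\hat g^{a},\hat g^{b}:[0,\infty)\to[0,\infty)$ are bounded and continuous; $c^{a}:[0,t_0]\to[0,C^a]$, $c^{b}:[0,t_0]\to[0,C^b]$ are bounded, continuous and differentiable; $C=C^a+C^b$. Put $\hat w^{a}(m,t)=\hat g^{a}(m)-c^{a}(t)$ and $\hat w^{b}(m,s,\tilde m,t)=\hat w^{a}(m,s)+\hat g^{b}(\tilde m-m)-c^{b}(t-s)$. For $t\ge s$, $Z(s,t)=\hat w^{b}(M_s,s,M^s_t,t)$ if $s\le t\le t_0$, and $Z(s,t)=-C$ if $t>t_0$. Recursion. Let $\mathbb{B}$ be the space of all bounded continuous functions $\delta(a,b,c)$ on $[0,\infty)\times[0,t_0]\times[0,t_0]$ with the supremum norm. With $X^{\{3\}}$ distributed by $H$ and $\Delta^{b}(a)=E[\hat g^{b}(a+X^{\{3\}})-\hat g^{b}(a)]$, put $$\phi^{b}_\delta(a,b,c,r)=\int_0^r\bar F(z)\{\alpha_2(z)[\Delta^{b}(a)+E\,\delta(a+X^{\{3\}},b+z,c-z)]-(c^{b})'(b+z)\}\,dz$$ and $(\Phi^{b}\delta)(a,b,c)=\max_{0\le r\le c}\phi^{b}_\delta(a,b,c,r)$. Let $y^{b}_0=0$, $y^{b}_j=\Phi^{b}y^{b}_{j-1}$. When $F(t_0)<1$, $y^{b}\in\mathbb{B}$ denotes the fixed point $y^{b}=\Phi^{b}y^{b}$, which is the uniform limit of $y^{b}_K$ as $K\to\infty$. Stopping times. Let $r^{*}_j(a,b,c)$ ($j\ge1$)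 be the maximizing functions, i.e. $0\le r^*_j(a,b,c)\le c$ and $y^{b}_j(a,b,c)=\phi^{b}_{y^{b}_{j-1}}(a,b,c,r^{*}_j(a,b,c))$, and let $r^*_0=0$. For $K\ge n$ and $i=0,1,\dots,K$ put $R^{*}_{i}=r^{*}_{K-i}(M^s_i-M_s,\,T^{\{3\}}_i-s,\,t_0-T^{\{3\}}_i)$ (an $\mathcal{F}^s_i$-measurable random variable), $\eta_{n,K}=K\wedge\inf\{i\ge n:R^{*}_{i}<S^{\{3\}}_{i+1}\}$ and $\tau^{*}_{n,K}=T^{\{3\}}_{\eta_{n,K}}+R^{*}_{\eta_{n,K}}$.
   Formalization: The maximizers r*_j are assumed Borel with ties broken consistently across j (else the limit can fail, e.g. for constant ĝ^b, c^b); τ*_n ≤ t_0 is claimed only on {T_n ≤ t_0}, since τ*_n ≥ T_n; (c^b)' is assumed integrable so that φ^b is defined. *)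

(* Defs.v *)
(* MathComp-Analysis *)
From HB Require Import structures.
From mathcomp Require Import all_boot all_order all_algebra.
From mathcomp Require Import all_classical all_reals all_analysis.

Set Implicit Arguments.
Unset Strict Implicit.
Unset Printing Implicit Defensive.

Import Order.TTheory GRing.Theory Num.Theory numFieldNormedType.Exports.
Local Open Scope classical_set_scope.
Local Open Scope ring_scope.

(** * Independence and conditional expectation *)

Section probability_notions.
Context {d : measure_display} {T : measurableType d} {R : realType}
        (P : probability T R).

Definition independent_families (I : choiceType) (G : I -> set (set T)) : Prop :=
  forall (J : seq I) (A : I -> set T), uniq J ->
    (forall i, i \in J -> G i (A i)) ->
    P (\bigcap_(i in [set` J]) A i) = (\prod_(i <- J) P (A i))%E.

Definition sigma_RVs (I : Type) (X : I -> {RV P >-> R}) : set (set T) :=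
  <<s [set A | exists i (B : set R), measurable B /\ A = X i @^-1` B] >>.

Definition independent_RVs (I : choiceType) (X : I -> {RV P >-> R}) : Prop :=
  independent_families (fun i => sigma_RVs (fun _ : unit => X i)).

(** [Y] is a version of the conditional expectation of [X] given [G]. *)
Definition cond_expectation (G : set (set T)) (X Y : T -> R) : Prop :=
  [/\ P.-integrable setT (EFin \o X),
      P.-integrable setT (EFin \o Y),
      (forall B : set R, measurable B -> G (Y @^-1` B)) &
      forall A : set T, G A ->
        (\int[P]_(w in A) (Y w)%:E = \int[P]_(w in A) (X w)%:E)%E].

End probability_notions.

(** * Data of the problem *)

(** Streams 1, 2, 3 are indexed by the elements 0, 1, 2 of ['I_3], and the
    sequences of each stream start at index 0: [holding D i k] is the
    (k+1)-st holding time, and [reward D i k] the (k+1)-st reward, of the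
    stream [i]. *)
Record problem d (T : measurableType d) (R : realType) (P : probability T R) :=
  Problem {
    holding : 'I_3 -> nat -> {RV P >-> R};
    reward : 'I_3 -> nat -> {RV P >-> R};
    holding_cdf : 'I_3 -> R -> R;
    reward_cdf : 'I_3 -> R -> R;
    density : R -> R;
    ga : R -> R;
    gb : R -> R;
    ca : R -> R;
    cb : R -> R;
    Ca : R;
    Cb : R;
    t0 : R;
    s0 : R }.

Definition stream3 : 'I_3 := ord_max.

Section definitions.
Context {d : measure_display} {T : measurableType d} {R : realType}
        {P : probability T R} (D : problem P).

Local Notation t0 := (t0 D).
Local Notation s := (s0 D).

(** ** Renewal-reward streams *)

Definition stream_family (i : 'I_3) (kind : bool) : nat -> {RV P >-> R} :=
  if kind then holding D i else reward D i.

Record renewal_reward_streams : Prop := {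
  holding_ge0 : forall i k w, 0 <= holding D i k w;
  reward_ge0 : forall i k w, 0 <= reward D i k w;
  holding_cdfE : forall i k x, cdf (holding D i k) x = (holding_cdf D i x)%:E;
  reward_cdfE : forall i k x, cdf (reward D i k) x = (reward_cdf D i x)%:E;
  holding_cdf_continuous : forall i, continuous (holding_cdf D i);
  holding_independent : forall i, independent_RVs (holding D i);
  reward_independent : forall i, independent_RVs (reward D i);
  holding_reward_independent : forall i,
    independent_families P (fun kind => sigma_RVs (stream_family i kind));
  streams_independent :
    independent_families P (fun i =>
      sigma_RVs (fun p : bool * nat => stream_family i p.1 p.2)) }.

Definition has_density (F f : R -> R) : Prop :=
  [/\ measurable_fun setT f, (forall x, 0 <= f x) &
      forall x, (F x)%:E = (\int[lebesgue_measure]_(z in `]-oo, x]) (f z)%:E)%E].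

(** [arrival i n] is the sum of the first [n] holding times. *)
Definition arrival (i : 'I_3) (n : nat) (w : T) : R :=
  \sum_(k < n) holding D i k w.

(** The value 0 is used on the null event where the stream explodes before
    time [t]. *)
Definition counting (i : 'I_3) (t : R) (w : T) : nat :=
  xget 0%N [set n | arrival i n w <= t < arrival i n.+1 w].

Definition M (t : R) (w : T) : R :=
  \sum_(i : 'I_3 | i != stream3) \sum_(k < counting i t w) reward D i k w.

Definition T3 (n : nat) (w : T) : R := s + arrival stream3 n w.

Definition Ms (t : R) (w : T) : R :=
  M (Num.min s t) w +
  \sum_(k < counting stream3 (Num.max (t - s) 0) w) reward D stream3 k w.

(** ** Filtrations *)

(** The filtrations are the internal ones of the marked point processes: the
    k-th event time and the k-th reward are known up to time [t] through the
    events "the k-th event occurs by time u with a reward in B", u <= t. *)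
Definition Ft (t : R) : set (set T) :=
  <<s [set A | exists (i : 'I_3) (k : nat) (u : R) (B : set R),
        [/\ i != stream3, u <= t, measurable B &
            A = [set w | arrival i k.+1 w <= u /\ B (reward D i k w)]] ] >>.

Definition Fst (t : R) : set (set T) :=
  <<s Ft s `|`
      [set A | exists (k : nat) (u : R) (B : set R),
        [/\ u <= t, measurable B &
            A = [set w | T3 k.+1 w <= u /\ B (reward D stream3 k w)]] ] >>.

Definition Fsn (n : nat) : set (set T) :=
  [set A | forall t : R, s <= t -> Fst t (A `&` [set w | T3 n w <= t])].

(** Stopping times may take the value [+oo]. *)
Definition stopping_time (tau : T -> \bar R) : Prop :=
  (forall w, (s%:E <= tau w)%E) /\
  (forall t : R, s <= t -> Fst t [set w | (tau w <= t%:E)%E]).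

Definition stopping_time_after (n : nat) (tau : T -> \bar R) : Prop :=
  stopping_time tau /\ forall w, ((T3 n w)%:E <= tau w)%E.

(** ** Pay-off *)

Definition Ctot : R := Ca D + Cb D.
Definition wa (m t : R) : R := ga D m - ca D t.
Definition wb (m u m' t : R) : R := wa m u + gb D (m' - m) - cb D (t - u).

Definition Z (t : \bar R) (w : T) : R :=
  if (t <= t0%:E)%E then wb (M s w) s (Ms (fine t) w) (fine t) else - Ctot.

(** The values of the pay-off functions outside [0, +oo[ or [0, t0] are
    irrelevant. The last field says that the integrals defining [phi] below
    exist; it is not implied by differentiability. *)
Record payoff_assumptions : Prop := {
  t0_gt0 : 0 < t0;
  s_ge0 : 0 <= s;
  ga_ge0 : forall x : R, 0 <= x -> 0 <= ga D x;
  gb_ge0 : forall x : R, 0 <= x -> 0 <= gb D x;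
  ga_bounded : exists K, forall x : R, 0 <= x -> ga D x <= K;
  gb_bounded : exists K, forall x : R, 0 <= x -> gb D x <= K;
  ga_continuous : {within `[0, +oo[, continuous (ga D)};
  gb_continuous : {within `[0, +oo[, continuous (gb D)};
  ca_range : forall t : R, 0 <= t <= t0 -> 0 <= ca D t <= Ca D;
  cb_range : forall t : R, 0 <= t <= t0 -> 0 <= cb D t <= Cb D;
  ca_continuous : {within `[0, t0], continuous (ca D)};
  cb_continuous : {within `[0, t0], continuous (cb D)};
  ca_derivable : forall t : R, 0 < t < t0 -> derivable (ca D) t 1;
  cb_derivable : forall t : R, 0 < t < t0 -> derivable (cb D) t 1;
  cb_derive_integrable :
    lebesgue_measure.-integrable `[0, t0] (EFin \o derive1 (cb D)) }.

(** ** Recursion *)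

Definition F : R -> R := holding_cdf D stream3.
Definition Fbar (z : R) : R := 1 - F z.
Definition hazard (z : R) : R := density D z / Fbar z.

(** A random variable with c.d.f. [reward_cdf D stream3]. *)
Definition X3 : {RV P >-> R} := reward D stream3 0.

Definition Delta (a : R) : R :=
  fine 'E_P[fun w => gb D (a + X3 w) - gb D a].

Definition phi (delta : R -> R -> R -> R) (a b c r : R) : R :=
  \int[lebesgue_measure]_(z in `[0, r])
    (Fbar z * (hazard z *
        (Delta a + fine 'E_P[fun w => delta (a + X3 w) (b + z) (c - z)])
      - derive1 (cb D) (b + z))).

(** The supremum is a maximum, [phi delta a b c] being continuous. *)
Definition Phi (delta : R -> R -> R -> R) (a b c : R) : R :=
  sup [set phi delta a b c r | r in `[0, c]].

Definition yb (j : nat) : R -> R -> R -> R := iter j Phi (fun _ _ _ => 0).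

(** The recursion leaves b + c unchanged and evaluates the derivative of the
    cost at b + z with z <= c, so it is meaningful where b + c <= t0; this is
    where it is used, with b = t - s and c = t0 - t. *)
Definition dom : set (R * R * R) :=
  [set p | [/\ 0 <= p.1.1, 0 <= p.1.2, 0 <= p.2 & p.1.2 + p.2 <= t0]].

Definition in_BB (delta : R -> R -> R -> R) : Prop :=
  (exists K, forall a b c, dom (a, b, c) -> `|delta a b c| <= K) /\
  {within dom, continuous (fun p : R * R * R => delta p.1.1 p.1.2 p.2)}.

Definition fixed_point (y : R -> R -> R -> R) : Prop :=
  in_BB y /\ forall a b c, dom (a, b, c) -> y a b c = Phi y a b c.

(** ** Stopping rules *)

Definition maximizes (j : nat) (a b c r : R) : Prop :=
  yb j.+1 a b c = phi (yb j) a b c r.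

(** The maximizers need not be unique, and choosing different ones at different
    stages j can make the limit in K of [tau_nK] fail to exist (for constant
    [gb] and [cb] every r in [0, c] is a maximizer at every stage). The last
    field asks that ties be broken consistently across stages; it holds for the
    smallest maximizers, for the largest ones, and whenever the maximizers are
    unique. *)
Record maximizing_functions (r : nat -> R -> R -> R -> R) : Prop := {
  max_fun0 : forall a b c, r 0%N a b c = 0;
  max_fun_range : forall j a b c, dom (a, b, c) -> 0 <= r j a b c <= c;
  max_funP : forall j a b c, dom (a, b, c) -> maximizes j a b c (r j.+1 a b c);
  max_fun_measurable : forall j,
    measurable_fun dom (fun p : R * R * R => r j p.1.1 p.1.2 p.2);
  max_fun_consistent : forall i j a b c, dom (a, b, c) ->
    maximizes i a b c (r j.+1 a b c) -> maximizes j a b c (r i.+1 a b c) ->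
    r i.+1 a b c = r j.+1 a b c }.

(** After time [t0] the third argument of [r] would be negative, and the waiting
    time is set to 0. *)
Definition Rstar (r : nat -> R -> R -> R -> R) (K i : nat) (w : T) : R :=
  if T3 i w <= t0 then
    r (K - i)%N (Ms (T3 i w) w - M s w) (T3 i w - s) (t0 - T3 i w)
  else 0.

Definition eta (r : nat -> R -> R -> R -> R) (n K : nat) (w : T) : nat :=
  \big[minn/K]_(n <= i < K | Rstar r K i w < holding D stream3 i w) i.

Definition tau_nK (r : nat -> R -> R -> R -> R) (n K : nat) (w : T) : R :=
  T3 (eta r n K w) w + Rstar r K (eta r n K w) w.

Definition gamma (y : R -> R -> R -> R) (m m' t : R) : R :=
  if t <= t0 then wb m s m' t + y (m' - m) (t - s) (t0 - t) else - Ctot.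

Definition optimal_after (n : nat) (tau : T -> \bar R) : Prop :=
  stopping_time_after n tau /\
  forall sigma : T -> \bar R, stopping_time_after n sigma ->
  forall U V : T -> R,
    cond_expectation P (Fsn n) (fun w => Z (sigma w) w) U ->
    cond_expectation P (Fsn n) (fun w => Z (tau w) w) V ->
    {ae P, forall w, U w <= V w}.

End definitions.

(* Main.v *)
Require Import Defs.
From HB Require Import structures.
From mathcomp Require Import all_boot all_order all_algebra.
From mathcomp Require Import all_classical all_reals all_analysis.
From mathcomp Require Import measurable_realfun ring lra.

(** Shifting the pay-off by the constant C makes it nonnegative and equal to 0
    after t0. With S and X the next holding time and reward of stream 3,
    integrating the cost by parts turns phi_delta(a,b,c,u) into the expectation
    of the gain of the rule that stops after u unless the next event comes first,
    and then continues with value delta. Hence y = Phi y says that gamma bounds the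
    expected value of every such rule, with equality for u = r(a,b,c), the limit
    in j of the maximizers r_j; these increase with j by Topkis' argument, as
    y_{j+1} - y_j >= 0 makes the increments of phi in u increase with j.

    Before the (i+1)-st event of stream 3 a stopping time only depends on
    streams 1, 2 and on the first i holding times and rewards of stream 3, which
    are independent of the next ones. So the one-step bound applies to every
    stopping time; iterating it K times leaves an error of order
    P(T_{n+K} <= t0) <= F(t0)^K. The rule that waits for r(...) after each event
    attains equality in every step. *)

(** Some null events shape the proof, because the filtrations are not completed and measurability
    has to hold exactly. Simultaneous events of stream 3 can make more than n events count at the
    n-th event time. The value there therefore has two forms: [terminal], the gamma of the
    statement, which is exactly measurable for [Fsn], and [gain], built from the first n rewards and
    measurable for the past of n events. They agree when the next holding time is positive, hence
    almost surely, since its law has a density. Another null event is a tie between a holding time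
    and the limit of the waiting times: the rules for finite K could all stop just before an event
    past which the limit rule continues. Conditional expectations are avoided until the end. Every
    bound compares integrals over events of the past, where independence is a product formula. The
    derivative of the cost is only integrable, so integration by parts rests on the fundamental
    theorem of calculus for everywhere differentiable functions with integrable derivative. *)

Set Implicit Arguments.
Unset Strict Implicit.
Unset Printing Implicit Defensive.

Import Order.TTheory GRing.Theory Num.Theory numFieldNormedType.Exports.
Local Open Scope classical_set_scope.
Local Open Scope ring_scope.

(** * The fundamental theorem of calculus for a derivative in L^1 *)

Section real_analysis.
Local Notation mu := lebesgue_measure.

(* Replaces the lower semicontinuous majorant in the classical proof: [A] is cut
   into level sets on which [h] varies little, each enclosed in an open set of
   slightly larger measure. *)
Lemma locally_constant_majorant (R : realType) (A : set R) (h : R -> R) (e : R) :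
  measurable A -> (lebesgue_measure A < +oo)%E -> measurable_fun A h ->
  (forall x, A x -> 0 <= h x) -> 0 < e ->
  exists g : R -> \bar R, [/\ measurable_fun [set: R] g, (forall x, 0 <= g x)%E,
    (forall x, A x -> \forall y \near x, ((h x)%:E <= g y)%E) &
    (\int[lebesgue_measure]_(x in A) g x
       <= \int[lebesgue_measure]_(x in A) (h x)%:E + (e *+ 2)%:E)%E].
Proof.
move=> mA Afin mh h0 e0.
pose l := fine (mu A).
have l0 : 0 <= l by rewrite fine_ge0.
have lE : mu A = l%:E by rewrite fineK// ge0_fin_numE.
pose dl : R := e / (1 + l).
have dl0 : 0 < dl by rewrite divr_gt0// ltr_pwDl.
pose E k := A `&` h @^-1` `[dl * k%:R, dl * k.+1%:R[.
have mE k : measurable (E k) by apply: mh => //.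
have Efin k : (mu (E k) < +oo)%E.
  apply: le_lt_trans Afin; apply: le_measure; rewrite ?inE;
    [exact: mE|exact: mA|exact: subIsetl].
pose w k : R := dl * k.+1%:R.
have w0 k : 0 < w k by rewrite mulr_gt0.
(* The excess of [U k] is divided by its weight [w k], so that the weighted excesses sum to the
   second [e]. *)
have /choice[U UP] k : exists U : set R, [/\ open U, E k `<=` U &
    (mu (U `\` E k) < (e / (2 ^ k.+1)%:R / w k)%:E)%E].
  apply: lebesgue_regularity_outer => //; first exact: Efin.
  by rewrite !divr_gt0// ltr0n expn_gt0.
have mU k : measurable (U k) by apply: open_measurable; case: (UP k).
have EA : \bigcup_k E k = A.
  apply/seteqP; split=> [x [k _ []]//|x Ax].
  exists (Num.truncn (h x / dl)) => //; split=> //=.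
  have /truncn_itv : 0 <= h x / dl by rewrite divr_ge0 ?h0// ltW.
  by rewrite in_itv/= ler_pdivlMr// ltr_pdivrMr// mulrC [X in _ < X]mulrC.
have tE : trivIset setT E.
  apply/trivIsetP => i j _ _ ij; rewrite -subset0 => x [[Ax]] /=.
  rewrite in_itv /= => /andP[h1 h2] [_] /=; rewrite in_itv/= => /andP[h3 h4].
  have h5 := le_lt_trans h1 h4; have h6 := le_lt_trans h3 h2.
  move: h5 h6; rewrite !ltr_pM2l// !ltr_nat !ltnS => h5 h6.
  by move: ij; rewrite eqn_leq h5 h6.
pose g (x : R) : \bar R := (\sum_(k <oo) (w k * \1_(U k) x)%:E)%E.
have t0 k x : (0 <= (w k * \1_(U k) x)%:E)%E.
  by rewrite lee_fin mulr_ge0// ltW.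
have mt k D : measurable_fun D (fun x => (w k * \1_(U k) x)%:E).
  by apply/measurable_EFinP; apply: measurable_funM => //; exact: measurable_indic.
exists g; split.
- by apply: ge0_emeasurable_sum => // k x _ _; exact: t0.
- by move=> x; apply: nneseries_ge0 => k _ _; exact: t0.
- move=> x; rewrite -{1}EA => -[k _ Ekx].
  have [oU EU _] := UP k.
  have Uy : \forall y \near x, U k y by apply: open_nbhs_nbhs; split => //; exact: EU.
  near=> y.
  have Uky : U k y by near: y.
  have hw : h x <= w k by case: Ekx => _ /=; rewrite in_itv/= => /andP[_ /ltW].
  apply: (@le_trans _ _ (w k * \1_(U k) y)%:E).
    by rewrite indicE mem_set// mulr1 lee_fin.
  apply: le_trans (nneseries_lim_ge k.+1 (fun n _ _ => t0 n y)).
  rewrite big_nat_recr//= leeDr// sume_ge0// => i _; exact: t0.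
- rewrite integral_nneseries//; last by move=> k; exact: mt.
  apply: (@le_trans _ _ (\sum_(k <oo) (\int[mu]_(x in E k) (h x + dl)%:E
                           + (e / (2 ^ k.+1)%:R)%:E))%E).
    apply: lee_nneseries => [k _ _|k _]; have mEk := mE k; have mUk := mU k.
      exact: integral_ge0.
    under eq_integral do rewrite EFinM.
    rewrite ge0_integralZl_EFin//; last 2 first.
    + have mI : measurable_fun A (\1_(U k) : R -> R) by exact: measurable_indic.
      by apply/measurable_EFinP; exact: mI.
    + exact: ltW.
    rewrite integral_indic//.
    apply: (@le_trans _ _ ((w k)%:E * (mu (E k) + mu (U k `\` E k)))%E).
      rewrite lee_pmul2l//; last by rewrite lte_fin w0.
      have mUE : measurable (U k `\` E k) by exact: measurableD.
      have U2 := @measureU2 _ _ _ mu _ _ (mE k) mUE.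
      apply: le_trans U2.
      apply: le_measure; rewrite ?inE; first exact: (measurableI _ _ (mU k) mA).
        exact: (measurableU _ _ (mE k) mUE).
      move=> x [Ux Ax]; have [Ex|nEx] := pselect (E k x); [by left|by right].
    rewrite muleDr//; last by rewrite ge0_adde_def ?inE.
    apply: leeD.
      rewrite -integral_cst; last exact: mE.
      apply: ge0_le_integral => //=.
      - by move=> x Ekx; rewrite lee_fin; apply/ltW.
      - apply/measurable_EFinP; apply: measurable_funD => //.
        by apply: measurable_funS mh => //; apply: subIsetl.
      - move=> x [_] /=; rewrite in_itv/= => /andP[h1 _].
        by rewrite lee_fin /w -(natr1 k) mulrDr mulr1 lerD2r.
    have [_ _ /ltW h1] := UP k.
    apply: (le_trans (lee_wpmul2l _ h1)); first by rewrite lee_fin ltW.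
    by rewrite -EFinM lee_fin [leLHS]mulrC divfK// gt_eqF.
  have hd0 x : A x -> 0 <= h x + dl by move=> Ax; rewrite addr_ge0 ?h0// ltW.
  apply: le_trans.
    apply: epsilon_trick; last exact: ltW.
    move=> k; apply: integral_ge0 => x [Ax _]; rewrite lee_fin; exact: hd0.
  have mhd : measurable_fun A (fun x => (h x + dl)%:E).
    by apply/measurable_EFinP; exact: measurable_funD.
  rewrite -ge0_integral_bigcup//= ?EA//.
  under eq_integral do rewrite EFinD.
  rewrite ge0_integralD//; last 2 first.
  + exact/measurable_EFinP.
  + by move=> x _; rewrite lee_fin ltW.
  rewrite integral_cst// [X in (dl%:E * X)%E]lE mulr2n EFinD addeA leeD2r// leeD2l//.
  rewrite -EFinM lee_fin /dl -mulrA ler_piMr//; first exact: ltW.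
  by rewrite ler_pdivrMl ?mulr1 ?lerDr// ltr_pwDl.
Unshelve. all: by end_near. Qed.

(** The growth of [f] from [a'], less a slack [e * (x - a')], is compared with the integral of a
    majorant [g] of [h]. The supremum [c] of the points where this bound holds must be [b']: at a
    smaller [c] the derivative is below [h c + e], while [g >= h c] near [c], so the bound would
    extend further. The argument runs on [[a', b']] inside []a, b[], where [f] is derivable, and
    continuity then reaches the end points. *)
Lemma increment_le_integral (R : realType) (f h : R -> R) (a b : R) : a < b ->
  {within `[a, b], continuous f} ->
  (forall x, a < x < b -> derivable f x 1) ->
  (forall x, a < x < b -> derive1 f x <= h x) -> (forall x, a < x < b -> 0 <= h x) ->
  mu.-integrable `]a, b[ (EFin \o h) ->
  ((f b - f a)%:E <= \int[mu]_(x in `]a, b[) (h x)%:E)%E.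
Proof.
move=> ab cf df f'h h0 ih.
set A : set R := `]a, b[%classic.
have AP x : A x = (a < x < b) :> Prop by rewrite /A/= in_itv.
have mA : measurable A by exact: measurable_itv.
have lA : mu A = (b - a)%:E.
  by rewrite lebesgue_measure_itv/= lte_fin ab -EFinB.
have mh : measurable_fun A h by case/integrableP: ih => /measurable_EFinP.
have I0 : (0 <= \int[mu]_(x in A) (h x)%:E)%E.
  by apply: integral_ge0 => x; rewrite AP => ?; rewrite lee_fin h0.
have Ifin : (\int[mu]_(x in A) (h x)%:E)%E \is a fin_num by exact: integrable_fin_num.
set I := fine (\int[mu]_(x in A) (h x)%:E)%E.
have IE : (\int[mu]_(x in A) (h x)%:E = I%:E)%E by rewrite fineK.
have key (e a' b' : R) : 0 < e -> a < a' -> a' < b' -> b' < b ->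
    f b' - f a' <= I + e *+ 2 + e * (b' - a').
  move=> e0 aa' a'b' b'b.
  have [g [mg g0 hg gI]] : exists g : R -> \bar R, [/\ measurable_fun [set: R] g,
      (forall x, 0 <= g x)%E,
      (forall x, A x -> \forall y \near x, ((h x)%:E <= g y)%E) &
      (\int[mu]_(x in A) g x <= I%:E + (e *+ 2)%:E)%E].
    rewrite -IE; apply: locally_constant_majorant => //.
    by rewrite [X in (X < _)%E]lA ltry.
  pose nu x := (\int[mu]_(z in `[a', x]) g z)%E.
  have mgD (B : set R) : measurable_fun B g by exact: measurable_funTS.
  have nu_nd x y : x <= y -> (nu x <= nu y)%E.
    move=> xy; apply: ge0_subset_integral => //=; [exact: mgD|].
    by apply: subset_itvl; rewrite bnd_simp.
  pose p x := f x - f a' - e * (x - a').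
  pose S := [set x | a' <= x <= b' /\ ((p x)%:E <= nu x)%E].
  have Sa' : S a'.
    split; first by rewrite lexx ltW.
    by rewrite /p !subrr mulr0 subr0; apply: integral_ge0.
  have ubS : ubound S b' by move=> x [/andP[]].
  have supS : has_sup S by split; [exists a'|exists b'].
  pose c := sup S.
  have le_c x : S x -> x <= c by exact: sup_upper_bound.
  have a'c : a' <= c by exact: le_c.
  have cb' : c <= b' by apply: ge_sup => //; exists a'.
  have cA : a < c < b by rewrite (lt_le_trans aa' a'c) (le_lt_trans cb' b'b).
  have cfc : {for c, continuous f}.
    have /continuous_within_itvP[//|+ _ _] := cf.
    by apply; rewrite in_itv.
  have cpc : p x @[x --> c] --> p c.
    apply: cvgB; first by apply: cvgB; [exact: cfc|exact: cvg_cst].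
    by apply: cvgM; [exact: cvg_cst|apply: cvgB; [exact: cvg_id|exact: cvg_cst]].
  (* The supremum is attained: [p] is continuous and [nu] is nondecreasing, so a failure at [c]
     would also hold at points of [S] just below it. *)
  have Sc : ((p c)%:E <= nu c)%E.
    rewrite leNgt; apply/negP => nup.
    have nuc0 : (0 <= nu c)%E by apply: integral_ge0.
    have nuE : nu c = (fine (nu c))%:E.
      by rewrite fineK// ge0_fin_numE// (lt_trans nup)// ltry.
    move: nup; rewrite nuE lte_fin => /(cvgr_gt _ cpc)[d /= d0 dp].
    have [x Sx cdx] := sup_adherent d0 supS.
    have xc : x <= c by exact: le_c.
    have := dp x; rewrite /ball_ /= ger0_norm ?subr_ge0// ltrBlDr -ltrBlDl.
    move=> /(_ cdx); rewrite ltNge => /negP; apply.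
    by rewrite -lee_fin -nuE; case: Sx => _ /le_trans; apply; exact: nu_nd.
  have [cb'E|cltb'] := eqVneq c b'; last first.
    have {cltb'} cltb' : c < b' by rewrite lt_neqAle cltb'.
    exfalso.
    have f'c : derive1 f c < h c + e by rewrite ltr_pwDr// f'h.
    have dfc := df c cA.
    have dq : \forall u \near 0^', u^-1 *: (f (u *: 1 + c) - f c) < h c + e.
      by apply: cvgr_lt dfc _ _; rewrite -[lim _]/('D_1 f c) -derive1E.
    have [d1 /= d10 dq1] := dq.
    have [d2 /= d20 gc] := hg c cA.
    pose d := Num.min (d1 / 2) (Num.min (d2 / 2) (b' - c)).
    have d0 : 0 < d by rewrite !lt_min !divr_gt0//= subr_gt0.
    have dd1 : d < d1.
      by rewrite (@le_lt_trans _ _ (d1 / 2))// ?ge_min ?lexx// ltr_pdivrMr// ltr_pMr// ltr1n.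
    have dd2 : d < d2.
      rewrite (@le_lt_trans _ _ (d2 / 2))// ?ge_min ?lexx ?orbT//.
      by rewrite ltr_pdivrMr// ltr_pMr// ltr1n.
    have cdb' : c + d <= b' by rewrite -lerBrDl !ge_min lexx !orbT.
    have ac : a' <= c + d by rewrite (le_trans a'c)// lerDl ltW.
    have : S (c + d); last first.
      by move=> /le_c; rewrite -[leRHS]addr0 lerD2l leNgt d0.
    split; first by rewrite ac.
    have fcd : f (c + d) - f c <= (h c + e) * d.
      have := dq1 d; rewrite /ball_ /= sub0r normrN gtr0_norm// => /(_ dd1).
      move=> /(_ (lt0r_neq0 d0)) /ltW.
      by rewrite -[_ *: (_ - _)]/(_ * _) mulrC ler_pdivrMr// -[d%:A]/(d * 1) mulr1 [d + c]addrC.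
    have -> : nu (c + d) = (nu c + \int[mu]_(z in `]c, (c + d)%R]) g z)%E.
      rewrite /nu (@itv_bndbnd_setU _ _ _ (BRight c)) ?bnd_simp//; last by rewrite lerDl ltW.
      rewrite ge0_integral_setU//=; first exact: mgD.
      apply/disj_setPS => z [] /=; rewrite !in_itv/= => /andP[_ zc] /andP[cz _].
      by move: (lt_le_trans cz zc); rewrite ltxx.
    have hI : ((h c * d)%:E <= \int[mu]_(z in `]c, (c + d)%R]) g z)%E.
      have -> : ((h c * d)%:E = \int[mu]_(z in `]c, (c + d)%R]) (h c)%:E)%E.
        rewrite integral_cst//= EFinM; congr (_ * _)%E.
        by rewrite lebesgue_measure_itv/= lte_fin ltrDl d0 -EFinB addrC addKr.
      apply: ge0_le_integral => //=.
      - by move=> z _; rewrite lee_fin h0.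
      - exact: mgD.
      - move=> z; rewrite in_itv/= => /andP[cz zd]; apply: gc => /=.
        rewrite distrC ger0_norm ?subr_ge0 ?ltW// ltrBlDl.
        by rewrite (le_lt_trans zd)// ltrD2l.
    apply: le_trans (leeD Sc hI); rewrite -EFinD lee_fin /p.
    by move: fcd; lra.
  have : ((p b')%:E <= I%:E + (e *+ 2)%:E)%E.
    rewrite -cb'E (le_trans Sc)// (le_trans _ gI)//.
    apply: ge0_subset_integral => //=; first exact: mgD.
    by move=> z; rewrite /A cb'E /= !in_itv/= => /andP[h1 h2]; lra.
  by rewrite -EFinD lee_fin /p => h1; lra.
have key2 a' b' : a < a' -> a' < b' -> b' < b -> f b' - f a' <= I.
  move=> aa' a'b' b'b; apply/ler_addgt0Pr => e e0.
  have k0 : 0 < 2 + (b' - a') by lra.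
  have := key (e / (2 + (b' - a'))) _ _ (divr_gt0 e0 k0) aa' a'b' b'b.
  move=> /le_trans; apply; rewrite -addrA lerD2l -[X in X + _]mulr_natr -mulrDr.
  by rewrite divfK// gt_eqF.
have /(continuous_within_itvP _ ab)[_ fa fb] := cf.
rewrite IE lee_fin lerBlDr.
apply: (cvgr_to_le fb); near=> b'.
rewrite -lerBlDl.
apply: (cvgr_to_ge fa); near=> a'.
rewrite lerBlDl -lerBlDr; exact: key2.
Unshelve. all: by end_near. Qed.

(** [increment_le_integral] needs a nonnegative bound of the derivative. Truncating [f'] below at
    [-n] and adding [n] gives one for [f x + n * x]; the extra [n * (b - a)] cancels, and dominated
    convergence removes the truncation. *)
Let integral_derive1_ge (R : realType) (f : R -> R) (a b : R) : a < b ->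
  {within `[a, b], continuous f} ->
  (forall x, a < x < b -> derivable f x 1) ->
  mu.-integrable `]a, b[ (EFin \o derive1 f) ->
  ((f b - f a)%:E <= \int[mu]_(x in `]a, b[) (derive1 f x)%:E)%E.
Proof.
move=> ab cf df i'.
set A : set R := `]a, b[%classic.
have mA : measurable A by exact: measurable_itv.
have lA : mu A = (b - a)%:E.
  by rewrite lebesgue_measure_itv/= lte_fin ab -EFinB.
have m' : measurable_fun A (derive1 f) by case/integrableP: i' => /measurable_EFinP.
pose g (n : nat) x : R := Num.max (derive1 f x) (- n%:R).
have mg n : measurable_fun A (g n).
  by apply: measurable_maxr => //; exact: measurable_cst.
have g_abs n x : `|g n x| <= `|derive1 f x|.
  have aux (z m : R) : 0 <= m -> `|Num.max z (- m)| <= `|z|.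
    move=> m0; case: (leP z (- m)) => // zm.
    by rewrite normrN ger0_norm// ler0_norm; lra.
  exact: aux.
have ig n : mu.-integrable A (EFin \o g n).
  apply: (@le_integrable _ _ _ mu A mA _ (EFin \o derive1 f)) => //.
    by apply/measurable_EFinP; exact: mg.
  by move=> x _ /=; rewrite lee_fin.
have ic n : mu.-integrable A (EFin \o cst n).
  apply: measurable_bounded_integrable => //; first by rewrite [X in (X < _)%E]lA ltry.
  by exists `|n|; split => // x nx y _; rewrite /= (le_trans _ (ltW nx)).
have g_le n : ((f b - f a)%:E <= \int[mu]_(x in A) (g n x)%:E)%E.
  have dfn x : a < x < b -> is_derive x 1 (fun x => f x + n%:R * x) (derive1 f x + n%:R).
    move=> xab.
    have dfx : is_derive x 1 f (derive1 f x).
      by rewrite derive1E; apply: DeriveDef => //; exact: df.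
    apply: is_deriveD.
    have := @is_deriveZ _ _ _ id n%:R x 1 1 _.
    by rewrite /GRing.scale/= mulr1; apply; exact: is_derive_id.
  have := @increment_le_integral R (fun x => f x + n%:R * x) (fun x => g n x + n%:R) a b ab.
  rewrite (_ : (\int[mu]_(x in A) (g n x + n%:R)%:E = \int[mu]_(x in A) (g n x)%:E + (n%:R * (b - a))%:E)%E); last first.
    under eq_integral do rewrite EFinD.
    rewrite integralD//; [|exact: ig|exact: ic].
    by rewrite integral_cst// [X in (n%:R%:E * X)%E]lA EFinM.
  rewrite (_ : f b + n%:R * b - (f a + n%:R * a) = (f b - f a) + n%:R * (b - a)); last by ring.
  rewrite EFinD leeD2rE//; apply.
  - apply: within_continuousD => //; apply: continuous_subspaceT => x.
    by apply: cvgM; [exact: cvg_cst|exact: cvg_id].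
  - by move=> x xab; have [] := dfn x xab.
  - move=> x xab; rewrite derive1E; have [_ ->] := dfn x xab.
    by rewrite lerD2r le_max lexx.
  - by move=> x xab; rewrite -lerBlDr sub0r le_max lexx orbT.
  - exact: (@integrableD _ _ _ mu _ mA _ _ (ig n) (ic n%:R)).
have [|||||] := @dominated_convergence _ _ R mu A mA (fun n x => (g n x)%:E) (EFin \o derive1 f) (fun x => `|derive1 f x|%:E).
- by move=> n; apply/measurable_EFinP; exact: mg.
- exact/measurable_EFinP.
- apply: aeW => x _; apply: cvg_near_cst.
  near=> n; congr EFin; apply/max_idPl.
  rewrite lerNl; near: n; exact: nbhs_infty_ger.
- exact: integrable_norm.
- by apply: aeW => x n _; rewrite lee_fin.
by move=> _ _ /cvge_to_ge; apply; exact: nearW.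
Unshelve. all: by end_near. Qed.

Lemma integral_derive1 (R : realType) (f : R -> R) (a b : R) : a < b ->
  {within `[a, b], continuous f} ->
  (forall x, a < x < b -> derivable f x 1) ->
  mu.-integrable `]a, b[ (EFin \o derive1 f) ->
  (\int[mu]_(x in `]a, b[) (derive1 f x)%:E = (f b - f a)%:E)%E.
Proof.
move=> ab cf df i'; apply/eqP; rewrite eq_le integral_derive1_ge// andbT.
have derN x : a < x < b -> derive1 (\- f) x = - derive1 f x.
  by move=> xab; rewrite !derive1E deriveN//; exact: df.
have eqN x : x \in `]a, b[%classic -> (- (derive1 f x)%:E = (derive1 (\- f) x)%:E)%E.
  by rewrite inE/= in_itv => /derN ->; rewrite EFinN.
rewrite -leeN2 -EFinN opprB.
have -> : (- (\int[mu]_(x in `]a, b[) (derive1 f x)%:E) =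
    \int[mu]_(x in `]a, b[) (derive1 (\- f) x)%:E)%E.
  by rewrite -integralN ?integrable_add_def//; exact: eq_integral.
have := @integral_derive1_ge R (\- f) a b ab; rewrite /= opprK addrC; apply.
- by move=> x; apply: continuousN; exact: cf.
- by move=> x xab; apply: derivableN; exact: df.
- have mab : measurable (`]a, b[%classic : set R) by exact: measurable_itv.
  apply: (@eq_integrable _ _ _ mu _ mab _ _ eqN).
  by have := integrableN i'; apply.
Qed.


(** * Translation of Lebesgue integrals *)

Lemma lebesgue_measure_shift (R : realType) (b : R) (A : set R) : measurable A ->
  pushforward mu (+%R b : R -> measurableTypeR R) A = mu A.
Proof.
have mb : measurable_fun [set: R] (+%R b : R -> R) by exact: measurable_funD.
move=> mA; apply/esym/lebesgue_measure_unique => //= _ [[x y]] _ <-.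
rewrite /pushforward.
have -> : +%R b @^-1` `]x, y] = `](x - b), (y - b)]%classic.
  by apply/seteqP; split=> z; rewrite /= !in_itv/= lerBrDl ltrBlDl.
rewrite !lebesgue_measure_itv/= !lte_fin ltrD2r.
by case: ifP => // _; rewrite -!EFinB; congr EFin; ring.
Qed.

Lemma ge0_integral_shift (R : realType) (b : R) (A : set R) (f : R -> \bar R) :
  measurable A -> measurable_fun A f -> (forall x, A x -> 0 <= f x)%E ->
  (\int[mu]_(x in A) f x = \int[mu]_(x in (+%R b : R -> R) @^-1` A) f (b + x)%R)%E.
Proof.
move=> mA mf f0.
have mb : measurable_fun [set: R] (+%R b : R -> R) by exact: measurable_funD.
transitivity (\int[pushforward mu (+%R b : R -> measurableTypeR R)]_(x in A) f x)%E.
  apply: eq_measure_integral => //= B mB _.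
  by rewrite -(lebesgue_measure_shift b mB).
by rewrite ge0_integral_pushforward// => x; rewrite inE; exact: f0.
Qed.

Lemma integrable_shift (R : realType) (b : R) (A : set R) (f : R -> R) :
  measurable A -> mu.-integrable A (EFin \o f) ->
  mu.-integrable ((+%R b : R -> R) @^-1` A) (fun x => (f (b + x))%:E).
Proof.
move=> mA /integrableP[mf fi].
have mb : measurable_fun [set: R] (+%R b : R -> R) by exact: measurable_funD.
apply/integrableP; split.
  apply: (measurable_comp mA) mf _ => //; last exact: measurable_funTS.
  by move=> _ [x Ax <-].
move: fi; rewrite (@ge0_integral_shift R b)//.
by apply: measurableT_comp.
Qed.

(** * Measurability of functions continuous within a domain *)

Definition grid_floor (R : realType) (n : nat) (x : R) : R :=
  (Num.truncn (x * n.+1%:R))%:R / n.+1%:R.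

(** Rounding each coordinate down to a grid makes [f] constant on countably many cells, hence
    measurable; continuity within [D] makes these functions converge to [f]. Rounding down must not
    leave [D], which holds for [dom] because its only upper bound is one on a sum. *)
Lemma within_continuous_measurable3 (R : realType) (D : set (R * R * R))
    (f : R * R * R -> R) (t := @grid_floor R) :
  measurable D ->
  (forall p, D p -> [/\ 0 <= p.1.1, 0 <= p.1.2 & 0 <= p.2]) ->
  (forall n p, D p -> D (t n p.1.1, t n p.1.2, t n p.2)) ->
  {within D, continuous f} -> measurable_fun D f.
Proof.
move=> mD D0 Dt cf.
have t_le n (x : R) : 0 <= x -> t n x <= x.
  move=> x0; rewrite /t /grid_floor ler_pdivrMr//.
  by have /truncn_itv/andP[] : 0 <= x * n.+1%:R by rewrite mulr_ge0.
have t_gt n (x : R) : 0 <= x -> x - n.+1%:R^-1 < t n x.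
  move=> x0; rewrite ltrBlDr /t /grid_floor -{2}[_^-1]mul1r -mulrDl ltr_pdivlMr// natr1.
  by have /truncn_itv/andP[] : 0 <= x * n.+1%:R by rewrite mulr_ge0.
have t_cvg (x : R) : 0 <= x -> t n x @[n --> \oo] --> x.
  move=> x0; apply: (@squeeze_cvgr _ _ _ _ (fun n => x - n.+1%:R^-1) (cst x)).
  - by apply: nearW => n; rewrite t_le// ltW// t_gt.
  - by rewrite -[X in _ --> X]subr0; apply: cvgB; [exact: cvg_cst|exact: cvg_harmonic].
  - exact: cvg_cst.
pose r n p : R * R * R := (t n p.1.1, t n p.1.2, t n p.2).
apply: (@measurable_fun_cvg _ _ _ _ (fun n => f \o r n)); last first.
  move=> p Dp; have [p1 p2 p3] := D0 _ Dp.
  have rp : r n p @[n --> \oo] --> p.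
    case: p {Dp} p1 p2 p3 => -[a b] c /= p1 p2 p3.
    exact: cvg_pair (cvg_pair (t_cvg a p1) (t_cvg b p2)) (t_cvg c p3).
  have fp := cf p.
  have rpD : r n p @[n --> \oo] --> (p : subspace D).
    apply/(@subspace_cvgP _ _ _ p _ Dp) => B /rp.
    by apply: (@filterS _ \oo _ _ (fun n => B (r n p))) => n; apply; exact: Dt.
  exact: cvg_comp rpD fp.
move=> n _ B mB.
pose m : R := n.+1%:R.
pose q (i : nat * nat * nat) : R * R * R := (i.1.1%:R / m, i.1.2%:R / m, i.2%:R / m).
pose I (k : nat) := `[(k%:R : R), k.+1%:R[%classic.
pose cell (i : nat * nat * nat) : set (R * R * R) :=
  (fun p => p.1.1 * m) @^-1` I i.1.1 `&` (fun p => p.1.2 * m) @^-1` I i.1.2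
    `&` (fun p => p.2 * m) @^-1` I i.2.
have mI k : measurable (I k) by exact: measurable_itv.
have mcell i : measurable (cell i).
  have m1 : measurable_fun [set: R * R * R] (fun p : R * R * R => p.1.1 * m).
    apply: measurable_funM; last exact: measurable_cst.
    by apply: measurableT_comp; exact: measurable_fst.
  have m2 : measurable_fun [set: R * R * R] (fun p : R * R * R => p.1.2 * m).
    apply: measurable_funM; last exact: measurable_cst.
    by apply: measurableT_comp; [exact: measurable_snd|exact: measurable_fst].
  have m3 : measurable_fun [set: R * R * R] (fun p : R * R * R => p.2 * m).
    apply: measurable_funM; last exact: measurable_cst.
    exact: measurable_snd.
  by apply: measurableI; [apply: measurableI|]; rewrite -[X in measurable X]setTI;
    [exact: (m1 measurableT _ (mI _))|exact: (m2 measurableT _ (mI _))|exact: (m3 measurableT _ (mI _))].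
have -> : D `&` (f \o r n) @^-1` B = D `&` \bigcup_i (cell i `&` [set p | B (f (q i))]).
  apply/seteqP; split=> [p [Dp Bp]|p [Dp [i _ [[[c1 c2] c3] Bi]]]]; split => //.
    have [p1 p2 p3] := D0 _ Dp.
    exists (Num.truncn (p.1.1 * m), Num.truncn (p.1.2 * m), Num.truncn (p.2 * m)) => //.
    by split => //; split; [split|]; rewrite /I/= in_itv/= truncn_itv// mulr_ge0// /m.
  rewrite /= (_ : r n p = q i)//.
  by rewrite /r /t /grid_floor /q; congr (_ / _, _ / _, _ / _);
    congr (_%:R); apply: truncn_def; move: c1 c2 c3; rewrite /I/= !in_itv.
apply: measurableI => //; apply: countable_bigcupT_measurable => // i.
apply: measurableI => //.
have [Bi|nBi] := pselect (B (f (q i))).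
  by rewrite (_ : [set p | _] = setT)//; apply/seteqP; split.
by rewrite (_ : [set p | _] = set0)//; apply/seteqP; split.
Qed.

End real_analysis.

(** * Laws given by a c.d.f. or a density, and independence *)

Section density_measure.
Local Open Scope ereal_scope.
Context {d : measure_display} {T : measurableType d} {R : realType}
        (m : {measure set T -> \bar R}) (f : T -> R).

Definition density_measure (mf : measurable_fun setT f) (f0 : forall x, (0 <= f x)%R)
    (A : set T) : \bar R := \int[m]_(x in A) (f x)%:E.

Hypotheses (mf : measurable_fun setT f) (f0 : forall x, (0 <= f x)%R).

Let density0 : density_measure mf f0 set0 = 0.
Proof. by rewrite /density_measure integral_set0. Qed.

Let density_ge0 A : 0 <= density_measure mf f0 A.
Proof. by apply: integral_ge0 => x _; rewrite lee_fin. Qed.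

Let density_sigma_additive : semi_sigma_additive (density_measure mf f0).
Proof.
move=> /= F mF tF mUF; rewrite /density_measure; apply: cvg_toP.
  apply: ereal_nondecreasing_is_cvgn => i j ij.
  by apply: lee_sum_nneg_natr => // k _ _; exact: density_ge0.
rewrite ge0_integral_bigcup//=.
- by apply/measurable_EFinP; exact: measurable_funTS.
- by move=> x _; rewrite lee_fin.
Qed.

HB.instance Definition _ := isMeasure.Build _ _ _ (density_measure mf f0)
  density0 density_ge0 density_sigma_additive.

Let integral_density_indic E : measurable E ->
  \int[density_measure mf f0]_x (\1_E x)%:E = \int[m]_x ((\1_E x)%:E * (f x)%:E).
Proof.
move=> mE; rewrite integral_indic//= /density_measure setIT [LHS]integral_mkcond/=.
apply: eq_integral => x _; rewrite patchE indicE; case: ifPn => _; rewrite ?mul1e//.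
by rewrite mul0e.
Qed.

Import HBNNSimple.

Let integral_density_nnsfun (h : {nnsfun T >-> R}) :
  \int[density_measure mf f0]_x (h x)%:E = \int[m]_x ((h x)%:E * (f x)%:E).
Proof.
under [LHS]eq_integral do rewrite fimfunE -fsumEFin//.
rewrite [LHS]ge0_integral_fsum//; last 2 first.
  - by move=> r; exact/measurable_EFinP/measurableT_comp.
  - by move=> n x _; rewrite EFinM nnfun_muleindic_ge0.
under [RHS]eq_integral.
  move=> x xD; rewrite fimfunE -fsumEFin// ge0_mule_fsuml; last first.
    by move=> r; rewrite EFinM nnfun_muleindic_ge0.
  over.
rewrite [RHS]ge0_integral_fsum//; last 2 first.
  - by move=> r; apply: emeasurable_funM; apply/measurable_EFinP => //; exact: measurableT_comp.
  - move=> n x _; apply: mule_ge0; last by rewrite lee_fin.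
    by rewrite EFinM nnfun_muleindic_ge0.
apply: eq_fsbigr => r; rewrite inE => -[x _ hxr].
have r0 : (0 <= r)%R by rewrite -hxr.
rewrite integralZl_indic_nnsfun// integral_density_indic// -ge0_integralZl_EFin//.
- by apply: eq_integral => y _; rewrite EFinM muleA.
- by move=> y _; rewrite mule_ge0 ?lee_fin.
- by apply: emeasurable_funM; apply/measurable_EFinP => //; exact: measurable_indic.
Qed.

Lemma ge0_integral_density (h : T -> \bar R) : measurable_fun setT h ->
  (forall x, 0 <= h x) ->
  \int[density_measure mf f0]_x h x = \int[m]_x (h x * (f x)%:E).
Proof.
move=> mh h0; pose h_ := nnsfun_approx measurableT mh.
have cvh x : (h_ n x)%:E @[n --> \oo] --> h x by exact: cvg_nnsfun_approx.
have mh_ n : measurable_fun setT (EFin \o h_ n) by exact/measurable_EFinP.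
have ndh x : {homo (fun n => (h_ n x)%:E) : i j / (i <= j)%N >-> i <= j}.
  by move=> i j ij; rewrite lee_fin; exact/lefP/nd_nnsfun_approx.
transitivity (limn (fun n => \int[density_measure mf f0]_x (h_ n x)%:E)).
  rewrite -monotone_convergence//=.
  - by apply: eq_integral => x _; apply/esym/cvg_lim => //; exact: cvh.
  - by move=> n x _; rewrite lee_fin.
transitivity (limn (fun n => \int[m]_x ((h_ n x)%:E * (f x)%:E))).
  by apply: congr_lim; apply/funext => n; exact: integral_density_nnsfun.
rewrite -monotone_convergence//=.
- apply: eq_integral => x _; apply/cvg_lim => //.
  by apply: cvgeZr => //; exact: cvh.
- by move=> n; apply: emeasurable_funM => //; exact/measurable_EFinP.
- by move=> n x _; rewrite mule_ge0// lee_fin.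
- by move=> x _ i j ij; rewrite lee_wpmul2r ?lee_fin//; exact: ndh.
Qed.

End density_measure.

(** The intervals []a, b]] form a generating pi-system, and each is a difference of two half-lines;
    finiteness makes the subtraction of their measures legitimate. *)
Lemma finite_measure_uniqueNy (R : realType)
    (m1 m2 : {measure set R -> \bar R}) :
  (m1 setT < +oo)%E -> (forall x : R, m1 `]-oo, x]%classic = m2 `]-oo, x]%classic) ->
  forall A, measurable A -> m1 A = m2 A.
Proof.
move=> m1fin m12.
have m1lt (A : set R) : measurable A -> (m1 A < +oo)%E.
  by move=> mA; apply: le_lt_trans m1fin; apply: le_measure; rewrite ?inE.
apply: (@measure_unique _ _ R (@ocitv R)
  (fun n => `](- n%:R)%R, n%:R]%classic) _ _ _ _ m1 m2) => //.
- exact: ocitvI.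
- by move=> n; exact: is_ocitv.
- apply/seteqP; split=> // x _; exists (Num.truncn `|x|).+1 => //=.
  have /ltr_normlP[h1 h2] := truncnS_gt `|x|.
  by rewrite in_itv/= ltrNl h1 ltW.
- move=> _ [[a b] _ <-] /=.
  have [ab|ba] := leP a b; last first.
    by rewrite set_itv_ge ?measure0// bnd_simp -leNgt ltW.
  have -> : `]a, b]%classic = `]-oo, b] `\` `]-oo, a].
    by rewrite -[RHS]setCK setCD setCitvl setUC -[LHS]setCK setCitv.
  have sub : `]-oo, a] `<=` `]-oo, b]%classic by exact: subset_itvl.
  have muD (m : {measure set R -> \bar R}) :
      (m `]-oo, b]%classic < +oo)%E ->
      m (`]-oo, b] `\` `]-oo, a]) = (m `]-oo, b]%classic - m `]-oo, a]%classic)%E.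
    by move=> mfin; rewrite measureD// setIidr.
  have m1b : (m1 `]-oo, b]%classic < +oo)%E by exact: m1lt.
  have m2b : (m2 `]-oo, b]%classic < +oo)%E by rewrite -m12.
  by rewrite (muD m1)// (muD m2)// !m12.
- by move=> k; exact: m1lt.
Qed.

Section distribution_lemmas.
Local Open Scope ereal_scope.
Context {d : measure_display} {T : measurableType d} {R : realType}
        (P : probability T R).

Lemma distribution_cdf_eq (X Y : {RV P >-> R}) (A : set R) : measurable A ->
  cdf X =1 cdf Y -> distribution P X A = distribution P Y A.
Proof.
move=> mA XY; apply: (@finite_measure_uniqueNy R (distribution P X) (distribution P Y)) => //.
by rewrite (le_lt_trans (probability_le1 _ _)) ?ltry.
Qed.

Lemma ge0_integral_distribution_density (X : {RV P >-> R}) (F f : R -> R) :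
  (forall x, cdf X x = (F x)%:E) -> measurable_fun setT f ->
  (forall x, (0 <= f x)%R) ->
  (forall x, (F x)%:E = \int[lebesgue_measure]_(z in `]-oo, x]) (f z)%:E) ->
  forall h : R -> \bar R, measurable_fun setT h -> (forall x, 0 <= h x) ->
  \int[distribution P X]_x h x = \int[lebesgue_measure]_x (h x * (f x)%:E).
Proof.
move=> cdfX mf f0 Ff h mh h0.
(* Lebesgue measure lives on [measurableTypeR R] and the law of [X] on [R]; pushing forward along
   the identity puts them on the same measurable type. *)
pose idR : measurableTypeR R -> R := idfun.
have midR : measurable_fun setT idR by move=> _ A mA; rewrite setTI.
pose leb := pushforward lebesgue_measure idR.
transitivity (\int[leb]_x (h x * (f x)%:E)); last first.
  rewrite /leb ge0_integral_pushforward//.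
    by apply: emeasurable_funM => //; exact/measurable_EFinP.
  by move=> x _; rewrite mule_ge0// lee_fin.
rewrite -(@ge0_integral_density _ R R leb f mf f0)//.
apply: eq_measure_integral => A mA _.
apply: (@finite_measure_uniqueNy R (distribution P X) (density_measure leb mf f0)) => //.
  by rewrite (le_lt_trans (probability_le1 _ _)) ?ltry.
move=> x; transitivity (\int[leb]_(z in `]-oo, x]) (f z)%:E) => //.
rewrite /leb ge0_integral_pushforward//=.
- by rewrite -[RHS]Ff -cdfX.
- exact/measurable_EFinP/measurable_funTS.
- by move=> y _; rewrite lee_fin.
Qed.

Lemma integral_distribution_density (X : {RV P >-> R}) (F f : R -> R) :
  (forall x, cdf X x = (F x)%:E) -> measurable_fun setT f ->
  (forall x, (0 <= f x)%R) ->
  (forall x, (F x)%:E = \int[lebesgue_measure]_(z in `]-oo, x]) (f z)%:E) ->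
  forall h : R -> \bar R, measurable_fun setT h ->
  \int[distribution P X]_x h x = \int[lebesgue_measure]_x (h x * (f x)%:E).
Proof.
move=> cdfX mf f0 Ff h mh; rewrite [LHS]integralE [RHS]integralE.
rewrite !(ge0_integral_distribution_density cdfX mf f0 Ff)//; last 2 first.
- exact: measurable_funeneg.
- exact: measurable_funepos.
congr (_ - _); apply: eq_integral => x _.
- by rewrite !funeposE muleC maxe_pMr ?lee_fin// mule0 muleC.
- by rewrite !funenegE muleC maxe_pMr ?lee_fin// mule0 muleN muleC.
Qed.

Lemma bounded_integrable (f : T -> R) (K : R) : measurable_fun setT f ->
  (forall x, (`|f x| <= K)%R) -> P.-integrable setT (EFin \o f).
Proof.
move=> mf fK; apply: measurable_bounded_integrable => //.
  by rewrite (le_lt_trans (probability_le1 _ _)) ?ltry.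
exists K; split => [|M KM x _ /=]; first exact: num_real.
by rewrite (le_trans (fK x))// ltW.
Qed.

(** Adding the bound [K] makes the integrand nonnegative, so that Tonelli's theorem gives the
    measurability. *)
Lemma measurable_Rintegral_section (d1 : measure_display) (T1 : measurableType d1)
    (f : T1 * T -> R) (K : R) : measurable_fun setT f ->
  (forall p, (`|f p| <= K)%R) -> measurable_fun setT (fun t => (\int[P]_q f (t, q))%R).
Proof.
move=> mf fK.
have mfK : measurable_fun setT (fun p => (f p + K)%:E).
  by apply/measurable_EFinP; exact: measurable_funD.
have fK0 p : 0 <= (f p + K)%:E.
  by rewrite lee_fin -lerBlDr sub0r; have /ler_normlP[] := fK p; rewrite lerNl.
have mF := @measurable_fun_fubini_tonelli_F _ _ T1 T R P _ mfK fK0.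
have mF' := measurableT_comp (fine_measurable measurableT) mF.
have mf_ t : measurable_fun setT (fun q => f (t, q)).
  by apply: (measurableT_comp mf); exact: measurable_pair1.
have i_ t : P.-integrable setT (EFin \o (fun q => f (t, q))).
  by apply: (@bounded_integrable _ K).
rewrite (_ : (fun t => _) = fun t => (fine (fubini_F P (fun p => (f p + K)%:E) t) - K)%R).
  by apply: measurable_funB.
apply/funext => t; rewrite /fubini_F /Rintegral.
under [in RHS]eq_integral do rewrite EFinD.
rewrite integralD//; [|exact: i_|by exact: (@bounded_integrable (cst K) `|K|%R)].
rewrite integral_cst// [X in K%:E * X]probability_setT mule1.
have fi : \int[P]_x (f (t, x))%:E \is a fin_num by apply: integrable_fin_num => //; exact: i_.
by rewrite [X in (_ = X - _)%R]fineD//= addrK.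
Qed.

Lemma ge0_integral_independent2 (d1 d2 : measure_display)
    (T1 : measurableType d1) (T2 : measurableType d2)
    (V : T -> T1) (Y : T -> T2) (nu : probability T2 R) :
  measurable_fun setT V -> measurable_fun setT Y ->
  (forall A B, measurable A -> measurable B ->
    P (V @^-1` A `&` Y @^-1` B) = P (V @^-1` A) * nu B) ->
  forall h : T1 * T2 -> \bar R, measurable_fun setT h -> (forall p, 0 <= h p) ->
  \int[P]_w h (V w, Y w) = \int[P]_w \int[nu]_p h (V w, p).
Proof.
move=> mV mY ind h mh h0.
have mVY : measurable_fun setT (fun w => (V w, Y w)) by exact: measurable_fun_pair.
pose Vm : {mfun T >-> T1} := mfun_Sub (mem_set mV).
pose VYm : {mfun T >-> (T1 * T2)%type} := mfun_Sub (mem_set mVY).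
transitivity (\int[distribution P VYm]_q h q); first by rewrite ge0_integral_pushforward.
have -> : \int[distribution P VYm]_q h q = \int[distribution P Vm \x nu]_q h q.
  apply: (@eq_measure_integral _ _ _ setT (distribution P Vm \x nu) (distribution P VYm)) => E mE _.
  symmetry.
  apply: (@product_measure_unique _ _ _ _ _ (distribution P Vm) nu (distribution P VYm)) => //.
rewrite fubini_tonelli1// ge0_integral_pushforward//.
  exact: measurable_fun_fubini_tonelli_F.
by move=> x _; apply: integral_ge0.
Qed.

Lemma ge0_integral_independent (d1 d2 d3 : measure_display)
    (T1 : measurableType d1) (T2 : measurableType d2) (T3 : measurableType d3)
    (V : T -> T1) (S : T -> T2) (X : T -> T3)
    (m2 : probability T2 R) (m3 : probability T3 R) :
  measurable_fun setT V -> measurable_fun setT S -> measurable_fun setT X ->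
  (forall A B C, measurable A -> measurable B -> measurable C ->
    P (V @^-1` A `&` (S @^-1` B `&` X @^-1` C)) = P (V @^-1` A) * (m2 B * m3 C)) ->
  forall h : T1 * (T2 * T3) -> \bar R, measurable_fun setT h -> (forall p, 0 <= h p) ->
  \int[P]_w h (V w, (S w, X w)) = \int[P]_w \int[m2 \x m3]_p h (V w, p).
Proof.
move=> mV mS mX ind h mh h0.
have mSX : measurable_fun setT (fun w => (S w, X w)) by exact: measurable_fun_pair.
have mVSX : measurable_fun setT (fun w => (V w, (S w, X w))) by exact: measurable_fun_pair.
(* The hypothesis covers only rectangles in the last two variables. If [V] falls in [A] with
   positive probability, the conditional law of [(S, X)] is a measure that agrees with the product
   on rectangles, hence on every [D]; otherwise both sides vanish. *)
have ind2 A D : measurable A -> measurable D ->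
    P (V @^-1` A `&` (fun w => (S w, X w)) @^-1` D) = P (V @^-1` A) * (m2 \x m3) D.
  move=> mA mD.
  have mVA : measurable (V @^-1` A) by rewrite -[X in measurable X]setTI; exact: mV.
  have mSXD : measurable ((fun w => (S w, X w)) @^-1` D).
    by rewrite -[X in measurable X]setTI; exact: mSX.
  have [pA0|pAn0] := eqVneq (P (V @^-1` A)) 0.
    rewrite pA0 mul0e; apply/eqP; rewrite eq_le measure_ge0 andbT -pA0.
    by apply: le_measure; rewrite ?inE//; exact: measurableI.
  pose p := fine (P (V @^-1` A)).
  have pE : P (V @^-1` A) = p%:E by rewrite fineK// fin_num_measure.
  have p0 : (0 < p)%R.
    by rewrite -lte_fin -pE lt0e pAn0 measure_ge0.
  have pV0 : (0 <= p^-1)%R by rewrite invr_ge0 ltW.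
  have m'E E : mscale (NngNum pV0) (pushforward (mrestr P mVA) (fun w => (S w, X w))) E =
      p^-1%:E * P (V @^-1` A `&` (fun w => (S w, X w)) @^-1` E).
    by rewrite /mscale/= /pushforward /mrestr setIC.
  have -> : (m2 \x m3) D = p^-1%:E * P (V @^-1` A `&` (fun w => (S w, X w)) @^-1` D).
    rewrite -(m'E mSX); apply: product_measure_unique => // B C mB mC.
    by rewrite [LHS]m'E ind// pE muleA -EFinM mulVf ?mul1e// gt_eqF.
  by rewrite pE muleA -EFinM divff ?mul1e// gt_eqF.
exact: (@ge0_integral_independent2 _ _ T1 (T2 * T3)%type V (fun w => (S w, X w)) (m2 \x m3)).
Qed.

End distribution_lemmas.

(** * The recursion and the value of one step *)

Section one_step.
Context {d : measure_display} {T : measurableType d} {R : realType}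
        {P : probability T R} (D : problem P).
Hypotheses (streamsD : renewal_reward_streams D) (payoffD : payoff_assumptions D)
  (Ft0 : F D (t0 D) < 1) (Ff : has_density (F D) (density D)).

Local Notation mu := lebesgue_measure.
Local Notation t0 := (t0 D).
Local Notation S0 := (holding D stream3 0%N).
Local Notation muS := (distribution P S0).
Local Notation muX := (distribution P (X3 D)).
Local Notation nu := (muS \x muX)%E.

Lemma muSE (h : R -> \bar R) : measurable_fun setT h ->
  (\int[muS]_z h z = \int[mu]_z (h z * (density D z)%:E))%E.
Proof.
move=> mh; case: Ff => mf f0 FE.
by apply: integral_distribution_density mh => //; exact: holding_cdfE.
Qed.

Lemma FE x : (F D x)%:E = muS `]-oo, x]%classic.
Proof. by rewrite /F -(holding_cdfE streamsD stream3 0%N). Qed.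

Lemma F_ge0 x : 0 <= F D x.
Proof. by rewrite -lee_fin FE. Qed.

Lemma F_le1 x : F D x <= 1.
Proof. by rewrite -lee_fin FE probability_le1. Qed.

Lemma F_nd x y : x <= y -> F D x <= F D y.
Proof.
by move=> xy; rewrite -lee_fin !FE le_measure ?inE//; exact: subset_itvl.
Qed.

Lemma FbarE x : (Fbar D x)%:E = muS `]x, +oo[%classic.
Proof.
by rewrite /Fbar EFinB FE -setCitvl probability_setC.
Qed.

Lemma measurable_Fbar : measurable_fun setT (Fbar D).
Proof.
apply: measurable_funB => //; have -> : F D = fine \o cdf S0.
  by apply/funext => x; rewrite /= (holding_cdfE streamsD).
by apply: measurableT_comp => //; exact: cdf_measurable.
Qed.

Lemma Fbar_ge0 x : 0 <= Fbar D x.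
Proof. by rewrite subr_ge0 F_le1. Qed.

Lemma Fbar_le1 x : Fbar D x <= 1.
Proof. by rewrite /Fbar lerBlDr lerDl F_ge0. Qed.

Lemma Fbar_gt0 x : x <= t0 -> 0 < Fbar D x.
Proof. by move=> xt0; rewrite subr_gt0 (le_lt_trans _ Ft0)// F_nd. Qed.

Lemma muS_set1 u : muS [set u] = 0%E.
Proof.
have mu1 : measurable ([set u] : set R) by exact: measurable_set1.
have m1 : measurable_fun setT (fun z : R => (\1_[set u] z : R)%:E).
  by apply/measurable_EFinP; exact: measurable_indic.
transitivity (\int[muS]_z (\1_[set u] z)%:E)%E; first by rewrite integral_indic// setIT.
rewrite muSE//; transitivity (\int[mu]_(z in [set u]) (density D z)%:E)%E.
  rewrite [RHS]integral_mkcond; apply: eq_integral => z _.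
  rewrite patchE indicE; case: ifPn => _; first by rewrite mul1e.
  by rewrite mul0e.
exact: integral_set1.
Qed.

Lemma muS_lt0 : muS [set z | z < 0] = 0%E.
Proof.
rewrite /distribution /pushforward (_ : _ @^-1` _ = set0) ?measure0//.
apply/seteqP; split => w //=.
by rewrite ltNge (holding_ge0 streamsD).
Qed.

Lemma muX_lt0 : muX [set z | z < 0] = 0%E.
Proof.
rewrite /distribution /pushforward (_ : _ @^-1` _ = set0) ?measure0//.
apply/seteqP; split => w //=.
by rewrite ltNge (reward_ge0 streamsD).
Qed.

(** The value [u] is excluded because [psi] jumps when its deadline crosses the holding time [p.1];
    the density leaves no mass at a point. *)
Lemma nu_ae (u : R) : {ae nu, forall p, [/\ 0 <= p.1, 0 <= p.2 & p.1 <> u]}.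
Proof.
have mlt : measurable [set z : R | z < 0].
  by rewrite (_ : [set z | _] = `]-oo, 0[%classic)//; apply/seteqP; split => z; rewrite /= in_itv.
have mu1 : measurable ([set u] : set R) by exact: measurable_set1.
have n1 : nu.-negligible ([set z : R | z < 0] `*` (setT : set R)).
  apply/negligibleP; first exact: measurableX.
  transitivity (muS [set z | (z < 0)%R] * muX setT)%E; first exact: product_measure1E.
  by rewrite muS_lt0 mul0e.
have n2 : nu.-negligible ((setT : set R) `*` [set z : R | z < 0]).
  apply/negligibleP; first exact: measurableX.
  transitivity (muS setT * muX [set z | (z < 0)%R])%E; first exact: product_measure1E.
  by rewrite muX_lt0 mule0.
have n3 : nu.-negligible ([set u] `*` (setT : set R)).
  apply/negligibleP; first exact: measurableX.
  transitivity (muS [set u] * muX setT)%E; first exact: product_measure1E.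
  by rewrite muS_set1 mul0e.
apply: negligibleS (negligibleU (negligibleU n1 n2) n3) => p /= np.
apply: contrapT => nN; apply: np; split.
- by rewrite leNgt; apply/negP => p1; apply: nN; left; left.
- by rewrite leNgt; apply/negP => p2; apply: nN; left; right.
- by move=> p1; apply: nN; right.
Qed.

(* [gb] and [cb] with arguments clamped to the ranges where the assumptions hold. *)
Definition gbc (x : R) : R := gb D (Num.max x 0).
Definition cbc (t : R) : R := cb D (Num.min (Num.max t 0) t0).

(** Measurability replaces the continuity of [in_BB]: it passes to the iterates [yb j] through the
    measurable maximizers, so that no continuity of [Phi delta] has to be shown. *)
Definition bounded_meas (delta : R -> R -> R -> R) : Prop :=
  (exists K, forall a b c, dom D (a, b, c) -> `|delta a b c| <= K) /\
  measurable_fun (dom D) (fun p : R * R * R => delta p.1.1 p.1.2 p.2).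

(** Nothing is known of [delta] off [dom]; the extension by zero is bounded and measurable
    everywhere, so it can be integrated over all holding times and rewards. *)
Definition on_dom (delta : R -> R -> R -> R) (p : R * R * R) : R :=
  ((fun p : R * R * R => delta p.1.1 p.1.2 p.2) \_ (dom D)) p.

(* The integrand, in the next holding time and reward, obtained from [phi] by
   integrating the cost by parts. *)
Definition psi (delta : R -> R -> R -> R) (a b c u : R) (p : R * R) : R :=
  (if p.1 <= u then gbc (a + p.2) - gbc a + on_dom delta (a + p.2, b + p.1, c - p.1)
   else 0) - (cbc (b + Num.min p.1 u) - cbc b).

Lemma gbcE x : 0 <= x -> gbc x = gb D x.
Proof. by move=> x0; rewrite /gbc max_l. Qed.

Lemma cbcE t : 0 <= t <= t0 -> cbc t = cb D t.
Proof. by move=> /andP[h1 h2]; rewrite /cbc max_l// min_l. Qed.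

Lemma t0_ge0 : 0 <= t0. Proof. exact/ltW/t0_gt0. Qed.

Lemma clamp_range (t : R) : 0 <= Num.min (Num.max t 0) t0 <= t0.
Proof. by rewrite le_min le_max lexx orbT t0_ge0 ge_min lexx orbT. Qed.

Lemma measurable_max0 : measurable_fun setT (fun x : R => Num.max x 0).
Proof. by apply: measurable_maxr; [exact: measurable_id|exact: measurable_cst]. Qed.

Lemma measurable_gbc : measurable_fun setT gbc.
Proof.
have mI : measurable (`[0, +oo[ : set R) by exact: measurable_itv.
have mg : measurable_fun (`[0, +oo[ : set R) (gb D).
  by apply: subspace_continuous_measurable_fun => //; exact: gb_continuous.
apply: (measurable_comp mI) mg measurable_max0.
by move=> _ [x _ <-] /=; rewrite in_itv/= andbT le_max lexx orbT.
Qed.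

Lemma measurable_cbc : measurable_fun setT cbc.
Proof.
have mI : measurable (`[0, t0] : set R) by exact: measurable_itv.
have mg : measurable_fun (`[0, t0] : set R) (cb D).
  by apply: subspace_continuous_measurable_fun => //; exact: cb_continuous.
apply: (measurable_comp mI) mg _.
  by move=> _ [x _ <-] /=; rewrite in_itv/= clamp_range.
by apply: measurable_minr; [exact: measurable_max0|exact: measurable_cst].
Qed.

Lemma gbc_ge0 x : 0 <= gbc x.
Proof. by apply: (gb_ge0 payoffD); rewrite le_max lexx orbT. Qed.

Lemma gbc_bounded : exists K, forall x, gbc x <= K.
Proof.
have [K gK] := gb_bounded payoffD.
by exists K => x; apply: gK; rewrite le_max lexx orbT.
Qed.

Lemma cbc_range t : 0 <= cbc t <= Cb D.
Proof. exact: cb_range payoffD _ (clamp_range t). Qed.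

Lemma measurable_dom : measurable (dom D).
Proof.
have m1 : measurable_fun setT (fun p : R * R * R => p.1.1).
  by apply: measurableT_comp; exact: measurable_fst.
have m2 : measurable_fun setT (fun p : R * R * R => p.1.2).
  by apply: measurableT_comp; [exact: measurable_snd|exact: measurable_fst].
have m3 : measurable_fun setT (fun p : R * R * R => p.2) by exact: measurable_snd.
pose f (p : R * R * R) := [&& 0 <= p.1.1, 0 <= p.1.2, 0 <= p.2 & p.1.2 + p.2 <= t0].
have -> : dom D = setT `&` f @^-1` [set true].
  by rewrite setTI; apply/seteqP; split => p; rewrite /dom/= /f => /and4P.
suff mf : measurable_fun setT f by exact: mf.
by do 3?apply: measurable_and; apply: measurable_fun_ler => //; exact: measurable_funD.
Qed.

Lemma measurable_on_dom delta : bounded_meas delta -> measurable_fun setT (on_dom delta).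
Proof. by move=> [_ md]; apply/(measurable_restrictT _ measurable_dom). Qed.

Lemma on_dom_bounded delta K : (forall a b c, dom D (a, b, c) -> `|delta a b c| <= K) ->
  0 <= K -> forall p, `|on_dom delta p| <= K.
Proof.
move=> dK K0 -[[a b] c]; rewrite /on_dom patchE; case: ifPn => [|_]; last by rewrite normr0.
by rewrite inE; exact: dK.
Qed.

Lemma measurable_psi delta d' (T' : measurableType d') (a b c u z x : T' -> R) :
  bounded_meas delta -> measurable_fun setT a -> measurable_fun setT b ->
  measurable_fun setT c -> measurable_fun setT u -> measurable_fun setT z ->
  measurable_fun setT x ->
  measurable_fun setT (fun t => psi delta (a t) (b t) (c t) (u t) (z t, x t)).
Proof.
move=> nd ma mb mc mu_ mz mx; apply: measurable_funB; last first.
  apply: measurable_funB; apply: (measurableT_comp measurable_cbc) => //.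
  by apply: measurable_funD => //; exact: measurable_minr.
apply: measurable_fun_ifT => //=; first exact: measurable_fun_ler.
apply: measurable_funD.
  by apply: measurable_funB; apply: (measurableT_comp measurable_gbc) => //; exact: measurable_funD.
apply: (measurableT_comp (measurable_on_dom nd)).
by do 2?apply: measurable_fun_pair => /=; [exact: measurable_funD..|exact: measurable_funB].
Qed.

Lemma psi_bounded delta : bounded_meas delta ->
  exists K, forall a b c u p, `|psi delta a b c u p| <= K.
Proof.
move=> [[K dK] _]; have [G gG] := gbc_bounded.
have K0 : `|delta 0 0 0| <= K by apply: dK; split => //=; rewrite ?addr0 ?t0_ge0.
exists (G + K + Cb D) => a b c u p; rewrite /psi.
have := on_dom_bounded dK (le_trans (normr_ge0 _) K0) (a + p.2, b + p.1, c - p.1).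
have /andP[h1 h2] := cbc_range (b + Num.min p.1 u).
have /andP[h3 h4] := cbc_range b.
have := gbc_ge0 (a + p.2); have := gG (a + p.2).
have := gbc_ge0 a; have := gG a.
move: (on_dom _ _) (gbc _) (gbc _) => q g1 g2 ? ? ? ? /ler_normlP[? ?].
by case: ifP => _; apply/ler_normlP; split; lra.
Qed.

Lemma cbc_continuous : continuous cbc.
Proof.
suff main (y : R) : cbc x @[x --> y] --> cbc y by move=> y; exact: main.
pose cl (x : R) := Num.min (Num.max x 0) t0.
have clc : cl x @[x --> y] --> cl y.
  apply: (@continuous_min _ _ _ _ y); last exact: cvg_cst.
  by apply: continuous_max; [exact: cvg_id|exact: cvg_cst].
have cly : `[0, t0]%classic (cl y) by rewrite /= in_itv/= clamp_range.
have clS : cl x @[x --> y] --> (cl y : subspace `[0, t0]).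
  have FF : Filter (cl x @[x --> y]) by exact: fmap_filter.
  apply/(@subspace_cvgP _ _ _ (cl y) FF cly) => B /clc.
  apply: (@filterS _ (nbhs y) _ _ (fun x => B (cl x))) => x; apply.
  by rewrite /= in_itv/= clamp_range.
have cc := cb_continuous payoffD; have ccl := cc (cl y).
exact: (cvg_comp cl (cb D) clS ccl).
Qed.

Lemma cb'_shift_integrable b v : 0 <= b -> b + v <= t0 ->
  mu.-integrable `[0, v] (fun z => (derive1 (cb D) (b + z))%:E).
Proof.
move=> b0 bv; have mI : measurable (`[b, b + v] : set R) by exact: measurable_itv.
have mI0 : measurable (`[0, t0] : set R) by exact: measurable_itv.
have sub : `[b, (b + v)%R] `<=` `[0, t0].
  by move=> x; rewrite /= !in_itv/= => /andP[h1 h2]; apply/andP; split; lra.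
have := @integrableS _ _ _ mu _ _ _ mI0 mI sub (cb_derive_integrable payoffD).
move=> /(@integrable_shift _ b _ _ mI).
congr (is_true (mu.-integrable _ _)).
by apply/seteqP; split=> z; rewrite /= !in_itv/= lerDl lerD2l.
Qed.

(** The derivative of the cost need be neither continuous nor bounded, hence the use of
    [integral_derive1]. The clamped cost [cbc] supplies the continuity up to the end points. *)
Lemma integral_cb' b v : 0 <= b -> 0 <= v -> b + v <= t0 ->
  (\int[mu]_(z in `]0%R, v[) (derive1 (cb D) (b + z))%:E = (cb D (b + v) - cb D b)%:E)%E.
Proof.
move=> b0; rewrite le_eqVlt => /predU1P[<- _|v0 bv].
  by rewrite set_itv_ge ?bnd_simp ?ltxx// integral_set0 addr0 subrr.
pose g z := cb D (b + z).
have dcb z : 0 < z < v -> derivable (cb D) (b + z) 1.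
  by move=> /andP[z0 zv]; apply: (cb_derivable payoffD); apply/andP; split; lra.
have dg z : 0 < z < v -> is_derive z 1 g (derive1 (cb D) (b + z)).
  move=> zv.
  have E : (fun h : R => h^-1 *: ((cb D \o shift (b + z)) (h *: 1) - cb D (b + z))) =
           (fun h : R => h^-1 *: ((g \o shift z) (h *: 1) - g z)).
    by apply/funext => h; rewrite /g /= addrCA.
  have -> : derive1 (cb D) (b + z) = 'D_1 g z by rewrite derive1E /derive E.
  by apply: DeriveDef => //; have := dcb z zv; rewrite /derivable E.
have g'E z : z \in `]0, v[%classic -> (derive1 (cb D) (b + z))%:E = (derive1 g z)%:E.
  rewrite inE/= in_itv/= => /dg h.
  by rewrite (derive1E g); have [_ ->] := h.
transitivity (\int[mu]_(z in `]0%R, v[) (derive1 g z)%:E)%E.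
  by apply: eq_integral => z; exact: g'E.
rewrite (@integral_derive1 R g 0 v v0).
- by rewrite /g addr0.
- apply: (@subspace_eq_continuous _ _ _ (fun z => cbc (b + z))).
    by move=> z; rewrite inE/= in_itv/= => /andP[h1 h2]; apply: cbcE; apply/andP; split; lra.
  apply: continuous_subspaceT => z.
  by apply: continuous_comp; [apply: cvgD; [exact: cvg_cst|exact: cvg_id]|exact: cbc_continuous].
- by move=> z /dg[].
- have mI : measurable (`]0, v[ : set R) by exact: measurable_itv.
  have mI2 : measurable (`[0, v] : set R) by exact: measurable_itv.
  have sub : `]0, v[ `<=` `[0, v] by exact: subset_itv_oo_cc.
  have := @integrableS _ _ _ mu _ _ _ mI2 mI sub (cb'_shift_integrable b0 bv).
  exact: (@eq_integrable _ _ _ mu _ mI _ _ g'E).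
Qed.

Lemma muS_ae (u : R) : {ae muS, forall z, 0 <= z /\ z <> u}.
Proof.
have mlt : measurable [set z : R | z < 0].
  by rewrite (_ : [set z | _] = `]-oo, 0[%classic)//; apply/seteqP; split => z; rewrite /= in_itv.
have n1 : muS.-negligible [set z : R | z < 0].
  by apply/negligibleP => //; exact: muS_lt0.
have n2 : muS.-negligible [set u].
  by apply/negligibleP; [exact: measurable_set1|exact: muS_set1].
apply: negligibleS (negligibleU n1 n2) => z /= np.
apply: contrapT => nN; apply: np; split.
- by rewrite leNgt; apply/negP => p1; apply: nN; left.
- by move=> p1; apply: nN; right.
Qed.

(** Integration by parts in the form of Fubini's theorem: [Fbar z] is the probability that the
    holding time exceeds [z], so both sides are iterated integrals of the derivative over the pairs
    [z < s] with [0 < z < u]. *)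
Lemma integral_Fbar_cb' b u : 0 <= b -> 0 <= u -> b + u <= t0 ->
  (\int[mu]_(z in `[0%R, u]) (Fbar D z * derive1 (cb D) (b + z))%:E =
   \int[muS]_z (cbc (b + Num.min z u) - cbc b)%:E)%E.
Proof.
move=> b0 u0 bu.
have mI : measurable (`]0, u[ : set R) by exact: measurable_itv.
have mI2 : measurable (`[0, u] : set R) by exact: measurable_itv.
have icl := cb'_shift_integrable b0 bu.
have iop : mu.-integrable `]0, u[ (fun z => (derive1 (cb D) (b + z))%:E).
  by apply: (@integrableS _ _ _ mu _ _ _ mI2 mI) icl; exact: subset_itv_oo_cc.
pose k : R -> R := (fun z => derive1 (cb D) (b + z)) \_ `]0, u[.
have mk : measurable_fun setT k.
  by apply/(measurable_restrictT _ mI); case/integrableP: iop => /measurable_EFinP.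
have ik : mu.-integrable setT (EFin \o k).
  rewrite /k -restrict_EFin; apply/integrable_restrict => //=.
  by rewrite setTI.
pose f (p : measurableTypeR R * R) : \bar R := (if (p.1 : R) < p.2 then k p.1 else 0)%:E.
have mf : measurable_fun setT f.
  apply/measurable_EFinP; apply: measurable_fun_ifT => //.
    by apply: measurable_fun_ltr; [exact: measurable_fst|exact: measurable_snd].
  by apply: (measurableT_comp mk); exact: measurable_fst.
have intf : (mu \x muS)%E.-integrable setT f.
  apply/integrable12ltyP => //.
  case/integrableP: (ik) => _; apply: le_lt_trans.
  apply: ge0_le_integral => //.
  - by move=> z _; exact: integral_ge0.
  - have mf' : measurable_fun setT (fun p => `|f p|)%E by exact: measurableT_comp.
    by apply: (measurable_fun_fubini_tonelli_F _ mf') => p; exact: abse_ge0.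
  - by apply: measurableT_comp => //; exact/measurable_EFinP.
  - move=> z _ /=.
    apply: (@le_trans _ _ (\int[muS]_s `|(k z)%:E|)%E).
      apply: ge0_le_integral => //.
      + have mfz : measurable_fun setT (fun x => f (z, x)).
          by apply: (measurableT_comp mf); exact: measurable_pair1.
        have : measurable_fun setT (abse \o (fun x => f (z, x))) by exact: measurableT_comp.
        exact.
      + move=> s _; rewrite /f/= lee_fin; case: ifP => // _.
        by rewrite normr0.
    by rewrite integral_cst// [X in (_ * X)%E]probability_setT mule1.
have := Fubini intf.
have -> : (\int[mu]_x \int[muS]_y f (x, y) =
    \int[mu]_(z in `[0%R, u]) (Fbar D z * derive1 (cb D) (b + z))%:E)%E.
  (* The end points are Lebesgue-null. For [z] strictly between them, integrating out [s] leaves the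
     derivative times the mass of []z, +oo[]. *)
  transitivity (\int[mu]_(z in `]0%R, u[) (Fbar D z * derive1 (cb D) (b + z))%:E)%E.
    rewrite [RHS]integral_mkcond; apply: eq_integral => z _.
    rewrite patchE /f /k /= patchE; case: ifPn => zu; last first.
      by under eq_integral do rewrite if_same; rewrite integral0.
    transitivity (\int[muS]_s ((derive1 (cb D) (b + z))%:E * (\1_(`]z, +oo[%classic) s)%:E))%E.
      apply: eq_integral => s _; rewrite indicE -EFinM; congr EFin.
      case: ifPn => zs; first by rewrite mem_set ?mulr1//= in_itv/= zs.
      by rewrite memNset ?mulr0//= in_itv/= (negbTE zs).
    rewrite integralZl//; last first.
      apply: (@bounded_integrable _ _ _ muS _ 1); first exact: measurable_indic.
      by move=> s; rewrite indicE; case: (_ \in _); rewrite ?normr0 ?normr1.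
    rewrite integral_indic// setIT [RHS]EFinM muleC; congr (_ * _)%E.
    exact/esym/FbarE.
  have mFc : measurable_fun (`[0, u] : set R) (fun z => (Fbar D z * derive1 (cb D) (b + z))%:E).
    apply/measurable_EFinP; apply: measurable_funM; first exact: measurable_funTS measurable_Fbar.
    by case/integrableP: icl => /measurable_EFinP.
  rewrite integral_itv_obnd_cbnd ?integral_itv_bndo_bndc//.
    by apply: measurable_funS mFc => //; exact: subset_itv_co_cc.
  by apply: measurable_funS mFc => //; exact: subset_itv_oo_cc.
move=> ->; apply: ae_eq_integral => //.
- exact: (measurable_fubini_G intf).
- apply/measurable_EFinP; apply: measurable_funB; apply: (measurableT_comp measurable_cbc) => //.
  by apply: measurable_funD => //; exact: measurable_minr.
(* For [s >= 0] the other order integrates the derivative over []0, min s u[], where [integral_cb']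
   applies. *)
- have := muS_ae 0; apply: filterS => s [s0 _] _.
  have v0 : 0 <= Num.min s u by rewrite le_min s0.
  have bv : b + Num.min s u <= t0 by rewrite (le_trans _ bu)// lerD2l ge_min lexx orbT.
  have bt : 0 <= b <= t0 by rewrite b0 (le_trans _ bu)// lerDl.
  have bst : 0 <= b + Num.min s u <= t0 by rewrite addr_ge0.
  rewrite (cbcE bt) (cbcE bst).
  rewrite -integral_cb'// [RHS]integral_mkcond.
  apply: eq_integral => z _; rewrite /f /k /= !patchE !mem_setE !in_itv/= lt_min.
  by case: (z < s); case: (0 < z); case: (z < u).
Qed.

Let psi1 delta (a b c : R) (p : R * R) : R :=
  gbc (a + p.2) - gbc a + on_dom delta (a + p.2, b + p.1, c - p.1).

Let measurable_psi1 delta a b c : bounded_meas delta -> measurable_fun setT (psi1 delta a b c).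
Proof.
move=> nd; have m1 : measurable_fun setT (fun p : R * R => p.1) by exact: measurable_fst.
have m2 : measurable_fun setT (fun p : R * R => p.2) by exact: measurable_snd.
apply: measurable_funD.
  apply: measurable_funB => //; apply: (measurableT_comp measurable_gbc) => //.
  exact: measurable_funD.
apply: (measurableT_comp (measurable_on_dom nd)).
by do 2?apply: measurable_fun_pair => /=; [exact: measurable_funD..|exact: measurable_funB].
Qed.

Let psi1_bounded delta a b c : bounded_meas delta -> exists K, forall p, `|psi1 delta a b c p| <= K.
Proof.
move=> [[K dK] _]; have [G gG] := gbc_bounded.
have K0 : `|delta 0 0 0| <= K by apply: dK; split => //=; rewrite ?addr0 ?t0_ge0.
exists (G + K) => p; rewrite /psi1.
have := on_dom_bounded dK (le_trans (normr_ge0 _) K0) (a + p.2, b + p.1, c - p.1).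
have := gbc_ge0 (a + p.2); have := gG (a + p.2).
have := gbc_ge0 a; have := gG a.
move: (on_dom _ _) (gbc _) (gbc _) => q g1 g2 ? ? ? ? /ler_normlP[? ?].
by apply/ler_normlP; split; lra.
Qed.

Lemma on_domE delta a b c : dom D (a, b, c) -> on_dom delta (a, b, c) = delta a b c.
Proof. by move=> dp; rewrite /on_dom patchE mem_set. Qed.

(** Rewards are nonnegative and [z <= c], so the arguments of [gb] and [delta] stay in the ranges
    where neither the clamping nor the extension by zero changes anything. *)
Let psi1E delta a b c z : bounded_meas delta -> dom D (a, b, c) -> 0 <= z <= c ->
  Delta D a + fine 'E_P[fun w => delta (a + X3 D w) (b + z) (c - z)] =
  (\int[muX]_x psi1 delta a b c (z, x))%R.
Proof.
move=> nd [/= a0 b0 c0 bc] /andP[z0 zc].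
have X0 w : 0 <= X3 D w by exact: (reward_ge0 streamsD).
have mX : measurable_fun setT (fun w => a + X3 D w) by exact: measurable_funD.
have dz w : dom D (a + X3 D w, b + z, c - z) by split => /=; have := X0 w; lra.
have [K dK] := nd.1.
have K0 : `|delta 0 0 0| <= K by apply: dK; split => //=; rewrite ?addr0 ?t0_ge0.
have cK := on_dom_bounded dK (le_trans (normr_ge0 _) K0).
have i1 : P.-integrable setT (fun w => (gbc (a + X3 D w) - gbc a)%:E).
  have [G gG] := gbc_bounded; apply: (@bounded_integrable _ _ _ P _ G).
    by apply: measurable_funB => //; exact: (measurableT_comp measurable_gbc).
  move=> w; have := gbc_ge0 (a + X3 D w); have := gG (a + X3 D w).
  have := gbc_ge0 a; have := gG a => ? ? ? ?.
  by apply/ler_normlP; split; lra.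
have i2 : P.-integrable setT (fun w => (on_dom delta (a + X3 D w, b + z, c - z))%:E).
  apply: (@bounded_integrable _ _ _ P _ K) => //.
  apply: (measurableT_comp (measurable_on_dom nd)).
  by do 2?apply: measurable_fun_pair => /=.
have mp : measurable_fun setT (fun x => psi1 delta a b c (z, x)).
  by apply: (measurableT_comp (measurable_psi1 a b c nd)); exact: measurable_pair1.
have EE (f : T -> R) : ('E_P[f] = \int[P]_w (f w)%:E)%E by rewrite unlock.
rewrite /Delta !EE /Rintegral integral_distribution//; last 2 first.
- exact/measurable_EFinP.
- have [Kp pK] := psi1_bounded a b c nd.
  apply: (@bounded_integrable _ _ _ P _ Kp) => [|w]; last exact: pK.
  exact: (measurableT_comp mp).
rewrite (_ : (\int[P]_x ((fun x => (psi1 delta a b c (z, x))%:E) \o X3 D) x)%E =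
  (\int[P]_w ((gbc (a + X3 D w) - gbc a)%:E + (on_dom delta (a + X3 D w, b + z, c - z))%:E))%E)//.
rewrite integralD// [RHS]fineD ?integrable_fin_num//.
congr (fine _ + fine _).
  by apply: eq_integral => w _; rewrite !gbcE ?addr_ge0.
by apply: eq_integral => w _; rewrite on_domE.
Qed.

Let integrable_psi1 delta a b c : bounded_meas delta -> nu.-integrable setT (EFin \o psi1 delta a b c).
Proof.
move=> nd; have [K pK] := psi1_bounded a b c nd.
by apply: (@bounded_integrable _ _ _ nu _ K) => //; exact: measurable_psi1.
Qed.

Let G delta a b c z : R := (\int[muX]_x psi1 delta a b c (z, x))%R.

Let measurable_G delta a b c : bounded_meas delta -> measurable_fun setT (G delta a b c).
Proof.
move=> nd; apply: (measurableT_comp (fine_measurable _)) => //.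
exact: (measurable_fubini_F (integrable_psi1 a b c nd)).
Qed.

Let psi1_section delta a b c z : bounded_meas delta ->
  muX.-integrable setT (fun x => (psi1 delta a b c (z, x))%:E).
Proof.
move=> nd; have [K pK] := psi1_bounded a b c nd.
apply: (@bounded_integrable _ _ _ muX _ K) => //.
by apply: (measurableT_comp (measurable_psi1 a b c nd)); exact: measurable_pair1.
Qed.

Let G_bounded delta a b c : bounded_meas delta -> exists K, forall z, `|G delta a b c z| <= K.
Proof.
move=> nd; have [K pK] := psi1_bounded a b c nd; exists K => z.
have iz := psi1_section a b c z nd.
rewrite -lee_fin -[leLHS]/(`|(G delta a b c z)%:E|)%E /G /Rintegral fineK; last first.
  exact: integrable_fin_num.
apply: (le_trans (le_abse_integral _ _ _)) => //.
  exact: measurable_int iz.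
apply: (@le_trans _ _ (\int[muX]_x K%:E)%E).
  apply: ge0_le_integral => //.
  - by apply: measurableT_comp => //; exact: measurable_int iz.
  - by move=> x _; rewrite lee_fin; exact: pK.
by rewrite integral_cst// [X in (_ * X)%E]probability_setT mule1.
Qed.

Let integral_density_G delta a b c u : bounded_meas delta -> 
  (\int[mu]_(z in `[0%R, u]) (density D z * G delta a b c z)%:E =
   \int[muS]_z (if (z <= u)%R then G delta a b c z else 0%R)%:E)%E.
Proof.
move=> nd; have mG := measurable_G a b c nd.
have mle : measurable_fun setT (fun z : R => z <= u) by exact: measurable_fun_ler.
have mle0 : measurable_fun setT (fun z : R => 0 <= z <= u).
  by apply: measurable_and => //; exact: measurable_fun_ler.
transitivity (\int[muS]_z (if (0 <= z <= u)%R then G delta a b c z else 0%R)%:E)%E.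
  rewrite muSE; last by apply/measurable_EFinP; exact: measurable_fun_ifT.
  rewrite integral_mkcond; apply: eq_integral => z _.
  rewrite patchE mem_setE in_itv/=; case: ifP => _; last by rewrite mul0e.
  by rewrite -EFinM mulrC.
apply: ae_eq_integral => //.
- by apply/measurable_EFinP; exact: measurable_fun_ifT.
- by apply/measurable_EFinP; exact: measurable_fun_ifT.
- by have := muS_ae 0; apply: filterS => z [z0 _] _; rewrite z0.
Qed.

Let integrable_density u : mu.-integrable `[0, u] (EFin \o density D).
Proof.
case: Ff => mf f0 fE; apply/integrableP; split.
  by apply/measurable_EFinP; exact: measurable_funTS.
apply: (@le_lt_trans _ _ (F D u)%:E); last by rewrite ltry.
rewrite fE; under eq_integral do rewrite /= ger0_norm//.
apply: ge0_subset_integral => //=.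
- by apply/measurable_EFinP; exact: measurable_funTS.
- by move=> x _; rewrite lee_fin.
- by move=> x; rewrite /= !in_itv/= => /andP[].
Qed.

(** Up to [t0] the survival function is positive, as [F(t0) < 1], so its product with the hazard
    rate is the density and the first term becomes an integral against the law of the holding time.
    The cost term is [integral_Fbar_cb']. *)
Lemma phiE delta a b c u : bounded_meas delta -> dom D (a, b, c) -> 0 <= u <= c ->
  phi D delta a b c u = (\int[nu]_p psi delta a b c u p)%R.
Proof.
move=> nd dabc /andP[u0 uc]; have [/= a0 b0 c0 bc] := dabc.
have but : b + u <= t0 by rewrite (le_trans _ bc)// lerD2l.
have mI : measurable (`[0, u] : set R) by exact: measurable_itv.
have [K GK] := G_bounded a b c nd.
have mG := measurable_G a b c nd.
have [mf f0 fE] := Ff.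
have i1 : mu.-integrable `[0, u] (EFin \o (fun z => density D z * G delta a b c z)).
  have iK : mu.-integrable `[0, u] (fun z => K%:E * (density D z)%:E)%E.
    by apply: integrableZl => //; exact: integrable_density.
  apply: (@le_integrable _ _ _ mu _ mI) iK.
    by apply/measurable_EFinP; apply: measurable_funM; exact: measurable_funTS.
  move=> z _; rewrite /= lee_fin !normrM mulrC ler_wpM2r//.
  by rewrite (le_trans (GK z))// ler_norm.
have i2 : mu.-integrable `[0, u] (EFin \o (fun z => Fbar D z * derive1 (cb D) (b + z))).
  apply: (@le_integrable _ _ _ mu _ mI) (cb'_shift_integrable b0 but).
    apply/measurable_EFinP; apply: measurable_funM; first exact: measurable_funTS measurable_Fbar.
    by case/integrableP: (cb'_shift_integrable b0 but) => /measurable_EFinP.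
  move=> z _; rewrite /= lee_fin normrM ler_piMl// ger0_norm ?Fbar_ge0//.
  exact: Fbar_le1.
transitivity (\int[mu]_(z in `[0, u]) (density D z * G delta a b c z - Fbar D z * derive1 (cb D) (b + z))).
  apply: eq_Rintegral => z; rewrite inE/= in_itv/= => /andP[z0 zu].
  rewrite psi1E//; last by rewrite z0 (le_trans zu).
  rewrite /G mulrBr mulrA /hazard mulrCA mulfV ?mulr1//.
  by rewrite gt_eqF// Fbar_gt0// (le_trans zu)// (le_trans _ but)// lerDr.

rewrite RintegralB//.
pose A (p : R * R) := if p.1 <= u then psi1 delta a b c p else 0.
pose B (p : R * R) := cbc (b + Num.min p.1 u) - cbc b.
have m1 : measurable_fun setT (fun p : R * R => p.1) by exact: measurable_fst.
have iA : nu.-integrable setT (EFin \o A).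
  have [K' pK] := psi1_bounded a b c nd.
  apply: (@bounded_integrable _ _ _ nu _ K').
    by apply: measurable_fun_ifT => //; [exact: measurable_fun_ler|exact: measurable_psi1].
  by move=> p; rewrite /A; case: ifP => _; rewrite ?normr0 ?(le_trans _ (pK p)).
have iB : nu.-integrable setT (EFin \o B).
  apply: (@bounded_integrable _ _ _ nu _ (Cb D)).
    apply: measurable_funB => //; apply: (measurableT_comp measurable_cbc) => //.
    by apply: measurable_funD => //; exact: measurable_minr.
  move=> p; have /andP[h1 h2] := cbc_range (b + Num.min p.1 u).
  by have /andP[h3 h4] := cbc_range b; apply/ler_normlP; rewrite /B; split; lra.
rewrite (_ : (\int[nu]_p psi delta a b c u p)%R = (\int[nu]_p (A p - B p))%R)//.
rewrite RintegralB//; congr (fine _ - fine _).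
- rewrite integral_density_G// -(integral12_prod_meas1 iA).
  apply: eq_integral => z _; rewrite /fubini_F /A/=.
  case: ifP => _; last by rewrite integral0.
  by rewrite /G /Rintegral fineK// integrable_fin_num//; exact: psi1_section.
- rewrite integral_Fbar_cb'// -(integral12_prod_meas1 iB).
  apply: eq_integral => z _; rewrite /fubini_F /B/=.
  by rewrite integral_cst// [X in (_ * X)%E]probability_setT mule1.
Qed.

Lemma integrable_psi delta a b c u : bounded_meas delta -> nu.-integrable setT (EFin \o psi delta a b c u).
Proof.
move=> nd; have [K pK] := psi_bounded nd.
apply: (@bounded_integrable _ _ _ nu _ K) => //.
have -> : psi delta a b c u = (fun p => psi delta a b c u (p.1, p.2)).
  by apply/funext => -[].
exact: measurable_psi.
Qed.

(** Moving the deadline from [u] to [v] brings in [delta] only when the next event falls in []u,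
    v]], and there with a plus sign. This is the increasing differences condition behind the
    monotonicity of the maximizers. *)
Lemma phi_increment_le delta delta' a b c u v : bounded_meas delta -> bounded_meas delta' ->
  (forall a b c, dom D (a, b, c) -> delta a b c <= delta' a b c) ->
  dom D (a, b, c) -> 0 <= u -> u <= v -> v <= c ->
  phi D delta a b c v - phi D delta a b c u <= phi D delta' a b c v - phi D delta' a b c u.
Proof.
move=> nd nd' dd' dabc u0 uv vc.
rewrite !phiE ?u0 ?(le_trans u0 uv) ?(le_trans uv vc)//.
rewrite -!RintegralB//; try exact: integrable_psi.
apply: le_Rintegral => //.
- exact: (@integrableB _ _ _ nu _ _ _ _ (integrable_psi a b c v nd) (integrable_psi a b c u nd)).
- exact: (@integrableB _ _ _ nu _ _ _ _ (integrable_psi a b c v nd') (integrable_psi a b c u nd')).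
move=> p _; rewrite /psi.
have cdd q : on_dom delta q <= on_dom delta' q.
  rewrite /on_dom !patchE; case: ifPn => //; rewrite inE.
  by case: q => -[? ?] ? /=; exact: dd'.
have := cdd (a + p.2, b + p.1, c - p.1); move: (on_dom delta _) (on_dom delta' _) => q q'.
case: (leP p.1 u) => pu; case: (leP p.1 v) => pv; move=> ?; try lra.
Qed.

Lemma phi0 delta a b c : phi D delta a b c 0 = 0.
Proof. by rewrite /phi set_itv1 /Rintegral integral_set1. Qed.

Lemma phi_le delta delta' a b c u : bounded_meas delta -> bounded_meas delta' ->
  (forall a b c, dom D (a, b, c) -> delta a b c <= delta' a b c) ->
  dom D (a, b, c) -> 0 <= u <= c -> phi D delta a b c u <= phi D delta' a b c u.
Proof.
move=> nd nd' dd' dabc /andP[u0 uc].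
by have := phi_increment_le nd nd' dd' dabc (lexx 0) u0 uc; rewrite !phi0 !subr0.
Qed.

(** The two integrands differ only if the next event comes before the deadline, hence before [t0]:
    the contraction factor is the probability of a holding time of at most [t0]. *)
Lemma phi_contract delta delta' e a b c u : bounded_meas delta -> bounded_meas delta' ->
  (forall a b c, dom D (a, b, c) -> `|delta a b c - delta' a b c| <= e) ->
  dom D (a, b, c) -> 0 <= u <= c ->
  `|phi D delta a b c u - phi D delta' a b c u| <= F D t0 * e.
Proof.
move=> nd nd' dd' dabc /[dup] uc' /andP[u0 uc]; have [/= a0 b0 c0 bc] := dabc.
have e0 : 0 <= e by exact: le_trans (normr_ge0 _) (dd' _ _ _ dabc).
rewrite !phiE// -RintegralB//; try exact: integrable_psi.
have ii := @integrableB _ _ _ nu _ measurableT _ _ (integrable_psi a b c u nd) (integrable_psi a b c u nd').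
have mle : measurable_fun setT (fun p : R * R => p.1 <= t0).
  by apply: measurable_fun_ler => //; exact: measurable_fst.
apply: (le_trans (le_normr_Rintegral _ _)) => //.
have i1 : nu.-integrable setT (EFin \o (fun p : R * R => if p.1 <= t0 then e else 0)).
  apply: (@bounded_integrable _ _ _ nu _ e); first exact: measurable_fun_ifT.
  by move=> p; case: ifP => _; rewrite ?normr0// ger0_norm.
apply: (@le_trans _ _ (\int[nu]_p (if p.1 <= t0 then e else 0))).
  apply: le_Rintegral => //.
    exact: (integrable_abse ii).
  move=> p _; rewrite /psi.
  have cdd q : `|on_dom delta q - on_dom delta' q| <= e.
    rewrite /on_dom !patchE; case: ifPn => [|_]; last by rewrite subrr normr0.
    by rewrite inE; case: q => -[? ?] ? /=; exact: dd'.
  have := cdd (a + p.2, b + p.1, c - p.1); move: (on_dom delta _) (on_dom delta' _) => q q'.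
  case: (leP p.1 u) => pu /ler_normlP[? ?].
    have -> : p.1 <= t0 by lra.
    by apply/ler_normlP; split; lra.
  by case: ifP => _; apply/ler_normlP; split; lra.
rewrite /Rintegral -lee_fin fineK ?integrable_fin_num// -(integral12_prod_meas1 i1).
rewrite EFinM FE muleC -integral_cst//.
have mI : measurable (`]-oo, t0] : set R) by exact: measurable_itv.
rewrite [X in (_ <= X)%E]integral_mkcond le_eqVlt; apply/orP; left; apply/eqP.
apply: eq_integral => z _; rewrite /fubini_F/=.
rewrite integral_cst// [X in (_ * X)%E]probability_setT mule1.
by rewrite patchE mem_setE in_itv/=; case: ifP.
Qed.

Lemma phi_bounded delta : bounded_meas delta -> exists K, forall a b c u, dom D (a, b, c) ->
  0 <= u <= c -> `|phi D delta a b c u| <= K.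
Proof.
move=> nd; have [K pK] := psi_bounded nd.
exists K => a b c u dabc uc; rewrite phiE//.
have ip := integrable_psi a b c u nd.
rewrite -lee_fin -[leLHS]/(`|(\int[nu]_p psi delta a b c u p)%:E|)%E.
rewrite /Rintegral fineK; last exact: integrable_fin_num.
apply: (le_trans (le_abse_integral _ _ _)) => //.
  exact: measurable_int ip.
apply: (@le_trans _ _ (\int[nu]_x K%:E)%E).
  apply: ge0_le_integral => //.
  - by apply: measurableT_comp => //; exact: measurable_int ip.
  - by move=> x _; rewrite lee_fin; exact: pK.
by rewrite integral_cst// [X in (_ * X)%E]probability_setT mule1.
Qed.

Lemma phi_le_Phi delta a b c u : bounded_meas delta -> dom D (a, b, c) -> 0 <= u <= c ->
  phi D delta a b c u <= Phi D delta a b c.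
Proof.
move=> nd dabc uc; have [K pK] := phi_bounded nd.
apply: sup_upper_bound; last by exists u => //; rewrite /= in_itv.
split; first by exists (phi D delta a b c u), u => //; rewrite /= in_itv.
exists K => _ [v + <-]; rewrite /= in_itv/= => vc.
by rewrite (le_trans (ler_norm _))// pK.
Qed.

Lemma Phi_le delta a b c M : bounded_meas delta -> dom D (a, b, c) ->
  (forall u, 0 <= u <= c -> phi D delta a b c u <= M) -> Phi D delta a b c <= M.
Proof.
move=> nd [/= a0 b0 c0 bc] pM; apply: ge_sup.
  by exists (phi D delta a b c 0), 0 => //; rewrite /= in_itv/= lexx.
by move=> _ [v + <-]; rewrite /= in_itv/=; exact: pM.
Qed.

Lemma Phi_mono delta delta' e a b c : bounded_meas delta -> bounded_meas delta' ->
  (forall a b c, dom D (a, b, c) -> `|delta a b c - delta' a b c| <= e) ->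
  dom D (a, b, c) -> Phi D delta a b c <= Phi D delta' a b c + F D t0 * e.
Proof.
move=> nd nd' dd' dabc; apply: Phi_le => // u uc.
have := phi_le_Phi nd' dabc uc.
by have /ler_normlP[] := phi_contract nd nd' dd' dabc uc; lra.
Qed.

Lemma Phi_contract delta delta' e a b c : bounded_meas delta -> bounded_meas delta' ->
  (forall a b c, dom D (a, b, c) -> `|delta a b c - delta' a b c| <= e) ->
  dom D (a, b, c) -> `|Phi D delta a b c - Phi D delta' a b c| <= F D t0 * e.
Proof.
move=> nd nd' dd' dabc; have := Phi_mono nd nd' dd' dabc.
have dd2 a1 b1 c1 : dom D (a1, b1, c1) -> `|delta' a1 b1 c1 - delta a1 b1 c1| <= e.
  by rewrite distrC; exact: dd'.
have := Phi_mono nd' nd dd2 dabc => ? ?; apply/ler_normlP; split; lra.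
Qed.

Lemma dom_grid_floor n p : dom D p ->
  dom D (grid_floor n p.1.1, grid_floor n p.1.2, grid_floor n p.2).
Proof.
have tle (x : R) : 0 <= x -> 0 <= grid_floor n x <= x.
  move=> x0; rewrite /grid_floor divr_ge0//= ler_pdivrMr//.
  by have /truncn_itv/andP[] : 0 <= x * n.+1%:R by rewrite mulr_ge0.
move=> [/tle/andP[? ?] /tle/andP[? ?] /tle/andP[? ?] ?]; split => //=; lra.
Qed.

Lemma in_BB_bounded_meas delta : in_BB D delta -> bounded_meas delta.
Proof.
move=> [bd cd]; split => //; apply: within_continuous_measurable3 => //.
- exact: measurable_dom.
- by move=> p [].
- exact: dom_grid_floor.
Qed.

(** * The fixed point and the limit of the maximizers *)

Variables (y : R -> R -> R -> R) (r : nat -> R -> R -> R -> R).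
Hypotheses (y_fix : fixed_point D y) (r_max : maximizing_functions D r).

Lemma bounded_meas_y : bounded_meas y. Proof. exact/in_BB_bounded_meas/y_fix.1. Qed.

Lemma y_bound : exists2 K, 0 <= K & forall a b c, dom D (a, b, c) -> `|y a b c| <= K.
Proof.
have [[K yK] _] := y_fix.1; exists K => //.
by rewrite (le_trans (normr_ge0 (y 0 0 0)))//; apply: yK; split => //=; rewrite ?addr0 ?t0_ge0.
Qed.

Lemma yE a b c : dom D (a, b, c) -> y a b c = Phi D y a b c.
Proof. exact: y_fix.2. Qed.

Lemma y_ge0 a b c : dom D (a, b, c) -> 0 <= y a b c.
Proof.
move=> dabc; rewrite yE// -(phi0 y a b c); apply: phi_le_Phi => //; first exact: bounded_meas_y.
by case: dabc => /= _ _ c0 _; rewrite lexx.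
Qed.

Lemma phi_le_y a b c u : dom D (a, b, c) -> 0 <= u <= c -> phi D y a b c u <= y a b c.
Proof. by move=> dabc uc; rewrite yE//; apply: phi_le_Phi => //; exact: bounded_meas_y. Qed.

(** The integrand [psi] is jointly measurable in the state, the deadline and the next event, so a
    measurable choice of deadline can be substituted before integrating. *)
Lemma measurable_phi_comp delta (u : R * R * R -> R) : bounded_meas delta ->
  measurable_fun (dom D) u -> (forall p, dom D p -> 0 <= u p <= p.2) ->
  measurable_fun (dom D) (fun p => phi D delta p.1.1 p.1.2 p.2 (u p)).
Proof.
move=> nd mu_ uc; have mdom := measurable_dom.
pose v := u \_ (dom D).
have mv : measurable_fun setT v by apply/(measurable_restrictT _ mdom).
pose f (t : R * R * R * (R * R)) := psi delta t.1.1.1 t.1.1.2 t.1.2 (v t.1) t.2.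
have [K pK] := psi_bounded nd.
have mf : measurable_fun setT f.
  have -> : f = (fun t => psi delta t.1.1.1 t.1.1.2 t.1.2 (v t.1) (t.2.1, t.2.2)).
    by apply/funext => -[? []].
  apply: measurable_psi => //.
  - by do 2?apply: measurableT_comp => //.
  - by do 2?apply: measurableT_comp => //.
  - by do 2?apply: measurableT_comp => //.
  - by apply: measurableT_comp => //.
  - by apply: measurableT_comp => //.
  - by apply: measurableT_comp => //.
have mF : measurable_fun setT (fun t => \int[nu]_q f (t, q))%R.
  by apply: (@measurable_Rintegral_section _ _ _ nu _ _ f K mf) => t; exact: pK.
apply: (@eq_measurable_fun _ _ _ _ (dom D) (fun t => \int[nu]_q f (t, q))%R).
  move=> p; rewrite inE => dp.
  rewrite (phiE nd (dp : dom D (p.1.1, p.1.2, p.2)) (uc _ dp)).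
  by rewrite /Rintegral /f/= /v patchE mem_set.
exact: measurable_funTS.
Qed.

Lemma max_fun_in j a b c : dom D (a, b, c) -> 0 <= r j a b c <= c.
Proof. by move=> dabc; exact: (max_fun_range r_max). Qed.

(** Both claims are carried by one induction, since the contraction step needs [yb j] to be bounded
    and measurable. Measurability of the next iterate comes from evaluating [phi] at the measurable
    maximizer, which avoids a supremum over uncountably many deadlines; the bound comes from the
    distance to [y]. *)
Lemma yb_approx K j : (forall a b c, dom D (a, b, c) -> `|y a b c| <= K) ->
  bounded_meas (yb D j) /\ forall a b c, dom D (a, b, c) ->
    `|yb D j a b c - y a b c| <= F D t0 ^+ j * K.
Proof.
move=> yK; elim: j => [|j [nj IH]].
  split; last by move=> a b c dabc; rewrite /yb/= sub0r normrN expr0 mul1r yK.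
  split; last exact: measurable_cst.
  by exists 0 => a b c _; rewrite normr0.
have IH' a b c : dom D (a, b, c) -> `|yb D j.+1 a b c - y a b c| <= F D t0 ^+ j.+1 * K.
  move=> dabc; rewrite yE// exprS -mulrA.
  exact: (Phi_contract nj bounded_meas_y IH dabc).
split => //; split.
  exists (F D t0 ^+ j.+1 * K + K) => a b c dabc.
  rewrite -[yb D j.+1 a b c](subrK (y a b c)) (le_trans (ler_normD _ _))//.
  by rewrite lerD ?IH' ?yK.
apply: (@eq_measurable_fun _ _ _ _ (dom D)
    (fun p : R * R * R => phi D (yb D j) p.1.1 p.1.2 p.2 (r j.+1 p.1.1 p.1.2 p.2))).
  move=> [[a b] c]; rewrite inE => dabc /=; symmetry; exact: (max_funP r_max j dabc).
apply: measurable_phi_comp => //; first exact: (max_fun_measurable r_max).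
by move=> [[a b] c] dabc; exact: max_fun_in.
Qed.

Lemma bounded_meas_yb j : bounded_meas (yb D j).
Proof. by have [K _ yK] := y_bound; have [] := yb_approx j yK. Qed.

Lemma yb_nd j a b c : dom D (a, b, c) -> yb D j a b c <= yb D j.+1 a b c.
Proof.
elim: j a b c => [|j IH] a b c dabc.
  rewrite [leLHS](_ : _ = phi D (yb D 0) a b c 0); last by rewrite phi0.
  apply: phi_le_Phi => //; first exact: bounded_meas_yb.
  by case: dabc => /= _ _ c0 _; rewrite lexx.
apply: Phi_le => // [|u uc]; first exact: bounded_meas_yb.
apply: le_trans (phi_le_Phi (bounded_meas_yb j.+1) dabc uc).
by apply: phi_le => //; exact: bounded_meas_yb.
Qed.

(* Topkis: [yb j.+1 - yb j >= 0] makes [u |-> phi (yb j.+1) u - phi (yb j) u]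
   nondecreasing, so a larger maximizer at the earlier stage would be a
   maximizer at both stages. *)
Lemma max_fun_nd j a b c : dom D (a, b, c) -> r j a b c <= r j.+1 a b c.
Proof.
move=> dabc; have /andP[v0 vc] := max_fun_in j.+1 dabc.
case: j v0 vc => [|j] v0 vc; first by rewrite (max_fun0 r_max).
have /andP[u0 uc] := max_fun_in j.+1 dabc.
rewrite leNgt; apply/negP => vu.
have maxu : maximizes D j a b c (r j.+1 a b c) := max_funP r_max j dabc.
have maxv : maximizes D j.+1 a b c (r j.+2 a b c) := max_funP r_max j.+1 dabc.
have inc := phi_increment_le (bounded_meas_yb j) (bounded_meas_yb j.+1) (@yb_nd j) dabc v0 (ltW vu) uc.
have lev := phi_le_Phi (bounded_meas_yb j) dabc (max_fun_in j.+2 dabc).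
have leu := phi_le_Phi (bounded_meas_yb j.+1) dabc (max_fun_in j.+1 dabc).
rewrite -[Phi D _ _ _ _]/(yb D j.+1 a b c) in lev.
rewrite -[Phi D _ _ _ _]/(yb D j.+2 a b c) in leu.
have : r j.+1 a b c = r j.+2 a b c.
  apply: (max_fun_consistent r_max (i := j) (j := j.+1) dabc).
  - by rewrite /maximizes in maxu maxv *; lra.
  - by rewrite /maximizes in maxu maxv *; lra.
by move: vu => /[swap] ->; rewrite ltxx.
Qed.

Definition rinf (a b c : R) : R := limn (fun j => r j a b c).

Lemma max_fun_cvg a b c : dom D (a, b, c) -> r j a b c @[j --> \oo] --> rinf a b c.
Proof.
move=> dabc; apply: nondecreasing_is_cvgn.
  by apply/nondecreasing_seqP => j; exact: max_fun_nd.
by exists c => _ [j _ <-]; have /andP[] := max_fun_in j dabc.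
Qed.

Lemma max_fun_le_rinf j a b c : dom D (a, b, c) -> r j a b c <= rinf a b c.
Proof.
move=> dabc; apply: (nondecreasing_cvgn_le _ (max_fun_cvg dabc)).
by apply/nondecreasing_seqP => i; exact: max_fun_nd.
Qed.

Lemma rinf_in a b c : dom D (a, b, c) -> 0 <= rinf a b c <= c.
Proof.
move=> dabc; have rc := max_fun_cvg dabc; apply/andP; split.
  by apply: (cvgr_to_ge rc); apply: nearW => j; have /andP[] := max_fun_in j dabc.
by apply: (cvgr_to_le rc); apply: nearW => j; have /andP[] := max_fun_in j dabc.
Qed.

Lemma measurable_rinf : measurable_fun (dom D) (fun p : R * R * R => rinf p.1.1 p.1.2 p.2).
Proof.
apply: (@measurable_fun_cvg _ _ _ _ (fun j p => r j p.1.1 p.1.2 p.2)).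
  by move=> j; exact: (max_fun_measurable r_max).
by move=> [[a b] c] dabc; exact: max_fun_cvg.
Qed.

(** In the deadline, the cost part is continuous and the other part is a step function whose only
    jump is at [p.1]. *)
Lemma psi_cvg delta a b c (u : R) (v : R^nat) p : p.1 <> u ->
  v n @[n --> \oo] --> u -> psi delta a b c (v n) p @[n --> \oo] --> psi delta a b c u p.
Proof.
move=> pu vu; apply: cvgB; last first.
  apply: cvgB; last exact: cvg_cst.
  have cm : {for u, continuous (fun x : R => b + Num.min p.1 x)}.
    apply: continuousD; first exact: cvg_cst.
    by apply: continuous_min; [exact: cvg_cst|exact: cvg_id].
  have cc : {for u, continuous (fun x : R => cbc (b + Num.min p.1 x))}.
    by apply: continuous_comp cm _; have := cbc_continuous; apply.
  exact: (cvg_comp _ _ vu cc).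
apply: cvg_near_cst; move/eqP: pu; rewrite neq_lt => /orP[pu|up].
  near=> n; rewrite (ltW pu) (_ : p.1 <= v n)//; apply: ltW.
  by near: n; exact: (cvgr_gt u vu).
near=> n; rewrite [p.1 <= u]leNgt up/= [p.1 <= v n]leNgt (_ : v n < p.1)//.
by near: n; exact: (cvgr_lt u vu).
Unshelve. all: by end_near. Qed.

Lemma rinf_max a b c : dom D (a, b, c) -> phi D y a b c (rinf a b c) = y a b c.
Proof.
move=> dabc; have [K K0 yK] := y_bound.
(* The index is shifted because [r 0] is 0 by convention, whereas [r j.+1] maximizes for [yb j]. *)
pose v j := r j.+1 a b c.
have vc : v j @[j --> \oo] --> rinf a b c by rewrite /v (cvg_shiftS (fun j => r j a b c)); exact: max_fun_cvg.
have vin j : 0 <= v j <= c by exact: max_fun_in.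
(* Dominated convergence: the integrands converge unless the holding time equals the limit deadline,
   which has probability 0. *)
have c1 : phi D y a b c (v j) @[j --> \oo] --> phi D y a b c (rinf a b c).
  have [B pB] := psi_bounded bounded_meas_y.
  have ip u := integrable_psi a b c u bounded_meas_y.
  have [|||||_ _] := @dominated_convergence _ _ R nu setT measurableT
    (fun j p => (psi y a b c (v j) p)%:E) (fun p => (psi y a b c (rinf a b c) p)%:E) (cst B%:E).
  - by move=> j; exact: measurable_int (ip _).
  - exact: measurable_int (ip _).
  - have := nu_ae (rinf a b c); apply: filterS => p [_ _ pr] _.
    by apply: cvg_EFin; [exact: nearW|exact: psi_cvg].
  - by apply: (@bounded_integrable _ _ _ nu (cst B) `|B|).
  - by apply: aeW => p j _; rewrite lee_fin; exact: pB.
  have phiEF u : 0 <= u <= c -> (\int[nu]_p (psi y a b c u p)%:E)%E = (phi D y a b c u)%:E.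
    move=> uc; rewrite (phiE bounded_meas_y dabc uc) /Rintegral fineK//.
    by apply: integrable_fin_num => //; exact: ip.
  rewrite phiEF ?rinf_in// => /fine_cvg; apply: cvg_trans; apply: near_eq_cvg.
  by apply: nearW => j; rewrite /= phiEF.
have Fp : F D t0 ^+ j * K @[j --> \oo] --> 0.
  rewrite -[X in _ --> X](mul0r K); apply: cvgM; last exact: cvg_cst.
  by apply: cvg_expr; rewrite ger0_norm ?F_ge0.
have c2 : phi D y a b c (v j) @[j --> \oo] --> y a b c.
  pose g j := F D t0 * (F D t0 ^+ j * K).
  have F2 : g j + g j @[j --> \oo] --> (0 : R).
    have h : g j @[j --> \oo] --> F D t0 * 0 by apply: cvgM Fp; exact: cvg_cst.
    have h2 := cvgD h h; rewrite mulr0 addr0 in h2.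
    exact: h2.
  (* One [g j] is the distance of [y] from [yb j.+1], the other the price of replacing [yb j] by [y]
     inside [phi]. *)
  have bd j : `|y a b c - phi D y a b c (v j)| <= g j + g j.
    have := phi_contract (bounded_meas_yb j) bounded_meas_y (yb_approx j yK).2 dabc (vin j).
    have := (yb_approx j.+1 yK).2 _ _ _ dabc.
    rewrite (max_funP r_max j dabc) exprS -mulrA -/(g j) => /ler_normlP[? ?] /ler_normlP[? ?].
    by rewrite /v; apply/ler_normlP; split; lra.
  apply/cvgrPdist_le => e e0; near=> j; apply: le_trans (bd j) _.
  by near: j; exact: (cvgr_le _ F2 _ e0).
exact: (cvg_unique _ c1 c2).
Unshelve. all: by end_near. Qed.

(** * The value of a waiting time between two events *)

Local Notation L := (t0 - s0 D).

(* [a] is the reward collected from stream 3, [b] the time elapsed since [s] and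
   [B] the base level including the shift by [Ctot]. *)
Definition contval (B a b : R) : R :=
  if b <= L then B + gbc a - cbc b + on_dom y (a, b, L - b) else 0.

(* The value of stopping at [b + u] or continuing at the next event, [p] being
   the next holding time and reward. *)
Definition stepval (B a b : R) (u : \bar R) (p : R * R) : R :=
  if (p.1%:E <= u)%E then contval B (a + p.2) (b + p.1)
  else if (u <= (L - b)%:E)%E then B + gbc a - cbc (b + fine u) else 0.

Lemma dom_L a b : 0 <= a -> 0 <= b -> b <= L -> dom D (a, b, L - b).
Proof.
move=> a0 b0 bL; split => //=; first by rewrite subr_ge0.
by rewrite addrC subrK lerBlDr lerDl (s_ge0 payoffD).
Qed.

Lemma on_dom_y_ge0 p : 0 <= on_dom y p.
Proof.
rewrite /on_dom patchE; case: ifPn => //; rewrite inE.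
by case: p => -[a b] c /=; exact: y_ge0.
Qed.

Lemma contval_ge0 B a b : Cb D <= B -> 0 <= contval B a b.
Proof.
move=> CB; rewrite /contval; case: ifP => // _.
have := on_dom_y_ge0 (a, b, L - b); have := gbc_ge0 a.
by have /andP[] := cbc_range b; lra.
Qed.

Lemma stepval_ge0 B a b u p : Cb D <= B -> 0 <= stepval B a b u p.
Proof.
move=> CB; rewrite /stepval; case: ifP => _; first exact: contval_ge0.
case: ifP => // _; have := gbc_ge0 a.
by have /andP[] := cbc_range (b + fine u); lra.
Qed.

Section measurability.
Context {d' : measure_display} {T' : measurableType d'}.
Variables (B a b : T' -> R).
Hypotheses (mB : measurable_fun setT B) (ma : measurable_fun setT a)
  (mb : measurable_fun setT b).

Lemma measurable_contval : measurable_fun setT (fun t => contval (B t) (a t) (b t)).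
Proof.
apply: measurable_fun_ifT => //; first exact: measurable_fun_ler.
apply: measurable_funD.
  apply: measurable_funB; last exact: (measurableT_comp measurable_cbc).
  by apply: measurable_funD => //; exact: (measurableT_comp measurable_gbc).
apply: (measurableT_comp (measurable_on_dom bounded_meas_y)).
by do 2?apply: measurable_fun_pair => //=; exact: measurable_funB.
Qed.

End measurability.

Lemma measurable_stepval d' (T' : measurableType d') (B a b z x : T' -> R) (u : T' -> \bar R) :
  measurable_fun setT B -> measurable_fun setT a -> measurable_fun setT b ->
  measurable_fun setT z -> measurable_fun setT x -> measurable_fun setT u ->
  measurable_fun setT (fun t => stepval (B t) (a t) (b t) (u t) (z t, x t)).
Proof.
move=> mB ma mb mz mx mu_.
apply: measurable_fun_ifT => /=.
- by apply: measurable_fun_lee => //; exact/measurable_EFinP.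
- by apply: measurable_contval => //; exact: measurable_funD.
- apply: measurable_fun_ifT => //=.
    by apply: measurable_fun_lee => //; apply/measurable_EFinP; exact: measurable_funB.
  apply: measurable_funB; first by apply: measurable_funD => //; exact: (measurableT_comp measurable_gbc).
  apply: (measurableT_comp measurable_cbc); apply: measurable_funD => //.
  exact: measurableT_comp.
Qed.

Lemma stepvalE B a b (u : R) p : b <= L -> u <= L - b ->
  stepval B a b u%:E p = B + gbc a - cbc b + psi y a b (L - b) u p.
Proof.
move=> bL uL; rewrite /stepval /psi !lee_fin uL; case: (leP p.1 u) => pu.
  have pL : b + p.1 <= L by lra.
  rewrite /contval pL opprD addrA; move: (on_dom y _) => q; ring.
by rewrite /=; ring.
Qed.

Lemma integral_stepval B a b (u : R) : 0 <= a -> 0 <= b -> b <= L -> 0 <= u <= L - b ->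
  (\int[nu]_p (stepval B a b u%:E p)%:E = (B + gbc a - cbc b + phi D y a b (L - b) u)%:E)%E.
Proof.
move=> a0 b0 bL /[dup] uL /andP[u0 uL'].
have dabc := dom_L a0 b0 bL.
under eq_integral do rewrite stepvalE// EFinD.
have ip := integrable_psi a b (L - b) u bounded_meas_y.
rewrite integralD//; last first.
  by apply: (@bounded_integrable _ _ _ nu (cst _) `|B + gbc a - cbc b|).
rewrite [RHS]EFinD; congr (_ + _)%E.
  by rewrite integral_cst// [X in (_ * X)%E]probability_setT mule1.
by rewrite (phiE bounded_meas_y dabc uL) /Rintegral fineK//; apply: integrable_fin_num => //; exact: ip.
Qed.

Lemma stepval_over B a b u p : L < b -> 0 <= p.1 -> (0 <= u)%E -> stepval B a b u p = 0.
Proof.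
move=> Lb p0 u0; rewrite /stepval /contval; case: ifP => _.
  by rewrite ifF//; apply/negbTE; rewrite -ltNge; lra.
rewrite ifF//; apply/negbTE; rewrite -ltNge (lt_le_trans _ u0)//.
by rewrite lte_fin subr_lt0.
Qed.

Lemma integral_stepval_over B a b u : L < b -> (0 <= u)%E ->
  (\int[nu]_p (stepval B a b u p)%:E = 0)%E.
Proof.
move=> Lb u0; rewrite (ae_eq_integral (cst 0%E))//; first by rewrite integral0.
- apply/measurable_EFinP.
  rewrite (_ : stepval B a b u = fun p => stepval B a b u (p.1, p.2)); last by apply/funext => -[].
  exact: measurable_stepval.
- have := nu_ae 0; apply: filterS => p [p0 _ _] _.
  by rewrite stepval_over.
Qed.

(** For waits up to the horizon this is [phi <= y]. A longer, possibly infinite, wait is dominated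
    pointwise by the wait [L - b]: it only adds events after the horizon, valued 0, and forgoes a
    nonnegative pay-off. This is where the shift by [Ctot] is needed. *)
Lemma integral_stepval_le B a b u : Cb D <= B -> 0 <= a -> 0 <= b -> (0 <= u)%E ->
  (\int[nu]_p (stepval B a b u p)%:E <= (contval B a b)%:E)%E.
Proof.
move=> CB a0 b0 u0; have [bL|Lb] := leP b L; last first.
  by rewrite integral_stepval_over// lee_fin contval_ge0.
have dabc := dom_L a0 b0 bL.
have main (v : R) : 0 <= v <= L - b ->
    (\int[nu]_p (stepval B a b v%:E p)%:E <= (contval B a b)%:E)%E.
  move=> vL; rewrite integral_stepval// lee_fin /contval bL lerD2l.
  by rewrite on_domE//; exact: phi_le_y.
have [uL|Lu] := leP u (L - b)%:E.
  have uE : u = (fine u)%:E.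
    by rewrite fineK// ge0_fin_numE// (le_lt_trans uL)// ltry.
  by rewrite uE; apply: main; rewrite -!lee_fin -uE u0.
have LL : 0 <= L - b <= L - b by rewrite lexx subr_ge0 bL.
apply: le_trans (main _ LL).
have ms v : measurable_fun setT (fun p => (stepval B a b v p)%:E).
  apply/measurable_EFinP.
  rewrite (_ : stepval B a b v = fun p => stepval B a b v (p.1, p.2)); last by apply/funext => -[].
  exact: measurable_stepval.
apply: ge0_le_integral => //.
- by move=> p _; rewrite lee_fin stepval_ge0.
- move=> p _; rewrite lee_fin [leLHS]/stepval.
  case: ifPn => pu; last by rewrite [(u <= _)%E]leNgt Lu/= stepval_ge0.
  have [pL|Lp] := leP p.1 (L - b); first by rewrite /stepval lee_fin pL.
  rewrite /contval ifF; first exact: stepval_ge0.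
  by apply/negbTE; rewrite -ltNge; lra.
Qed.

Lemma integral_stepval_rinf B a b : 0 <= a -> 0 <= b -> b <= L ->
  (\int[nu]_p (stepval B a b (rinf a b (L - b))%:E p)%:E = (contval B a b)%:E)%E.
Proof.
move=> a0 b0 bL; have dabc := dom_L a0 b0 bL.
by rewrite integral_stepval ?rinf_in// /contval bL on_domE// rinf_max.
Qed.
End one_step.

(** * Filtrations *)

Section past.
Context {d : measure_display} {T : measurableType d} {R : realType}
        {P : probability T R} (D : problem P).
Hypothesis (streamsD : renewal_reward_streams D).

Local Notation S3 := (holding D stream3).
Local Notation X3 := (reward D stream3).

Definition stream_events (j : 'I_3) : set (set T) :=
  sigma_RVs (fun p : bool * nat => stream_family D j p.1 p.2).

(* A pi-system describing streams 1, 2 and the first [i] events of stream 3. *)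
Definition past_set (E : 'I_3 -> set T) (B C : nat -> set R) (i : nat) : set T :=
  \bigcap_(j in [set j | j != stream3]) E j `&`
  (\bigcap_(k in `I_i) (S3 k @^-1` B k) `&` \bigcap_(k in `I_i) (X3 k @^-1` C k)).

Definition past (i : nat) : set (set T) :=
  [set A | exists (E : 'I_3 -> set T) (B C : nat -> set R),
    [/\ forall j, stream_events j (E j), forall k, measurable (B k),
        forall k, measurable (C k) & A = past_set E B C i]].

Lemma sigma_RVs_preimage (I : Type) (Y : I -> {RV P >-> R}) i B : measurable B ->
  sigma_RVs Y (Y i @^-1` B).
Proof. by move=> mB; apply: sub_sigma_algebra; exists i, B. Qed.

Lemma sigma_RVs_bigcap (I : Type) (Y : I -> {RV P >-> R}) (n : nat) (A : nat -> set T) :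
  (forall k, sigma_RVs Y (A k)) -> sigma_RVs Y (\bigcap_(k in `I_n) A k).
Proof.
move=> mA; pose G := [set A | exists i (B : set R), measurable B /\ A = Y i @^-1` B].
by apply: (@bigcap_measurableType _ (g_sigma_algebraType G)) => k _; exact: mA.
Qed.

Lemma sigma_RVs_measurable (I : Type) (Y : I -> {RV P >-> R}) A :
  sigma_RVs Y A -> measurable A.
Proof.
apply: smallest_sub; first exact: sigma_algebra_measurable.
by move=> _ [i [B [mB ->]]]; exact: measurable_funPTI.
Qed.

Lemma prob_bigcap_independent (Y : nat -> {RV P >-> R}) (B : nat -> set R) n :
  independent_RVs Y -> (forall k, measurable (B k)) ->
  P (\bigcap_(k in `I_n) (Y k @^-1` B k)) = (\prod_(k < n) P (Y k @^-1` B k))%E.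
Proof.
move=> indY mB; rewrite (_ : `I_n = [set` iota 0 n]); last first.
  by apply/seteqP; split => k /=; rewrite mem_iota add0n.
rewrite indY ?iota_uniq//; last first.
  by move=> k _; exact: (@sigma_RVs_preimage unit (fun=> Y k) tt).
by rewrite -(big_mkord xpredT (fun k => P (Y k @^-1` B k))) /index_iota subn0.
Qed.

(** Independence acts at three levels: between the streams, between holding times and rewards of
    stream 3, and within each of these two sequences. *)
Lemma prob_past_set E B C i : (forall j, stream_events j (E j)) ->
  (forall k, measurable (B k)) -> (forall k, measurable (C k)) ->
  P (past_set E B C i) = (\prod_(j | j != stream3) P (E j) *
    (\prod_(k < i) P (S3 k @^-1` B k) * \prod_(k < i) P (X3 k @^-1` C k)))%E.
Proof.
move=> mE mB mC; pose HS := \bigcap_(k in `I_i) (S3 k @^-1` B k).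
pose HX := \bigcap_(k in `I_i) (X3 k @^-1` C k).
have mHS : sigma_RVs (stream_family D stream3 true) HS.
  by apply: sigma_RVs_bigcap => k; exact: (@sigma_RVs_preimage _ S3).
have mHX : sigma_RVs (stream_family D stream3 false) HX.
  by apply: sigma_RVs_bigcap => k; exact: (@sigma_RVs_preimage _ X3).
have sub kind : sigma_RVs (stream_family D stream3 kind) `<=` stream_events stream3.
  by apply: sub_sigma_algebra2 => _ [k [A [mA ->]]]; exists (kind, k), A.
(* The restriction on the first [i] events takes the place of stream 3, so that the independence of
   the streams applies to a family indexed by all of them. *)
pose A j := if j == stream3 then HS `&` HX else E j.
have mA j : stream_events j (A j).
  rewrite /A; case: eqP => // ->; rewrite /stream_events.
  pose G := [set A | exists i (B : set R), measurable B /\ A =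
    (fun p : bool * nat => stream_family D stream3 p.1 p.2) i @^-1` B].
  by apply: (@measurableI _ (g_sigma_algebraType G)); [exact: (sub true)|exact: (sub false)].
have -> : past_set E B C i = \bigcap_(j in [set` enum 'I_3]) A j.
  apply/seteqP; split => w.
  - move=> [Ew Hw] j _; rewrite /A; case: eqP => // /eqP js; exact: Ew.
  - move=> Aw; split.
      by move=> j /= /negbTE js; have := Aw j; rewrite /= mem_enum /A js; exact.
    by have := Aw stream3; rewrite /= mem_enum /A eqxx; exact.
rewrite (streams_independent streamsD) ?enum_uniq//; last by move=> j _; exact: mA.
rewrite big_enum/= (bigD1 stream3)//= muleC; congr (_ * _)%E.
  by apply: eq_bigr => j /negbTE js; rewrite /A js.
rewrite /A eqxx.
pose HH (kind : bool) := if kind then HS else HX.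
have -> : HS `&` HX = \bigcap_(kind in [set` [:: true; false]]) HH kind.
  apply/seteqP; split => [w [? ?] []//|w h].
  by split; [apply: (h true)|apply: (h false)].
rewrite (@holding_reward_independent _ _ _ _ _ streamsD stream3)//; last by case.
rewrite !big_cons big_nil mule1 /HH; congr (_ * _)%E.
  by rewrite prob_bigcap_independent//; exact: (holding_independent streamsD).
by rewrite prob_bigcap_independent//; exact: (reward_independent streamsD).
Qed.

Lemma past_setI i : setI_closed (past i).
Proof.
move=> _ _ [E [B [C [mE mB mC ->]]]] [E' [B' [C' [mE' mB' mC' ->]]]].
exists (fun j => E j `&` E' j), (fun k => B k `&` B' k), (fun k => C k `&` C' k).
split.
- move=> j; pose G := [set A | exists i (B : set R), measurable B /\ A =
    (fun p : bool * nat => stream_family D j p.1 p.2) i @^-1` B].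
  by apply: (@measurableI _ (g_sigma_algebraType G)); [exact: mE|exact: mE'].
- by move=> k; exact: measurableI.
- by move=> k; exact: measurableI.
- apply/seteqP; split => w.
    move=> [[Ew [Bw Cw]] [Ew' [Bw' Cw']]]; split; [|split] => k kk.
    + by split; [exact: Ew|exact: Ew'].
    + by split; [exact: Bw|exact: Bw'].
    + by split; [exact: Cw|exact: Cw'].
  move=> [Ew [Bw Cw]]; split; split; [|split| |split] => k kk.
  + by have [] := Ew k kk.
  + by have [] := Bw k kk.
  + by have [] := Cw k kk.
  + by have [] := Ew k kk.
  + by have [] := Bw k kk.
  + by have [] := Cw k kk.
Qed.

Lemma past_measurable i A : <<s past i >> A -> measurable A.
Proof.
apply: smallest_sub; first exact: sigma_algebra_measurable.
move=> _ [E [B [C [mE mB mC ->]]]]; apply: measurableI.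
  by apply: fin_bigcap_measurable => [|j _]; [exact: finite_finset|exact: sigma_RVs_measurable (mE j)].
by apply: measurableI; apply: bigcap_measurableType => k _; exact: measurable_funPTI.
Qed.

Lemma prob_holding k B : measurable B ->
  P (S3 k @^-1` B) = distribution P (S3 0%N) B.
Proof.
move=> mB; apply: (@distribution_cdf_eq _ _ _ _ (S3 k) (S3 0%N)) => // x.
by rewrite !(holding_cdfE streamsD).
Qed.

Lemma prob_reward k B : measurable B ->
  P (X3 k @^-1` B) = distribution P (X3 0%N) B.
Proof.
move=> mB; apply: (@distribution_cdf_eq _ _ _ _ (X3 k) (X3 0%N)) => // x.
by rewrite !(reward_cdfE streamsD).
Qed.

(** For fixed [B] and [C], both sides are finite measures in [A], so it is enough to compare them on
    the pi-system [past i]. *)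
Lemma past_independent i A B C : <<s past i >> A -> measurable B -> measurable C ->
  P (A `&` (S3 i @^-1` B `&` X3 i @^-1` C)) =
  (P A * (distribution P (S3 0%N) B * distribution P (X3 0%N) C))%E.
Proof.
move=> + mB mC; set m2 := distribution P (S3 0%N) B; set m3 := distribution P (X3 0%N) C.
have mBC : measurable (S3 i @^-1` B `&` X3 i @^-1` C).
  by apply: measurableI; exact: measurable_funPTI.
have q0 : 0 <= fine (m2 * m3)%E by rewrite fine_ge0// mule_ge0// measure_ge0.
have qE : (fine (m2 * m3))%:E = (m2 * m3)%E.
  by rewrite fineK// fin_numM// fin_num_measure.
suff h : forall A, <<s past i >> A ->
    mrestr P mBC A = mscale (NngNum q0) P A.
  by move=> /h; rewrite /mrestr /mscale/= qE muleC.
have pT : past i setT.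
  exists (fun=> setT), (fun=> setT), (fun=> setT); split => //.
    move=> j; exact: (@measurableT _ (g_sigma_algebraType [set A | exists i (B : set R), measurable B /\ A =
    (fun p : bool * nat => stream_family D j p.1 p.2) i @^-1` B])).
  by apply/seteqP; split.
move=> A0; apply: (@g_sigma_algebra_measure_unique _ _ _ (past i) _ (fun=> setT)) => //.
- by move=> A1 pA1; apply: (@past_measurable i); exact: sub_sigma_algebra.
- by apply/seteqP; split => // x _; exists 0%N.
- exact: past_setI.
- move=> A1 [E [B' [C' [mE mB' mC' ->]]]].
  rewrite [LHS]/= /mrestr [RHS]/= /mscale [X in (X * _)%E]qE.
  (* The next holding time and reward have index [i]: intersecting with them turns a past set for
     [i] events into one for [i.+1]. *)
  pose Bi k := if (k < i)%N then B' k else B.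
  pose Ci k := if (k < i)%N then C' k else C.
  have -> : past_set E B' C' i `&` (S3 i @^-1` B `&` X3 i @^-1` C) = past_set E Bi Ci i.+1.
    apply/seteqP; split => w.
    - move=> [[Ew [Bw Cw]] [Bw' Cw']]; split=> //; split => k /=; rewrite ltnS leq_eqVlt /Bi /Ci.
        by move=> /orP[/eqP ->|ki]; [rewrite ltnn|rewrite ki; exact: Bw].
      by move=> /orP[/eqP ->|ki]; [rewrite ltnn|rewrite ki; exact: Cw].
    - move=> [Ew [Bw Cw]]; split.
        split=> //; split => k /= ki.
          by have := Bw k; rewrite /Bi/= ki; apply; rewrite ltnS ltnW.
        by have := Cw k; rewrite /Ci/= ki; apply; rewrite ltnS ltnW.
      by split; [have := Bw i (ltnSn i)|have := Cw i (ltnSn i)]; rewrite /Bi /Ci ltnn.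
  have BE : (\prod_(k < i.+1) P (S3 k @^-1` Bi k) =
      \prod_(k < i) P (S3 k @^-1` B' k) * m2)%E.
    rewrite big_ord_recr/=; congr (_ * _)%E; last by rewrite /Bi ltnn prob_holding.
    by apply: eq_bigr => k _; rewrite /Bi ltn_ord.
  have CE : (\prod_(k < i.+1) P (X3 k @^-1` Ci k) =
      \prod_(k < i) P (X3 k @^-1` C' k) * m3)%E.
    rewrite big_ord_recr/=; congr (_ * _)%E; last by rewrite /Ci ltnn prob_reward.
    by apply: eq_bigr => k _; rewrite /Ci ltn_ord.
  rewrite prob_past_set//; last 2 first.
  - by move=> k; rewrite /Bi; case: ifP.
  - by move=> k; rewrite /Ci; case: ifP.
  have /esym pE := prob_past_set i mE mB' mC'.
  rewrite BE CE; apply: etrans (congr1 (fun x => m2 * m3 * x)%E pE).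
  rewrite [RHS]muleC -!muleA; congr (_ * (_ * _))%E.
  by rewrite muleCA.
- by move=> n /=; rewrite (le_lt_trans (measureIl _ _ _)) ?(le_lt_trans (probability_le1 _ _)) ?ltry//.
Qed.

End past.

(** * Compound sums and what is observed of them at a given time *)

Section total.
Context {R : realType}.

(* [M] and [Ms] are, path by path, of this form, [a] being the event times and [x] the rewards. *)
Definition total (a x : nat -> R) (t : R) : R :=
  \sum_(k < xget 0%N [set n | a n <= t < a n.+1]) x k.

Lemma total_in (a x : nat -> R) t n : nondecreasing_seq a -> a n <= t < a n.+1 ->
  total a x t = \sum_(k < n) x k.
Proof.
move=> nda an; rewrite /total (@xget_subset1 _ _ _ n)// => i j /=.
move=> /andP[i1 i2] /andP[j1 j2]; apply/eqP; rewrite eqn_leq; apply/andP; split.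
  by rewrite leqNgt; apply/negP => /nda; rewrite leNgt (le_lt_trans i1).
by rewrite leqNgt; apply/negP => /nda; rewrite leNgt (le_lt_trans j1).
Qed.

(** The hypotheses give the same set of candidate counts on both sides, so even the default count 0,
    used when the stream explodes, agrees. The lemma serves to replace event times and rewards by
    their observed versions. *)
Lemma eq_total (a x a' x' : nat -> R) t t' : nondecreasing_seq a ->
  (forall k, (a k <= t) = (a' k <= t')) ->
  (forall k, a k.+1 <= t -> x k = x' k) -> total a x t = total a' x' t'.
Proof.
move=> nda aa' xx'; rewrite /total.
have -> : [set n | a' n <= t' < a' n.+1] = [set n | a n <= t < a n.+1].
  by apply/seteqP; split => n /=; rewrite !ltNge !aa'.
case: xgetP => [n _ /= /andP[an _]|_]; last by rewrite !big_ord0.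
by apply: eq_bigr => k _; apply: xx'; apply: le_trans an; exact: nda.
Qed.

Lemma total_ge0 (a x : nat -> R) t : (forall k, 0 <= x k) -> 0 <= total a x t.
Proof. by move=> x0; exact: sumr_ge0. Qed.

Lemma measurable_total (d : measure_display) (T : measurableType d)
    (a x : nat -> T -> R) (t : T -> R) :
  (forall w, nondecreasing_seq (a ^~ w)) ->
  (forall k, measurable_fun setT (a k)) -> (forall k, measurable_fun setT (x k)) ->
  measurable_fun setT t ->
  measurable_fun setT (fun w => total (a ^~ w) (x ^~ w) (t w)).
Proof.
move=> nda ma mx mt.
pose E n := [set w | a n w <= t w < a n.+1 w].
have mE n : measurable (E n).
  have -> : E n = setT `&` (fun w => (a n w <= t w) && (t w < a n.+1 w)) @^-1` [set true].
    by rewrite setTI.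
  suff : measurable_fun setT (fun w => (a n w <= t w) && (t w < a n.+1 w)) by exact.
  by apply: measurable_and; [exact: measurable_fun_ler|exact: measurable_fun_ltr].
have mf n : measurable_fun setT (fun w => \sum_(k < n) x k w).
  by apply: measurable_sum => k; exact: mx.
move=> _ Y mY; rewrite setTI.
have -> : (fun w => total (a ^~ w) (x ^~ w) (t w)) @^-1` Y =
    (\bigcup_n (E n `&` (fun w => \sum_(k < n) x k w) @^-1` Y)) `|`
    (~` (\bigcup_n E n) `&` [set w | Y 0]).
  apply/seteqP; split => w /=.
    have [[n En]|nE] := pselect (exists n, E n w).
      by rewrite (total_in _ (nda w) En) => Yw; left; exists n.
    move=> Yw; right; split; first by move=> [n _ En]; apply: nE; exists n.
    move: Yw; rewrite /total xgetPN ?big_ord0// => n En; apply: nE; by exists n.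
  move=> [[n _ [En Yw]]|[nE Y0]]; first by rewrite (total_in _ (nda w) En).
  by rewrite /total xgetPN ?big_ord0// => n En; apply: nE; exists n.
apply: measurableU.
  apply: bigcupT_measurable => n; apply: measurableI => //.
  by rewrite -[X in measurable X]setTI; exact: mf.
apply: measurableI; first by apply: measurableC; exact: bigcupT_measurable.
by have [Y0|Y0] := pselect (Y 0); [rewrite (_ : [set _ | _] = setT)|rewrite (_ : [set _ | _] = set0)];
  rewrite //; apply/seteqP; split.
Qed.

(* What is known at time [t] of an event at time [a]; [t + 1] means later than [t]. *)
Definition obs_time (t a : R) : R := if a <= t then a else t + 1.
Definition obs_reward (t a x : R) : R := if a <= t then x else 0.

Lemma obs_time_nd t : {homo (obs_time t) : a b / a <= b}.
Proof. by move=> a b ab; rewrite /obs_time; case: (leP a t) => h1; case: (leP b t) => h2; lra. Qed.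

Lemma obs_time_le t a u : u <= t -> (obs_time t a <= u) = (a <= u).
Proof.
move=> ut; rewrite /obs_time; case: (leP a t) => // ta.
by apply/idP/idP => ?; lra.
Qed.

Lemma measurable_sublevel (d : measure_display) (T : measurableType d) (f : T -> R) u :
  measurable_fun setT f -> measurable [set w | f w <= u].
Proof.
move=> mf; rewrite (_ : [set _ | _] = f @^-1` `]-oo, u]); last first.
  by apply/seteqP; split => w /=; rewrite in_itv.
by rewrite -[X in measurable X]setTI; apply: mf => //; exact: measurable_itv.
Qed.

Section observed.
Context {d : measure_display} {T : measurableType d} (a x : T -> R) (t : R).
Hypothesis obs : forall u B, u <= t -> measurable B -> measurable [set w | a w <= u /\ B (x w)].

Lemma measurable_obs_le u : u <= t -> measurable [set w | a w <= u].
Proof.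
move=> ut; rewrite (_ : [set _ | _] = [set w | a w <= u /\ setT (x w)]).
  exact: obs.
by apply/seteqP; split => w //= [].
Qed.

Lemma measurable_obs_time : measurable_fun setT (fun w => obs_time t (a w)).
Proof.
apply: (measurability _ (RGenOInfty.measurableE R)) => //.
move=> _ [_ [c ->] <-]; rewrite setTI.
have [ct|tc] := ltP c (t + 1); last first.
  rewrite (_ : _ @^-1` _ = set0)//; apply/seteqP; split => // w /=.
  rewrite in_itv/= andbT /obs_time; case: (leP (a w) t) => ?; lra.
rewrite (_ : _ @^-1` _ = ~` [set w | a w <= Num.min c t]).
  by apply: measurableC; apply: measurable_obs_le; rewrite ge_min lexx orbT.
apply/seteqP; split => w /=; rewrite in_itv/= andbT /obs_time le_min.
  by case: (leP (a w) t) => h; [rewrite ltNge andbT => /negP|rewrite andbF].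
by case: (leP (a w) t) => h; [rewrite ltNge andbT => /negP|].
Qed.

Lemma measurable_obs_reward : measurable_fun setT (fun w => obs_reward t (a w) (x w)).
Proof.
move=> _ Y mY; rewrite setTI.
rewrite (_ : _ @^-1` _ = [set w | a w <= t /\ Y (x w)] `|`
   (~` [set w | a w <= t] `&` [set w | Y 0])); last first.
  apply/seteqP; split => w /=; rewrite /obs_reward; case: (leP (a w) t) => h.
  - by left.
  - by right; split=> //; apply/negP; rewrite -ltNge.
  - by move=> [[]//|[]].
  - by move=> [[]//|[]].
apply: measurableU; first exact: obs.
apply: measurableI; first by apply: measurableC; exact: measurable_obs_le.
by have [Y0|Y0] := pselect (Y 0); [rewrite (_ : [set _ | _] = setT)|rewrite (_ : [set _ | _] = set0)];
  rewrite //; apply/seteqP; split.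
Qed.

End observed.

End total.

Local Notation measurable_wrt F f := (@measurable_fun _ _ (g_sigma_algebraType F) _ setT f).

(** * The filtrations and their relation to the past of stream 3 *)

Section filtration.
Context {d : measure_display} {T : measurableType d} {R : realType}
        {P : probability T R} (D : problem P).
Hypothesis (streamsD : renewal_reward_streams D).

Local Notation s := (s0 D).
Local Notation S3 := (holding D stream3).
Local Notation X3 := (reward D stream3).

Lemma mfun_sub (F F' : set (set T)) d' (U : measurableType d') (f : T -> U) :
  F `<=` <<s F' >> -> measurable_wrt F f -> measurable_wrt F' f.
Proof.
move=> FF' mf _ Y mY; apply: (smallest_sub _ FF' (mf measurableT Y mY)).
exact: smallest_sigma_algebra.
Qed.

Lemma mfun_subT (F : set (set T)) d' (U : measurableType d') (f : T -> U) :
  F `<=` measurable -> measurable_wrt F f -> measurable_fun setT f.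
Proof.
move=> FT mf _ Y mY; apply: (smallest_sub _ FT (mf measurableT Y mY)).
exact: sigma_algebra_measurable.
Qed.

Lemma mfun_preimage (F : set (set T)) d' (U : measurableType d') (f : T -> U) Y :
  measurable_wrt F f -> measurable Y -> <<s F >> (f @^-1` Y).
Proof. by move=> mf mY; have := mf measurableT Y mY; rewrite setTI. Qed.

Lemma arrival_nd i w : nondecreasing_seq (fun k => arrival D i k w).
Proof.
apply/nondecreasing_seqP => k; rewrite /arrival big_ord_recr/= lerDl.
exact: holding_ge0.
Qed.

Lemma arrivalS i k w : arrival D i k.+1 w = arrival D i k w + holding D i k w.
Proof. by rewrite /arrival big_ord_recr. Qed.

Lemma T3S k w : T3 D k.+1 w = T3 D k w + S3 k w.
Proof. by rewrite /T3 arrivalS addrA. Qed.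

Lemma T3_nd w : nondecreasing_seq (fun k => T3 D k w).
Proof. by move=> i j ij; rewrite /T3 lerD2l arrival_nd. Qed.

Lemma T30 w : T3 D 0 w = s.
Proof. by rewrite /T3 /arrival big_ord0 addr0. Qed.

Lemma T3_ge k w : s <= T3 D k w.
Proof. by rewrite -(T30 w); exact: T3_nd. Qed.

Lemma MsE t w : s <= t ->
  Ms D t w = M D s w + total (fun k => T3 D k w) (fun k => X3 k w) t.
Proof.
move=> st; rewrite /Ms (min_l st) max_l ?subr_ge0//; congr (_ + _).
apply: (@eq_total _ (fun k => arrival D stream3 k w) (fun k => X3 k w)) => //.
  exact: arrival_nd.
by move=> k; rewrite /T3 lerBrDl.
Qed.

Lemma M_ge0 t w : 0 <= M D t w.
Proof. by apply: sumr_ge0 => i _; apply: sumr_ge0 => k _; exact: reward_ge0. Qed.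

Lemma Ft_measurable t : Ft D t `<=` measurable.
Proof.
apply: smallest_sub; first exact: sigma_algebra_measurable.
move=> _ [i [k [u [B [_ ut mB ->]]]]]; apply: measurableI.
  apply: measurable_sublevel; apply: measurable_sum => j; exact: measurable_funPT.
exact: measurable_funPTI.
Qed.

(** Later events do not enter the sum, so it can be computed from observed event times and rewards,
    which are measurable for [Ft]. *)
Lemma mfun_M t : measurable_wrt (Ft D t) (M D t).
Proof.
pose F i w := total (fun k => obs_time t (arrival D i k w))
                 (fun k => obs_reward t (arrival D i k.+1 w) (reward D i k w)) t.
have -> : M D t = (fun w => \sum_(i : 'I_3 | i != stream3) F i w).
  apply/funext => w; rewrite /M; apply: eq_bigr => i i3.
  apply: (@eq_total _ (fun k => arrival D i k w) (fun k => reward D i k w)).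
  - exact: arrival_nd.
  - by move=> k; rewrite obs_time_le.
  - by move=> k ak; rewrite /obs_reward ak.
under eq_fun do rewrite big_mkcond/=.
apply: (@measurable_sum _ (g_sigma_algebraType (Ft D t))) => i; have [i3|i3] := boolP (i != stream3); last exact: measurable_cst.
have obs k u B : u <= t -> measurable B ->
    @measurable _ (g_sigma_algebraType (Ft D t))
      [set w | arrival D i k.+1 w <= u /\ B (reward D i k w)].
  move=> ut mB; apply: sub_sigma_algebra; apply: sub_sigma_algebra.
  by exists i, k, u, B.
apply: measurable_total.
- by move=> w j k jk; apply: obs_time_nd; exact: arrival_nd.
- case=> [|k].
    by under eq_fun do rewrite /arrival big_ord0; exact: measurable_cst.
  by apply: (@measurable_obs_time _ _ (g_sigma_algebraType (Ft D t))) => u B; exact: obs.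
- move=> k.
  by apply: (@measurable_obs_reward _ _ (g_sigma_algebraType (Ft D t))) => u B; exact: obs.
- exact: measurable_cst.
Qed.

Lemma Fst_measurable t : Fst D t `<=` measurable.
Proof.
apply: smallest_sub; first exact: sigma_algebra_measurable.
rewrite subUset; split; first exact: Ft_measurable.
move=> _ [k [u [B [ut mB ->]]]]; apply: measurableI.
  apply: measurable_sublevel; apply: measurable_funD => //.
  by apply: measurable_sum => j; exact: measurable_funPT.
exact: measurable_funPTI.
Qed.

Lemma Ft_Fst t : Ft D s `<=` Fst D t.
Proof. by move=> A FA; apply: sub_sigma_algebra; left. Qed.

(** It allows [Fst D t] to be used as the measurable sets of a [g_sigma_algebraType], so that
    general measurability lemmas apply to it. *)
Lemma Fst_id t : <<s Fst D t >> = Fst D t.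
Proof. by apply: sigma_algebra_id; exact: smallest_sigma_algebra. Qed.

Lemma mfun_M_Fst t : measurable_wrt (Fst D t) (M D s).
Proof. apply: (@mfun_sub (Ft D s) (Fst D t) _ R (M D s)); last exact: mfun_M.
by rewrite Fst_id; exact: Ft_Fst. Qed.

Lemma Fst_obs t k u B : u <= t -> measurable B ->
  @measurable _ (g_sigma_algebraType (Fst D t)) [set w | T3 D k.+1 w <= u /\ B (X3 k w)].
Proof.
move=> ut mB; apply: sub_sigma_algebra; apply: sub_sigma_algebra; right.
by exists k, u, B.
Qed.

Lemma mfun_obs_time t k : measurable_wrt (Fst D t) (fun w => obs_time t (T3 D k w)).
Proof.
case: k => [|k]; first by under eq_fun do rewrite T30; exact: measurable_cst.
by apply: (@measurable_obs_time _ _ (g_sigma_algebraType (Fst D t))) => u B; exact: Fst_obs.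
Qed.

Lemma mfun_obs_reward t k :
  measurable_wrt (Fst D t) (fun w => obs_reward t (T3 D k.+1 w) (X3 k w)).
Proof.
by apply: (@measurable_obs_reward _ _ (g_sigma_algebraType (Fst D t))) => u B; exact: Fst_obs.
Qed.

Lemma Fst_T3_le t k : s <= t -> Fst D t [set w | T3 D k w <= t].
Proof.
move=> st; rewrite -Fst_id; case: k => [|k].
  rewrite (_ : [set _ | _] = setT); last by apply/seteqP; split => w //= _; rewrite T30.
  exact: (@measurableT _ (g_sigma_algebraType (Fst D t))).
apply: (@measurable_obs_le _ _ (g_sigma_algebraType (Fst D t)) _ _ t) => //.
by move=> u B; exact: Fst_obs.
Qed.

Lemma past_preimage i (Y : {RV P >-> R}) B (E : bool) k : (k < i)%N -> measurable B ->
  Y = (if E then S3 else X3) k -> <<s past D i >> (Y @^-1` B).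
Proof.
move=> ki mB ->; apply: sub_sigma_algebra.
have mT j : stream_events D j setT.
  exact: (@measurableT _ (g_sigma_algebraType [set A | exists i (B : set R),
    measurable B /\ A = (fun p : bool * nat => stream_family D j p.1 p.2) i @^-1` B])).
have mC b j : measurable (if (j == k) && b then B else setT) by case: ifP.
exists (fun=> setT), (fun j => if (j == k) && E then B else setT),
  (fun j => if (j == k) && ~~ E then B else setT); split => //.
apply/seteqP; split => w.
- move=> Bw; split; [by []|split] => j _ /=; case: eqP => //= ->; by case: E Bw.
- move=> [_ [h1 h2]]; have := h1 k ki; have := h2 k ki; rewrite /= eqxx.
  by case: E {h1 h2}.
Qed.

Lemma mfun_holding i k : (k < i)%N -> measurable_wrt (past D i) (S3 k).
Proof. by move=> ki _ B mB; rewrite setTI; exact: (@past_preimage i _ _ true k). Qed.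

Lemma mfun_reward i k : (k < i)%N -> measurable_wrt (past D i) (X3 k).
Proof. by move=> ki _ B mB; rewrite setTI; exact: (@past_preimage i _ _ false k). Qed.

Lemma mfun_T3 i k : (k <= i)%N -> measurable_wrt (past D i) (T3 D k).
Proof.
move=> ki; apply: (@measurable_funD _ (g_sigma_algebraType (past D i))) => //.
apply: (@measurable_sum _ (g_sigma_algebraType (past D i))) => j; apply: mfun_holding.
exact: leq_trans (ltn_ord j) ki.
Qed.

Definition reward_sum (i : nat) (w : T) : R := \sum_(k < i) X3 k w.

Lemma mfun_reward_sum i k : (k <= i)%N -> measurable_wrt (past D i) (reward_sum k).
Proof.
move=> ki; apply: (@measurable_sum _ (g_sigma_algebraType (past D i))) => j.
by apply: mfun_reward; exact: leq_trans (ltn_ord j) ki.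
Qed.

Lemma reward_sum_ge0 i w : 0 <= reward_sum i w.
Proof. by apply: sumr_ge0 => k _; exact: reward_ge0. Qed.

Lemma stream_events_past i j : j != stream3 -> stream_events D j `<=` <<s past D i >>.
Proof.
move=> j3 A mA; apply: sub_sigma_algebra.
have mT k : stream_events D k setT.
  exact: (@measurableT _ (g_sigma_algebraType [set A | exists i (B : set R),
    measurable B /\ A = (fun p : bool * nat => stream_family D k p.1 p.2) i @^-1` B])).
exists (fun k => if k == j then A else setT), (fun=> setT), (fun=> setT); split => //.
  by move=> k; case: eqP => [->|].
apply/seteqP; split => w.
- by move=> Aw; split=> // k _ /=; case: eqP.
- by move=> [/(_ j j3)]; rewrite eqxx.
Qed.

(** The inclusion holds at every [t] because [past] contains streams 1 and 2 entirely. This costs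
    nothing: they are independent of stream 3. *)
Lemma Ft_past i t : Ft D t `<=` <<s past D i >>.
Proof.
apply: smallest_sub; first exact: smallest_sigma_algebra.
move=> _ [j [k [u [B [j3 ut mB ->]]]]]; apply: (@stream_events_past i j) => //.
pose Y := (fun p : bool * nat => stream_family D j p.1 p.2).
pose G := [set A | exists i (B : set R), measurable B /\ A = Y i @^-1` B].
have mY p : measurable_wrt G (Y p).
  by move=> _ C mC; rewrite setTI; exact: (@sigma_RVs_preimage _ _ _ P _ Y p).
apply: (@measurableI _ (g_sigma_algebraType G)).
  apply: (@measurable_sublevel _ _ (g_sigma_algebraType G)).
  apply: (@measurable_sum _ (g_sigma_algebraType G)) => l.
  exact: (mY (true, nat_of_ord l)).
apply: (@mfun_preimage G _ R) => //; exact: (mY (false, k)).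
Qed.

Lemma mfun_M_past i : measurable_wrt (past D i) (M D s).
Proof. by apply: (@mfun_sub (Ft D s) (past D i) _ R (M D s)); [exact: Ft_past|exact: mfun_M]. Qed.

Lemma past_sub i j : (i <= j)%N -> <<s past D i >> `<=` <<s past D j >>.
Proof.
move=> ij; apply: smallest_sub; first exact: smallest_sigma_algebra.
move=> _ [E [B [C [mE mB mC ->]]]]; apply: sub_sigma_algebra.
exists E, (fun k => if (k < i)%N then B k else setT), (fun k => if (k < i)%N then C k else setT).
split => //; [by move=> k; case: ifP|by move=> k; case: ifP|].
apply/seteqP; split => w [Ew [Bw Cw]]; split=> //; split => k /= ki.
- by case: ifP => // ki'; exact: Bw.
- by case: ifP => // ki'; exact: Cw.
- by have := Bw k; rewrite /= ki; apply; exact: leq_trans ki ij.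
- by have := Cw k; rewrite /= ki; apply; exact: leq_trans ki ij.
Qed.

(* Before the next event nothing is learnt beyond the past. *)
Lemma past_trace i t A : Fst D t A ->
  exists2 A', <<s past D i >> A' & forall w, t < T3 D i.+1 w -> (A w <-> A' w).
Proof.
pose C := [set A | exists2 A', <<s past D i >> A' & forall w, t < T3 D i.+1 w -> (A w <-> A' w)].
suff : Fst D t `<=` C by move=> + FA; exact.
apply: smallest_sub.
  split.
  - exists set0 => //; exact: (@measurable0 _ (g_sigma_algebraType (past D i))).
  - move=> B [B' mB' BB']; exists (~` B').
      exact: (@measurableC _ (g_sigma_algebraType (past D i))).
    by move=> w tw; rewrite !setTD; split => nB /(BB' _ tw).
  - move=> B CB; have [B' B'P] := choice (fun k => (let: ex_intro2 A' h1 h2 := CB k in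
      ex_intro _ A' (conj h1 h2)) : exists A', <<s past D i >> A' /\
        forall w, t < T3 D i.+1 w -> (B k w <-> A' w)).
    exists (\bigcup_k B' k).
      apply: (@bigcupT_measurable _ (g_sigma_algebraType (past D i))) => k.
      by have [] := B'P k.
    by move=> w tw; split => -[k _ Bk]; exists k => //; have [_ /(_ _ tw)[]] := B'P k; auto.
rewrite subUset; split.
  by move=> B FB; exists B => //; exact: Ft_past FB.
move=> _ [k [u [B [ut mB ->]]]]; have [ki|ik] := ltnP k i.
  exists [set w | T3 D k.+1 w <= u /\ B (X3 k w)] => //.
  apply: (@measurableI _ (g_sigma_algebraType (past D i))).
    by apply: (@measurable_sublevel _ _ (g_sigma_algebraType (past D i))); exact: mfun_T3.
  by apply: (@mfun_preimage (past D i) _ R) => //; exact: mfun_reward.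
(* With [k >= i], the event time [T3 k.+1] is at least [T3 i.+1], which lies after [t] on the set
   considered. *)
exists set0; first exact: (@measurable0 _ (g_sigma_algebraType (past D i))).
move=> w tw; split => // -[Tu _].
have := @T3_nd w i.+1 k.+1 ik => h; move: (lt_le_trans tw (le_trans h (le_trans Tu ut))).
by rewrite ltxx.
Qed.

End filtration.

(** * Stopping times between two events of stream 3 *)

Section stopping.
Context {d : measure_display} {T : measurableType d} {R : realType}
        {P : probability T R} (D : problem P).
Hypothesis (streamsD : renewal_reward_streams D).

Local Notation s := (s0 D).
Local Notation S3 := (holding D stream3).
Local Notation X3 := (reward D stream3).

Lemma measurable_mem (d' : measure_display) (T' : measurableType d') (A : set T') :
  measurable A -> measurable_fun setT (fun w => w \in A).
Proof.
move=> mA; apply: (@measurable_fun_bool _ _ _ _ true).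
rewrite setTI (_ : _ @^-1` _ = A)//.
by apply/seteqP; split => w; [move/set_mem|move/mem_set].
Qed.

(* [rho] is the infimum of the rationals [q] for which [sigma <= q] is already
   decided by the past. *)
Lemma stopping_past sigma i : stopping_time D sigma ->
  exists rho : T -> \bar R, [/\ measurable_wrt (past D i) rho,
    forall w, (sigma w < (T3 D i.+1 w)%:E)%E -> rho w = sigma w &
    forall w, ((T3 D i.+1 w)%:E <= sigma w)%E -> ((T3 D i.+1 w)%:E <= rho w)%E].
Proof.
move=> [s_sigma Fsigma].
have Fs t : Fst D t [set w | (sigma w <= t%:E)%E].
  have [/Fsigma//|ts] := leP s t.
  rewrite (_ : [set _ | _] = set0); last first.
    apply/seteqP; split => // w /= st; have := le_trans (s_sigma w) st.
    by rewrite lee_fin leNgt ts.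
  rewrite -Fst_id; exact: (@measurable0 _ (g_sigma_algebraType (Fst D t))).
have [A' A'P] := choice (fun t => (let: ex_intro2 A' h1 h2 := past_trace streamsD i (Fs t) in
    ex_intro _ A' (conj h1 h2)) : exists A', <<s past D i >> A' /\
      forall w, t < T3 D i.+1 w -> ((sigma w <= t%:E)%E <-> A' w)).
(* An enumeration of all rationals; codes that decode to nothing merely repeat 0. *)
pose q (n : nat) : R := ratr (odflt 0 (unpickle n : option rat)).
pose g n w : \bar R := if w \in A' (q n) then (q n)%:E else +oo%E.
exists (fun w => einfs (g ^~ w) 0%N); split.
- apply: (@measurable_fun_einfs _ (g_sigma_algebraType (past D i))) => n.
  apply: (@measurable_fun_ifT _ _ (g_sigma_algebraType (past D i))) => //.
  apply: (@measurable_mem _ (g_sigma_algebraType (past D i))).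
  by have [] := A'P (q n).
- move=> w sT; apply/eqP; rewrite eq_le; apply/andP; split; last first.
    apply: le_ereal_inf_tmp => _ [n _ <-]; rewrite /g; case: ifPn => [|_]; last exact: leey.
    rewrite inE => A'w; have [qT|Tq] := ltP (q n) (T3 D i.+1 w).
      by have [_ /(_ _ qT)[_ /(_ A'w)]] := A'P (q n).
    by apply: (le_trans (ltW sT)); rewrite lee_fin.
  have sfin : sigma w \is a fin_num.
    by rewrite fin_numE; apply/andP; split; [rewrite gt_eqF// (lt_le_trans _ (s_sigma w))// ltNyr|
      rewrite lt_eqF// (lt_trans sT)// ltry].
  apply/lee_addgt0Pr => e e0; rewrite -(fineK sfin) -EFinD.
  have sTf : fine (sigma w) < T3 D i.+1 w by rewrite -lte_fin fineK.
  (* The rational must also stay below the next event time, since only there does [A'] decide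
     whether [sigma] is at most that rational. *)
  have : fine (sigma w) < Num.min (fine (sigma w) + e) (T3 D i.+1 w).
    by rewrite lt_min sTf ltrDl e0.
  move=> /rat_in_itvoo[x]; rewrite in_itv/= lt_min => /andP[sx /andP[xe xT]].
  apply: (@le_trans _ _ (ratr x)%:E); last by rewrite lee_fin ltW.
  apply: ereal_inf_lbound; exists (pickle x) => //=.
  rewrite /g /q pickleK/= ifT// inE; have [_ /(_ _ xT)[h _]] := A'P (ratr x); apply: h.
  by rewrite -(fineK sfin) lee_fin ltW.
- move=> w Ts; apply: le_ereal_inf_tmp => _ [n _ <-]; rewrite /g; case: ifPn => [|_]; last exact: leey.
  rewrite inE => A'w; rewrite lee_fin leNgt; apply/negP => qT.
  have [_ /(_ _ qT)[_ /(_ A'w)]] := A'P (q n).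
  by move=> /(le_trans Ts); rewrite lee_fin leNgt qT.
Qed.

Lemma Fsn_sigma_algebra n : sigma_algebra setT (Fsn D n).
Proof.
split.
- move=> t st; rewrite set0I -Fst_id.
  exact: (@measurable0 _ (g_sigma_algebraType (Fst D t))).
- move=> A FA t st; rewrite setTD -Fst_id.
  rewrite (_ : _ `&` _ = [set w | T3 D n w <= t] `\` (A `&` [set w | T3 D n w <= t])).
    apply: (@measurableD _ (g_sigma_algebraType (Fst D t))); apply: sub_sigma_algebra.
      exact: Fst_T3_le.
    exact: FA.
  apply/seteqP; split => w /=; first by move=> [? ?]; split => // -[].
  by move=> [? h]; split => // ?; apply: h.
- move=> A FA t st; rewrite setI_bigcupl -Fst_id.
  apply: (@bigcupT_measurable _ (g_sigma_algebraType (Fst D t))) => k.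
  by apply: sub_sigma_algebra; exact: FA.
Qed.

Lemma Fsn_measurable n : Fsn D n `<=` measurable.
Proof.
move=> A FA.
rewrite (_ : A = \bigcup_k (A `&` [set w | T3 D n w <= s + k%:R])).
  apply: bigcupT_measurable => k; apply: (@Fst_measurable _ _ _ _ D (s + k%:R)).
  by apply: FA; rewrite lerDl.
apply/seteqP; split => [w Aw|w [k _ []]//].
exists (Num.truncn (T3 D n w - s)).+1 => //; split => //=.
by rewrite -lerBlDl ltW// truncnS_gt.
Qed.

(* Apply [stopping_past] to the time which is [T3 n] on [A] and infinite off [A]. *)
Lemma Fsn_past n A : Fsn D n A -> exists2 A', <<s past D n >> A' &
  forall w, 0 < S3 n w -> (A w <-> A' w).
Proof.
move=> FA; pose sigma w : \bar R := if w \in A then (T3 D n w)%:E else +oo%E.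
have st : stopping_time D sigma.
  split=> [w|t st]; rewrite /sigma.
    by case: ifPn => _; rewrite ?leey// lee_fin T3_ge.
  rewrite (_ : [set _ | _] = A `&` [set w | T3 D n w <= t]); first exact: FA.
  apply/seteqP; split => w /=; first by case: ifPn => [/set_mem Aw|_]; rewrite ?lee_fin// leye_eq.
  by move=> [Aw Tt]; rewrite mem_set// lee_fin.
have [rho [mrho rho1 rho2]] := stopping_past n st.
exists [set w | (rho w <= (T3 D n w)%:E)%E].
  rewrite (_ : [set _ | _] = (fun w => (rho w <= (T3 D n w)%:E)%E) @^-1` [set true])//.
  apply: (@mfun_preimage _ _ _ _ bool) => //.
  apply: (@measurable_fun_lee _ (g_sigma_algebraType (past D n))) => //.
  by apply/measurable_EFinP; exact: mfun_T3.
(* If the holding time were 0, the next event and its reward would already be visible at [T3 n], and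
   the past of [n] events would not be enough. *)
move=> w Sw; have TT : T3 D n w < T3 D n.+1 w by rewrite T3S ltrDl.
split.
  move=> Aw; have sE : sigma w = (T3 D n w)%:E by rewrite /sigma mem_set.
  by rewrite /= rho1 sE ?lexx// lte_fin.
move=> /= rT; apply: contrapT => nA.
have /rho2 : ((T3 D n.+1 w)%:E <= sigma w)%E by rewrite /sigma memNset// leey.
by move=> /le_trans/(_ rT); rewrite lee_fin leNgt TT.
Qed.

End stopping.

(** * Optimal stopping *)

Section optimal_stopping.
Context {d : measure_display} {T : measurableType d} {R : realType}
        {P : probability T R} (D : problem P).
Variables (y : R -> R -> R -> R) (r : nat -> R -> R -> R -> R).
Hypotheses (streamsD : renewal_reward_streams D) (payoffD : payoff_assumptions D)
  (Ft0 : F D (t0 D) < 1) (Ff : has_density (F D) (density D))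
  (y_fix : fixed_point D y) (r_max : maximizing_functions D r).

Local Notation s := (s0 D).
Local Notation t0 := (t0 D).
Local Notation S3 := (holding D stream3).
Local Notation X3 := (reward D stream3).
Local Notation T3 := (T3 D).
Local Notation L := (t0 - s).
Local Notation nu := (distribution P (S3 0%N) \x distribution P (X3 0%N))%E.

(* The maximum with [Cb] only matters when [s > t0], where the pay-off is constant. *)
Definition base (w : T) : R :=
  Num.max (ga D (Num.max (M D s w) 0) - ca D s + Ctot D) (Cb D).

(** The shifted value after the [i]-th event. It uses the first [i] rewards instead of [Ms], which
    would include simultaneous later events, and is thus measurable for the past. *)
Definition gain (i : nat) (w : T) : R :=
  contval D y (base w) (reward_sum D i w) (T3 i w - s).

Definition Zplus (t : \bar R) (w : T) : R := Z D t w + Ctot D.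

Definition step (i : nat) (w : T) (u : \bar R) (p : R * R) : R :=
  stepval D y (base w) (reward_sum D i w) (T3 i w - s) u p.

Lemma base_ge w : Cb D <= base w.
Proof. by rewrite le_max lexx orbT. Qed.

Lemma base_bounded : exists K, forall w, base w <= K.
Proof.
have [K gK] := ga_bounded payoffD.
exists (Num.max (K - ca D s + Ctot D) (Cb D)) => w.
rewrite /base ge_max !le_max lexx !orbT andbT; apply/orP; left.
by rewrite !lerD2r; apply: gK; rewrite le_max lexx orbT.
Qed.

Lemma baseE w : s <= t0 -> base w = wa D (M D s w) s + Ctot D.
Proof.
move=> st; rewrite /base /wa (max_l (M_ge0 streamsD _ _)) max_l//.
have := ga_ge0 payoffD (M_ge0 streamsD s w).
have := @ca_range _ _ _ _ _ payoffD s; rewrite (s_ge0 payoffD) st => /(_ isT)/andP[].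
by rewrite /Ctot; lra.
Qed.

Lemma mfun_base (G : set (set T)) : measurable_wrt G (M D s) -> measurable_wrt G base.
Proof.
move=> mM.
have mI : measurable (`[0, +oo[ : set R) by exact: measurable_itv.
have mg : measurable_fun (`[0, +oo[ : set R) (ga D).
  by apply: subspace_continuous_measurable_fun => //; exact: ga_continuous.
have mga : measurable_fun setT (fun x : R => ga D (Num.max x 0)).
  apply: (measurable_comp mI) mg measurable_max0.
  by move=> _ [x _ <-] /=; rewrite in_itv/= andbT le_max lexx orbT.
apply: (@measurable_maxr _ (g_sigma_algebraType G)); last exact: measurable_cst.
apply: (@measurable_funD _ (g_sigma_algebraType G)); last exact: measurable_cst.
apply: (@measurable_funD _ (g_sigma_algebraType G)); last exact: measurable_cst.
exact: measurableT_comp mga mM.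
Qed.

Lemma ZplusE t w : s <= t <= t0 -> Zplus t%:E w =
  base w + gbc D (total (fun k => T3 k w) (fun k => X3 k w) t) - cbc D (t - s).
Proof.
move=> /andP[st tt0]; rewrite /Zplus /Z lee_fin tt0 /= /wb MsE// (addrC (M D s w)) addrK.
rewrite (baseE _ (le_trans st tt0)) gbcE; last by apply: total_ge0 => k; exact: reward_ge0.
rewrite cbcE; first by ring.
by rewrite subr_ge0 st/=; have := s_ge0 payoffD; lra.
Qed.

Lemma Zplus_out t w : (t0%:E < t)%E -> Zplus t w = 0.
Proof. by rewrite /Zplus /Z ltNge => /negbTE ->; rewrite addNr. Qed.

Lemma Zplus_ge0 t w : (s%:E <= t)%E -> 0 <= Zplus t w.
Proof.
move=> st; have [tt|/Zplus_out->//] := leP t t0%:E.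
have tE : t = (fine t)%:E.
  by rewrite fineK// fin_numE gt_eqF ?(lt_le_trans _ st)// ?ltNyr// lt_eqF// (le_lt_trans tt)// ltry.
rewrite tE ZplusE; last by rewrite -!lee_fin -tE st.
by have := base_ge w; have := gbc_ge0 payoffD (total (T3 ^~ w) (X3 ^~ w) (fine t));
  have /andP[] := cbc_range payoffD (fine t - s); lra.
Qed.

Lemma Zplus_bounded : exists2 K, 0 <= K & forall t w, (s%:E <= t)%E -> Zplus t w <= K.
Proof.
have [Kb bK] := base_bounded; have [Kg gK] := gbc_bounded payoffD.
exists (Num.max (Kb + Kg) 0); first by rewrite le_max lexx orbT.
move=> t w st; rewrite le_max; have [tt|/Zplus_out->//] := leP t t0%:E; last by rewrite lexx orbT.
have tE : t = (fine t)%:E.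
  by rewrite fineK// fin_numE gt_eqF ?(lt_le_trans _ st)// ?ltNyr// lt_eqF// (le_lt_trans tt)// ltry.
rewrite tE ZplusE; last by rewrite -!lee_fin -tE st.
apply/orP; left; have := bK w; have := gK (total (T3 ^~ w) (X3 ^~ w) (fine t)).
by have /andP[] := cbc_range payoffD (fine t - s); lra.
Qed.

Lemma gain_ge0 i w : 0 <= gain i w.
Proof. by apply: contval_ge0 => //; exact: base_ge. Qed.

Lemma gain_out i w : t0 < T3 i w -> gain i w = 0.
Proof. by move=> tT; rewrite /gain /contval ifF//; apply/negbTE; rewrite -ltNge; lra. Qed.

Lemma gain_bounded : exists2 K, 0 <= K & forall i w, gain i w <= K.
Proof.
have [Kb bK] := base_bounded; have [Kg gK] := gbc_bounded payoffD.
have [Ky Ky0 yK] := y_bound payoffD y_fix.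
exists (Num.max (Kb + Kg + Ky) 0); first by rewrite le_max lexx orbT.
move=> i w; rewrite le_max /gain /contval; case: ifP => bL; last by rewrite lexx orbT.
apply/orP; left; have := bK w; have := gK (reward_sum D i w).
have := on_dom_bounded yK Ky0 (reward_sum D i w, T3 i w - s, t0 - s - (T3 i w - s)).
by move=> /ler_normlP[_]; have /andP[] := cbc_range payoffD (T3 i w - s); lra.
Qed.

(** Links a given rule to the one-step value: with the waiting time [sigma - T3 i] and the actual
    next event, [stepval] gives what the rule collects by then. A tie with the next event counts as
    continuing. *)
Lemma stepE i w sigma : ((T3 i w)%:E <= sigma)%E ->
  step i w (sigma - (T3 i w)%:E)%E (S3 i w, X3 i w) =
  if ((T3 i.+1 w)%:E <= sigma)%E then gain i.+1 w else Zplus sigma w.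
Proof.
move=> Ts; rewrite /step /stepval.
have -> : ((S3 i w, X3 i w).1%:E <= sigma - (T3 i w)%:E)%E = ((T3 i.+1 w)%:E <= sigma)%E.
  by rewrite leeBrDr// -EFinD addrC -T3S.
case: ifPn => [_|].
  by rewrite /gain T3S /reward_sum big_ord_recr/=; congr contval; ring.
rewrite -ltNge => sT.
have sE : sigma = (fine sigma)%:E.
  rewrite fineK// fin_numE gt_eqF ?(lt_le_trans _ Ts)// ?ltNyr//=.
  by rewrite lt_eqF// (lt_trans sT)// ltry.
move: Ts sT; rewrite sE !lee_fin lte_fin => Ts sT; move: (fine sigma) Ts sT => {sE}t Ts sT.
have [tt|tt] := leP t t0; last first.
  by rewrite ifF ?Zplus_out ?lte_fin//; apply/negbTE; rewrite -ltNge; lra.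
have st : s <= t by apply: le_trans Ts; exact: T3_ge.
rewrite ifT; last by lra.
rewrite ZplusE ?st// (@total_in _ (fun k => T3 k w) _ t i) ?Ts//; last exact: T3_nd.
by rewrite /= /reward_sum; congr (_ - cbc _ _); ring.
Qed.

Lemma mfun_gain i : measurable_wrt (past D i) (gain i).
Proof.
apply: (@measurable_contval _ _ _ _ _ payoffD _ y_fix _ (g_sigma_algebraType (past D i))).
- by apply: mfun_base; exact: mfun_M_past.
- exact: mfun_reward_sum.
- by apply: (@measurable_funD _ (g_sigma_algebraType (past D i))) => //; exact: mfun_T3.
Qed.

Lemma measurable_gain i : measurable_fun setT (gain i).
Proof.
apply: (@mfun_subT _ _ (past D i)); last exact: mfun_gain.
by move=> A pA; apply: (@past_measurable _ _ _ _ D i); exact: sub_sigma_algebra.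
Qed.

Lemma measurable_fst_past i d' (U : measurableType d') (f : T -> U) : measurable_wrt (past D i) f ->
  measurable_fun setT (fun q : g_sigma_algebraType (past D i) * (R * R) => f q.1).
Proof. by move=> mf; apply: (measurableT_comp mf); exact: measurable_fst. Qed.

Lemma measurable_step_pair i u : measurable_wrt (past D i) u ->
  measurable_fun setT (fun q : g_sigma_algebraType (past D i) * (R * R) =>
    step i q.1 (u q.1) q.2).
Proof.
move=> mu_; have m1 := @measurable_fst_past i.
rewrite (_ : (fun _ => _) = (fun q : g_sigma_algebraType (past D i) * (R * R) =>
    step i q.1 (u q.1) (q.2.1, q.2.2))); last by apply/funext => -[? []].
apply: measurable_stepval => //.
- by apply: (m1 _ R base); apply: mfun_base; exact: mfun_M_past.
- by apply: (m1 _ R (reward_sum D i)); exact: mfun_reward_sum.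
- apply: (m1 _ R (fun w => T3 i w - s)).
  by apply: (@measurable_funD _ (g_sigma_algebraType (past D i))) => //; exact: mfun_T3.
- by apply: measurableT_comp; [exact: measurable_fst|exact: measurable_snd].
- by apply: measurableT_comp; [exact: measurable_snd|exact: measurable_snd].
- exact: (m1 _ (\bar R) u).
Qed.

Lemma past_meas i : past D i `<=` measurable.
Proof. by move=> A pA; apply: (@past_measurable _ _ _ _ D i); exact: sub_sigma_algebra. Qed.

Lemma measurable_integral_step i u : measurable_wrt (past D i) u ->
  measurable_fun setT (fun w => \int[nu]_p (step i w (u w) p)%:E)%E.
Proof.
move=> mu_; apply: (@mfun_subT _ _ (past D i) _ (\bar R)); first exact: past_meas.
have := (@measurable_fun_fubini_tonelli_F _ _ (g_sigma_algebraType (past D i)) (R * R)%type R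
  (nu : probability (R * R)%type R) (fun q => (step i q.1 (u q.1) q.2)%:E)).
apply.
  by apply/measurable_EFinP; exact: measurable_step_pair.
by move=> q; rewrite lee_fin stepval_ge0// base_ge.
Qed.

(** The freezing argument: the identity, seen as a map to [T] with the sigma-algebra of the past, is
    independent of the next holding time and reward, which can therefore be integrated out with the
    past held fixed. *)
Lemma integral_step i A u : <<s past D i >> A -> measurable_wrt (past D i) u ->
  (\int[P]_(w in A) (step i w (u w) (S3 i w, X3 i w))%:E =
   \int[P]_(w in A) \int[nu]_p (step i w (u w) p)%:E)%E.
Proof.
move=> pA mu_; pose V (w : T) : g_sigma_algebraType (past D i) := w.
have mV : measurable_fun setT V.
  by move=> _ B mB; rewrite setTI; exact: (@past_measurable _ _ _ _ D i).
pose h (q : g_sigma_algebraType (past D i) * (R * R)) : \bar R :=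
  if q.1 \in A then (step i q.1 (u q.1) q.2)%:E else 0%E.
have mh : measurable_fun setT h.
  apply: measurable_fun_ifT => //=.
    apply: (@measurable_fst_past i _ bool (fun w => w \in A)).
    exact: (@measurable_mem _ (g_sigma_algebraType (past D i))).
  by apply/measurable_EFinP; exact: measurable_step_pair.
have h0 q : (0 <= h q)%E.
  by rewrite /h; case: ifP => // _; rewrite lee_fin stepval_ge0// base_ge.
have ind B C E : measurable B -> measurable C -> measurable E ->
    P (V @^-1` B `&` (S3 i @^-1` C `&` X3 i @^-1` E)) =
    (P (V @^-1` B) * (distribution P (S3 0%N) C * distribution P (X3 0%N) E))%E.
  by move=> mB mC mE; exact: (past_independent streamsD).
rewrite integral_mkcond [RHS]integral_mkcond.
transitivity (\int[P]_w h (V w, (S3 i w, X3 i w)))%E.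
  by apply: eq_integral => w _; rewrite patchE /h.
rewrite (ge0_integral_independent mV _ _ ind mh h0)//.
apply: eq_integral => w _; rewrite patchE /h/=; case: ifP => _; last by rewrite integral0.
by apply: eq_integral => -[].
Qed.

Lemma measurable_step i u : measurable_wrt (past D i) u ->
  measurable_fun setT (fun w => step i w (u w) (S3 i w, X3 i w)).
Proof.
move=> mu_; apply: measurable_stepval => //.
- apply: (@mfun_subT _ _ (past D i) _ R base); first exact: past_meas.
  by apply: mfun_base; exact: mfun_M_past.
- apply: (@mfun_subT _ _ (past D i) _ R (reward_sum D i)); first exact: past_meas.
  exact: mfun_reward_sum.
- apply: (@mfun_subT _ _ (past D i) _ R (fun w => T3 i w - s)); first exact: past_meas.
  by apply: (@measurable_funD _ (g_sigma_algebraType (past D i))) => //; exact: mfun_T3.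
- by apply: (@mfun_subT _ _ (past D i) _ (\bar R) u) => //; exact: past_meas.
Qed.

Lemma T3_L i w : 0 <= T3 i w - s.
Proof. by rewrite subr_ge0 T3_ge. Qed.

Lemma integral_step_le i A u : <<s past D i >> A -> measurable_wrt (past D i) u ->
  (forall w, A w -> (0 <= u w)%E) ->
  (\int[P]_(w in A) (step i w (u w) (S3 i w, X3 i w))%:E <=
   \int[P]_(w in A) (gain i w)%:E)%E.
Proof.
move=> pA mu_ u0; rewrite integral_step//.
have mA : measurable A by exact: (@past_measurable _ _ _ _ D i).
apply: ge0_le_integral => //.
- by move=> w _; apply: integral_ge0 => p _; rewrite lee_fin stepval_ge0// base_ge.
- by apply: measurable_funTS; exact: measurable_integral_step.
- by apply/measurable_EFinP; apply: measurable_funTS; exact: measurable_gain.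
- move=> w Aw; apply: integral_stepval_le => //; rewrite ?base_ge ?T3_L ?u0//.
  exact: reward_sum_ge0.
Qed.

Lemma prob_T3_le K : (P [set w | (T3 K w <= t0)%R] <= (F D t0 ^+ K)%:E)%E.
Proof.
have mT k : measurable_fun setT (T3 k).
  by apply: measurable_funD => //; apply: measurable_sum => j; exact: measurable_funPT.
have mB : measurable (`]-oo, t0] : set R) by exact: measurable_itv.
apply: (@le_trans _ _ (P (\bigcap_(k in `I_K) (S3 k @^-1` `]-oo, t0])))).
  apply: le_measure; rewrite ?inE.
  - exact: measurable_sublevel.
  - by apply: bigcap_measurableType => k _; exact: measurable_funPTI.
  - move=> w /= Tt k /= kK; rewrite in_itv/=; apply: le_trans Tt.
    apply: (@le_trans _ _ (T3 k.+1 w)); last exact: T3_nd.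
    rewrite T3S lerDr; apply: le_trans (T3_ge streamsD k w); exact: s_ge0 payoffD.
rewrite prob_bigcap_independent//; last exact: holding_independent.
rewrite (eq_bigr (fun=> (F D t0)%:E)); last first.
  by move=> k _; rewrite /F -(holding_cdfE streamsD stream3 k).
have -> // : (\prod_(k < K) (F D t0)%:E = (F D t0 ^+ K)%:E)%E.
by elim: K => [|K IH]; rewrite ?big_ord0// big_ord_recr/= IH exprSr.
Qed.

Lemma le_of_prob_T3 (a b K : R) i : 0 <= K -> (forall k, (a%:E <= b%:E + K%:E * P [set w | (T3 (i + k) w <= t0)%R])%E) ->
  a <= b.
Proof.
move=> K0 ab; apply/ler_addgt0Pr => e e0.
have [F0 F1] : 0 <= F D t0 /\ F D t0 < 1 by split => //; exact: F_ge0.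
have : F D t0 ^+ k @[k --> \oo] --> (0 : R) by apply: cvg_expr; rewrite ger0_norm.
have e1 : 0 < e / (K + 1) by rewrite divr_gt0// ltr_wpDl.
move=> /cvgrPdist_lt/(_ _ e1)[k _ /(_ k (leqnn k))]; rewrite /= sub0r normrN ger0_norm ?exprn_ge0//.
move=> Fk; rewrite -lee_fin; apply: (le_trans (ab k)); rewrite EFinD leeD2l//.
have Pk : (P [set w | (T3 (i + k) w <= t0)%R] <= (F D t0 ^+ k)%:E)%E.
  apply: (le_trans (prob_T3_le (i + k))); rewrite lee_fin.
  by rewrite exprD ler_piMl ?exprn_ge0// exprn_ile1// ltW.
apply: (le_trans (lee_wpmul2l _ Pk)) => //; rewrite -EFinM lee_fin.
move: Fk; rewrite ltr_pdivlMr ?ltr_wpDl// => /ltW; apply: le_trans.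
by rewrite mulrC ler_wpM2l ?exprn_ge0// lerDl.
Qed.

Lemma integral_le_mass A E (f : T -> R) K : measurable A -> measurable E ->
  measurable_fun setT f -> 0 <= K -> (forall w, A w -> 0 <= f w <= K) ->
  (forall w, A w -> ~ E w -> f w = 0) ->
  (\int[P]_(w in A) (f w)%:E <= K%:E * P E)%E.
Proof.
move=> mA mE mf K0 fK f0; rewrite -(@integral_cst _ _ _ P _ mE).
rewrite [leLHS]integral_mkcond [leRHS]integral_mkcond.
apply: ge0_le_integral => //.
- by move=> w _; rewrite patchE; case: ifPn => // /set_mem/fK/andP[].
- by apply/(measurable_restrictT _ mA)/measurable_funTS/measurable_EFinP.
- by apply/(measurable_restrictT _ mE).
- move=> w _; rewrite !patchE; case: ifPn => [/set_mem Aw|_]; case: ifPn => //.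
  + by move=> _; rewrite lee_fin; have /andP[] := fK _ Aw.
  + by move=> /negP nE; rewrite f0// => /mem_set.
Qed.

Lemma integral_split A B (f : T -> R) : measurable A -> measurable B ->
  measurable_fun setT f -> (forall w, A w -> 0 <= f w) ->
  (\int[P]_(w in A) (f w)%:E =
   \int[P]_(w in A `\` B) (f w)%:E + \int[P]_(w in A `&` B) (f w)%:E)%E.
Proof.
move=> mA mB mf f0; rewrite -{1}(setDUK (@subIsetl _ A B)) setUC.
rewrite setDIr setDv set0U ge0_integral_setU//.
- exact: measurableD.
- exact: measurableI.
- by apply/measurable_EFinP; exact: measurable_funTS.
- by move=> w [[Aw _]|[Aw _]]; rewrite lee_fin f0.
- by apply/disj_setPS => w [[_ nB] [_ /nB]].
Qed.

(** [A] is split according to whether [sigma] reaches the next event: on that part the induction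
    applies from [i.+1], and the one-step bound then absorbs both parts into [gain i]. When the
    steps run out, the pay-off is at most [K], and 0 if the current event is after [t0]. *)
Lemma integral_upper k i A sigma K : stopping_time D sigma ->
  measurable_fun setT (fun w => Zplus (sigma w) w) -> <<s past D i >> A ->
  (forall w, A w -> ((T3 i w)%:E <= sigma w)%E) ->
  0 <= K -> (forall t w, (s%:E <= t)%E -> Zplus t w <= K) ->
  (\int[P]_(w in A) (Zplus (sigma w) w)%:E <=
   \int[P]_(w in A) (gain i w)%:E + K%:E * P [set w | (T3 (i + k) w <= t0)%R])%E.
Proof.
move=> st mZ + + K0 ZK; have [s_sigma _] := st.
have Z0 w : 0 <= Zplus (sigma w) w by apply: Zplus_ge0.
have mT j : measurable [set w | T3 j w <= t0].
  apply: measurable_sublevel.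
  by apply: measurable_funD => //; apply: measurable_sum => l; exact: measurable_funPT.
elim: k i A => [|k IH] i A pA Ts.
  rewrite addn0 -[leLHS]add0e; apply: leeD.
    by apply: integral_ge0 => w _; rewrite lee_fin gain_ge0.
  apply: integral_le_mass => //; first exact: past_measurable pA.
    by move=> w Aw; rewrite Z0 ZK.
  move=> w Aw /negP; rewrite -ltNge => tT; apply: Zplus_out.
  by apply: lt_le_trans (Ts _ Aw); rewrite lte_fin.
have [rho [mrho rho1 rho2]] := stopping_past streamsD i st.
(* Written with [rho] instead of [sigma], this event is seen to belong to the past of [i.+1] events,
   as the induction requires. *)
pose B := [set w | ((T3 i.+1 w)%:E <= sigma w)%E].
pose B' := [set w | ((T3 i.+1 w)%:E <= rho w)%E].
have BB' : B' = B.
  apply/seteqP; split => w; rewrite /B /B'/=; last exact: rho2.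
  by move=> Tr; rewrite leNgt; apply/negP => sT; move: (Tr); rewrite rho1// leNgt sT.
have pB : <<s past D i.+1 >> B.
  rewrite -BB' (_ : B' = (fun w => ((T3 i.+1 w)%:E <= rho w)%E) @^-1` [set true])//.
  apply: (@mfun_preimage _ _ _ _ bool) => //.
  apply: (@measurable_fun_lee _ (g_sigma_algebraType (past D i.+1))).
    by apply/measurable_EFinP; exact: mfun_T3.
  apply: (@mfun_sub _ _ (past D i) _ _ (\bar R)) => //.
  by move=> C pC; apply: (@past_sub _ _ _ _ D i) => //; exact: sub_sigma_algebra.
have pAB : <<s past D i.+1 >> (A `&` B).
  apply: (@measurableI _ (g_sigma_algebraType (past D i.+1))) => //.
  exact: (@past_sub _ _ _ _ D i).
have mA := past_measurable pA; have mB := past_measurable pB.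
rewrite (integral_split mA mB mZ) //.
have {}IH := IH i.+1 (A `&` B) pAB (fun w AB => AB.2).
rewrite addSnnS in IH; apply: (le_trans (leeD2l _ IH)); rewrite addeA leeD2r//.
(* The waiting time has to be measurable for the past of [i] events, so it is taken from [rho];
   [stepE] turns it back into [sigma] on each part. *)
pose u w := (rho w - (T3 i w)%:E)%E.
have mu_ : measurable_wrt (past D i) u.
  apply: (@emeasurable_funB _ (g_sigma_algebraType (past D i))) => //.
  by apply/measurable_EFinP; exact: mfun_T3.
have Tr w : A w -> ((T3 i w)%:E <= rho w)%E.
  move=> Aw; have [/rho2|/rho1->] := leP (T3 i.+1 w)%:E (sigma w); last exact: Ts.
  by apply: le_trans; rewrite lee_fin T3_nd.
have u0 w : A w -> (0 <= u w)%E by move=> Aw; rewrite sube_ge0// Tr.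
apply: le_trans (integral_step_le pA mu_ u0).
rewrite [leRHS](integral_split mA mB (measurable_step mu_)); last first.
  by move=> w Aw; apply: stepval_ge0 => //; exact: base_ge.
rewrite le_eqVlt; apply/orP; left; apply/eqP; congr (_ + _)%E.
  apply: eq_integral => w /set_mem[Aw nB]; rewrite stepE ?Tr//.
  have sT : (sigma w < (T3 i.+1 w)%:E)%E by rewrite ltNge; exact/negP.
  by rewrite rho1// leNgt sT.
apply: eq_integral => w /set_mem[Aw Bw]; rewrite stepE ?Tr//.
by rewrite rho2.
Qed.

(* The optimal waiting time after the [i]-th event, 0 after [t0]. *)
Definition rest (i : nat) (w : T) : R :=
  on_dom D (rinf r) (reward_sum D i w, T3 i w - s, t0 - T3 i w).

Definition plan (i : nat) (w : T) : R := T3 i w + rest i w.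

(* The optimal rule after the [i]-th event, forced to stop at the [(i + k)]-th. *)
Fixpoint theta (k i : nat) (w : T) : R :=
  if k is k'.+1 then if plan i w < T3 i.+1 w then plan i w else theta k' i.+1 w
  else T3 i w.

Definition tau (i : nat) (w : T) : R := limn (fun k => theta k i w).

Lemma bounded_meas_rinf : bounded_meas D (rinf r).
Proof.
split; last exact: measurable_rinf y_fix r_max.
exists t0 => a b c dabc.
have /andP[r0 rc] := rinf_in streamsD payoffD Ft0 Ff y_fix r_max dabc.
rewrite ger0_norm// (le_trans rc)//; case: dabc => _ /= b0 _ bc; lra.
Qed.

Lemma dom_T3 i w : T3 i w <= t0 -> dom D (reward_sum D i w, T3 i w - s, t0 - T3 i w).
Proof.
move=> Tt; split => /=; [exact: reward_sum_ge0|exact: T3_L|by rewrite subr_ge0|].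
by have := s_ge0 payoffD; lra.
Qed.

Lemma restE i w : T3 i w <= t0 ->
  rest i w = rinf r (reward_sum D i w) (T3 i w - s) (t0 - T3 i w).
Proof. by move=> Tt; rewrite /rest on_domE//; exact: dom_T3. Qed.

Lemma rest_in i w : T3 i w <= t0 -> 0 <= rest i w <= t0 - T3 i w.
Proof.
move=> Tt; rewrite restE//.
exact: (rinf_in streamsD payoffD Ft0 Ff y_fix r_max (dom_T3 Tt)).
Qed.

Lemma rest_out i w : t0 < T3 i w -> rest i w = 0.
Proof.
move=> tT; rewrite /rest /on_dom patchE memNset// => -[_ _ /=].
by rewrite subr_ge0 leNgt tT.
Qed.

Lemma rest_ge0 i w : 0 <= rest i w.
Proof. by have [/rest_in/andP[]|/rest_out->] := leP (T3 i w) t0. Qed.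

Lemma plan_le i w : plan i w <= Num.max (T3 i w) t0.
Proof.
rewrite /plan; have [Tt|tT] := leP (T3 i w) t0.
  by have /andP[_] := rest_in Tt; lra.
by rewrite rest_out// addr0.
Qed.

Lemma theta_ge k i w : T3 i w <= theta k i w.
Proof.
elim: k i => [|k IH] i //=; case: ifP => _; first by rewrite lerDl rest_ge0.
by apply: le_trans (IH i.+1); exact: T3_nd.
Qed.

Lemma theta_le k i w : theta k i w <= Num.max (T3 i w) t0.
Proof.
elim: k i => [|k IH] i /=; first by rewrite le_max lexx.
case: ltP => [_|Tr]; first exact: plan_le.
apply: (le_trans (IH i.+1)); rewrite ge_max (le_trans Tr) ?plan_le//.
by rewrite le_max lexx orbT.
Qed.

Lemma theta_nd i w : nondecreasing_seq (fun k => theta k i w).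
Proof.
apply/nondecreasing_seqP => k; elim: k i => [|k IH] i; first exact: theta_ge.
by rewrite /= -/(theta k.+1 i.+1 w); case: ifP => // _; exact: IH.
Qed.

Lemma theta_cvg i w : theta k i w @[k --> \oo] --> tau i w.
Proof.
apply: nondecreasing_is_cvgn; first exact: theta_nd.
by exists (Num.max (T3 i w) t0) => _ [k _ <-]; exact: theta_le.
Qed.

Lemma theta_le_tau k i w : theta k i w <= tau i w.
Proof. exact: (nondecreasing_cvgn_le (@theta_nd i w) (@theta_cvg i w)). Qed.

Lemma tau_le i w x : (forall k, theta k i w <= x) -> tau i w <= x.
Proof. by move=> h; apply: (cvgr_to_le (@theta_cvg i w)); exact: nearW. Qed.

Lemma tau_ge i w : T3 i w <= tau i w.
Proof. exact: (theta_le_tau 0 i w). Qed.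

Lemma tau_le_t0 i w : tau i w <= Num.max (T3 i w) t0.
Proof. by apply: tau_le => k; exact: theta_le. Qed.

Lemma tauE i w : tau i w = if plan i w < T3 i.+1 w then plan i w else tau i.+1 w.
Proof.
have h1 : theta k.+1 i w @[k --> \oo] --> tau i w.
  by have := @theta_cvg i w; rewrite -(cvg_shiftS (fun k => theta k i w)).
apply: (cvg_unique _ h1) => //=; case: ifP => _; [exact: cvg_cst|exact: theta_cvg].
Qed.

(** Once the [i]-th event has occurred by time [t], the planned stopping time is a function of
    observed quantities, and so is its comparison with the next event as far as it matters by time
    [t]. *)
Lemma theta_stopping k i t : s <= t -> Fst D t [set w | theta k i w <= t].
Proof.
move=> st; elim: k i => [|k IH] i; first exact: Fst_T3_le.
pose A w := \sum_(j < i) obs_reward t (T3 j.+1 w) (X3 j w).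
pose o j w := obs_time t (T3 j w).
pose rt w := o i w + on_dom D (rinf r) (A w, o i w - s, t0 - o i w).
have rtE w : T3 i w <= t -> rt w = plan i w.
  move=> Tt; rewrite /rt /o /obs_time Tt; congr (_ + on_dom _ _ (_, _, _)).
  apply: eq_bigr => j _; rewrite /obs_reward ifT//; apply: le_trans Tt.
  by apply: T3_nd.
pose GT := g_sigma_algebraType (Fst D t).
have mo j : measurable_wrt (Fst D t) (o j) by exact: mfun_obs_time.
have mrt : measurable_wrt (Fst D t) rt.
  apply: (@measurable_funD _ GT) => //.
  apply: (measurableT_comp (measurable_on_dom bounded_meas_rinf)).
  apply: (@measurable_fun_pair _ _ _ GT); last exact: (@measurable_funB _ GT).
  apply: (@measurable_fun_pair _ _ _ GT); last exact: (@measurable_funB _ GT).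
  by apply: (@measurable_sum _ GT) => j; exact: mfun_obs_reward.
(* The next event time is replaced by its observed value. The two may differ only after [t], where
   the value [t + 1] still exceeds any plan that is at most [t]. *)
rewrite (_ : [set w | _] = [set w | T3 i w <= t] `&`
    (([set w | rt w <= t] `&` (fun w => rt w < o i.+1 w) @^-1` [set true]) `|`
     ((fun w => o i.+1 w <= rt w) @^-1` [set true] `&` [set w | theta k i.+1 w <= t]))).
  rewrite -Fst_id; apply: (@measurableI _ GT); first by apply: sub_sigma_algebra; exact: Fst_T3_le.
  apply: (@measurableU _ GT); apply: (@measurableI _ GT).
  - exact: (@measurable_sublevel _ _ GT).
  - apply: (@mfun_preimage _ _ _ _ bool) => //; exact: (@measurable_fun_ltr _ GT).
  - apply: (@mfun_preimage _ _ _ _ bool) => //; exact: (@measurable_fun_ler _ GT).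
  - by apply: sub_sigma_algebra; exact: IH.
apply/seteqP; split => w /=.
  move=> th; have Tt : T3 i w <= t by apply: le_trans th; exact: (theta_ge k.+1).
  split => //; rewrite rtE// /o /obs_time; move: th.
  case: (ltP (plan i w)) => [rT rt'|Tr th].
    by left; split => //; case: ifP => // _; lra.
  right; split => //; rewrite ifT//; apply: le_trans th; exact: theta_ge.
move=> [Tt]; rewrite rtE// /o /obs_time; case: (ltP (plan i w) (T3 i.+1 w)) => rT.
  case => [[]//|[+ th]]; rewrite ifT; last by apply: le_trans th; exact: theta_ge.
  by rewrite leNgt rT.
case => [[rt']|[]//]; case: ifP => [_|]; first by rewrite ltNge rT.
by move=> /negbT; rewrite -ltNge => tT; have := lt_le_trans tT (le_trans rT rt'); rewrite ltxx.
Qed.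

Lemma tau_stopping i : stopping_time D (EFin \o tau i).
Proof.
split=> [w|t st]; first by rewrite lee_fin (le_trans (T3_ge streamsD i w))// tau_ge.
rewrite (_ : [set _ | _] = \bigcap_k [set w | theta k i w <= t]).
  rewrite -Fst_id; apply: (@bigcap_measurableType _ (g_sigma_algebraType (Fst D t))) => k _.
  by apply: sub_sigma_algebra; exact: theta_stopping.
apply/seteqP; split => w /=; rewrite lee_fin.
  by move=> tt k _; exact: le_trans (theta_le_tau k i w) tt.
by move=> h; apply: tau_le => k; exact: h.
Qed.

Lemma measurable_T3 k : measurable_fun setT (T3 k).
Proof. by apply: measurable_funD => //; apply: measurable_sum => j; exact: measurable_funPT. Qed.

Lemma measurable_base : measurable_fun setT base.
Proof.
apply: (@mfun_subT _ _ (past D 0) _ R base); first exact: past_meas.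
by apply: mfun_base; exact: mfun_M_past.
Qed.

Lemma measurable_tau i : measurable_fun setT (tau i).
Proof.
apply: (measurability _ (RGenOInfty.measurableE R)) => //.
move=> _ [_ [c ->] <-]; rewrite setTI.
rewrite (_ : _ @^-1` _ = ~` [set w | ((tau i w)%:E <= c%:E)%E]).
  apply: measurableC; have [sc|cs] := leP s c.
    by apply: (@Fst_measurable _ _ _ _ D c); have [_] := tau_stopping i; exact.
  rewrite (_ : [set _ | _] = set0)//; apply/seteqP; split => // w /=.
  rewrite lee_fin => tc; have := le_lt_trans (le_trans (T3_ge streamsD i w) (le_trans (tau_ge i w) tc)) cs.
  by rewrite ltxx.
by apply/seteqP; split => w /=; rewrite in_itv/= andbT lee_fin ltNge => /negP.
Qed.

Lemma s_le_tau i w : s <= tau i w.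
Proof. exact: le_trans (T3_ge streamsD i w) (tau_ge i w). Qed.

Lemma measurable_Zplus_tau i : measurable_fun setT (fun w => Zplus (tau i w)%:E w).
Proof.
have mt := measurable_tau i.
rewrite (_ : (fun _ => _) = fun w => if tau i w <= t0 then
    base w + gbc D (total (fun k => T3 k w) (fun k => X3 k w) (tau i w)) -
    cbc D (tau i w - s) else 0).
  apply: measurable_fun_ifT => //; first exact: measurable_fun_ler.
  apply: measurable_funB; last first.
    by apply: (measurableT_comp (measurable_cbc payoffD)); exact: measurable_funB.
  apply: measurable_funD; first exact: measurable_base.
  apply: (measurableT_comp (measurable_gbc payoffD)).
  apply: measurable_total => //; [exact: T3_nd|exact: measurable_T3].
apply/funext => w; case: leP => tt; first by rewrite ZplusE ?s_le_tau.
by rewrite Zplus_out ?lte_fin.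
Qed.

Lemma mfun_plan i : measurable_wrt (past D i) (plan i).
Proof.
pose GT := g_sigma_algebraType (past D i).
have mT : measurable_wrt (past D i) (T3 i) by exact: mfun_T3.
apply: (@measurable_funD _ GT) => //.
apply: (measurableT_comp (measurable_on_dom bounded_meas_rinf)).
apply: (@measurable_fun_pair _ _ _ GT); last exact: (@measurable_funB _ GT).
apply: (@measurable_fun_pair _ _ _ GT); last exact: (@measurable_funB _ GT).
exact: mfun_reward_sum.
Qed.

(** Up to [t0] this is the maximality of [rinf]; after [t0] both integrands are 0. *)
Lemma integral_step_rest i A : <<s past D i >> A ->
  (\int[P]_(w in A) (step i w ((plan i w)%:E - (T3 i w)%:E)%E (S3 i w, X3 i w))%:E =
   \int[P]_(w in A) (gain i w)%:E)%E.
Proof.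
move=> pA; rewrite (integral_step pA (u := fun w => ((plan i w)%:E - (T3 i w)%:E)%E)).
  apply: eq_integral => w _; rewrite -EFinB /plan addrC addKr.
  have [Tt|tT] := leP (T3 i w) t0; last first.
    rewrite rest_out// gain_out// /step integral_stepval_over//.
    by rewrite ltrBlDr subrK.
  rewrite /gain -(integral_stepval_rinf streamsD payoffD Ft0 Ff y_fix r_max).
  - have -> : rest i w = rinf r (reward_sum D i w) (T3 i w - s) (L - (T3 i w - s)).
      by rewrite (restE Tt); congr rinf; ring.
    by [].
  - exact: reward_sum_ge0.
  - exact: T3_L.
  - by rewrite lerD2r.
apply: (@emeasurable_funB _ (g_sigma_algebraType (past D i))).
  by apply/measurable_EFinP; exact: mfun_plan.
by apply/measurable_EFinP; exact: mfun_T3.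
Qed.

(** The counterpart of [integral_upper], with equality in each step. The error is now the gain left
    after [k] further events, which vanishes unless the last of them is by [t0]. *)
Lemma integral_lower k i A K : <<s past D i >> A -> 0 <= K -> (forall j w, gain j w <= K) ->
  (\int[P]_(w in A) (gain i w)%:E <=
   \int[P]_(w in A) (Zplus (tau i w)%:E w)%:E + K%:E * P [set w | (T3 (i + k) w <= t0)%R])%E.
Proof.
move=> + K0 gK.
have Z0 j w : 0 <= Zplus (tau j w)%:E w by apply: Zplus_ge0; rewrite lee_fin s_le_tau.
have mT j : measurable [set w | T3 j w <= t0].
  by apply: measurable_sublevel; exact: measurable_T3.
elim: k i A => [|k IH] i A pA.
  rewrite addn0 -[leLHS]add0e; apply: leeD.
    by apply: integral_ge0 => w _; rewrite lee_fin.
  apply: integral_le_mass => //; [exact: past_measurable pA|exact: measurable_gain| |].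
    by move=> w Aw; rewrite gain_ge0 gK.
  by move=> w Aw /negP; rewrite -ltNge => tT; exact: gain_out.
pose B := [set w | T3 i.+1 w <= plan i w].
have pB : <<s past D i.+1 >> B.
  rewrite (_ : B = (fun w => T3 i.+1 w <= plan i w) @^-1` [set true])//.
  apply: (@mfun_preimage _ _ _ _ bool) => //.
  apply: (@measurable_fun_ler _ (g_sigma_algebraType (past D i.+1))).
    exact: mfun_T3.
  apply: (@mfun_sub _ _ (past D i) _ _ R); last exact: mfun_plan.
  by move=> C pC; apply: (@past_sub _ _ _ _ D i) => //; exact: sub_sigma_algebra.
have pAB : <<s past D i.+1 >> (A `&` B).
  apply: (@measurableI _ (g_sigma_algebraType (past D i.+1))) => //.
  exact: (@past_sub _ _ _ _ D i).
have mA := past_measurable pA; have mB := past_measurable pB.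
have mu_ : measurable_wrt (past D i) (fun w => ((plan i w)%:E - (T3 i w)%:E)%E).
  apply: (@emeasurable_funB _ (g_sigma_algebraType (past D i))).
    by apply/measurable_EFinP; exact: mfun_plan.
  by apply/measurable_EFinP; exact: mfun_T3.
have Tr w : ((T3 i w)%:E <= (plan i w)%:E)%E by rewrite lee_fin lerDl rest_ge0.
rewrite -integral_step_rest// (integral_split mA mB (measurable_step mu_)); last first.
  by move=> w Aw; apply: stepval_ge0 => //; exact: base_ge.
rewrite (integral_split mA mB (measurable_Zplus_tau i))//.
have {}IH := IH i.+1 (A `&` B) pAB; rewrite addSnnS in IH.
rewrite -addeA; apply: leeD.
  rewrite le_eqVlt; apply/orP; left; apply/eqP.
  apply: eq_integral => w /set_mem[Aw nB]; rewrite stepE// lee_fin tauE.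
  by rewrite ltNge (negbTE (introN idP nB)).
apply: le_trans (le_trans IH _).
  rewrite le_eqVlt; apply/orP; left; apply/eqP.
  by apply: eq_integral => w /set_mem[Aw Bw]; rewrite stepE// lee_fin ifT.
rewrite leeD2r// le_eqVlt; apply/orP; left; apply/eqP.
by apply: eq_integral => w /set_mem[Aw Bw]; rewrite [in RHS]tauE ltNge ifN// negbK.
Qed.

End optimal_stopping.

(** * Passage to the limit, almost sure convergence and the value *)

Section conclusion.
Context {d : measure_display} {T : measurableType d} {R : realType}
        {P : probability T R} (D : problem P).
Variables (y : R -> R -> R -> R) (r : nat -> R -> R -> R -> R).
Hypotheses (streamsD : renewal_reward_streams D) (payoffD : payoff_assumptions D)
  (Ft0 : F D (t0 D) < 1) (Ff : has_density (F D) (density D))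
  (y_fix : fixed_point D y) (r_max : maximizing_functions D r).

Local Notation s := (s0 D).
Local Notation t0 := (t0 D).
Local Notation S3 := (holding D stream3).
Local Notation X3 := (reward D stream3).
Local Notation T3 := (T3 D).
Local Notation nu := (distribution P (S3 0%N) \x distribution P (X3 0%N))%E.
Local Notation rest := (rest D r).
Local Notation tau := (tau D r).
Local Notation gain := (gain D y).

Lemma ae_foralln (Q : nat -> T -> Prop) : (forall n, {ae P, forall w, Q n w}) ->
  {ae P, forall w, forall n, Q n w}.
Proof.
move=> aeQ; have /= : P.-negligible (\bigcup_n ~` [set w | Q n w]).
  by apply: negligible_bigcup => n; exact: aeQ.
apply: negligibleS => w /= nQ; apply: contrapT => h; apply: nQ => n.
by apply: contrapT => nQn; apply: h; exists n.
Qed.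

(** The waiting time depends on the past alone, and the holding time is independent of it with a law
    without atoms. The tie must be excluded because [eta] compares strictly: with [Rstar] increasing
    strictly to [rest = S3], every finite stage stops before an event past which the limit rule goes
    on. *)
Lemma holding_ne_rest i : {ae P, forall w, S3 i w <> rest i w}.
Proof.
pose E := [set w | S3 i w = rest i w].
pose GT := g_sigma_algebraType (past D i).
pose V (w : T) : GT := w.
have mV : measurable_fun setT V.
  by move=> _ B mB; rewrite setTI; exact: (@past_measurable _ _ _ _ D i).
have mrest : measurable_wrt (past D i) (rest i).
  rewrite (_ : rest i = fun w => plan D r i w - T3 i w).
    by apply: (@measurable_funB _ GT); [exact: (mfun_plan streamsD payoffD Ft0 Ff y_fix r_max)|exact: mfun_T3].
  by apply/funext => w; rewrite /plan addrC addKr.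
pose h (q : GT * (R * R)) : \bar R := if q.2.1 == rest i q.1 then 1%E else 0%E.
have mh : measurable_fun setT h.
  apply: measurable_fun_ifT => //; apply: measurable_fun_eqr.
    by apply: measurableT_comp; [exact: measurable_fst|exact: measurable_snd].
  exact: (@measurable_fst_past _ _ _ _ D i _ R).
have h0 q : (0 <= h q)%E by rewrite /h; case: ifP.
have ind B C E' : measurable B -> measurable C -> measurable E' ->
    P (V @^-1` B `&` (S3 i @^-1` C `&` X3 i @^-1` E')) =
    (P (V @^-1` B) * (distribution P (S3 0%N) C * distribution P (X3 0%N) E'))%E.
  by move=> mB mC mE; exact: (past_independent streamsD).
have := ge0_integral_independent mV (measurable_funPT (S3 i)) (measurable_funPT (X3 i)) ind mh h0.
rewrite [RHS](_ : _ = 0%E); last first.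
  rewrite -[RHS](@integral0 _ _ _ P setT); apply: eq_integral => w _.
  rewrite (ae_eq_integral (cst 0%E))//; first by rewrite integral0.
    by apply: (measurableT_comp mh); exact: measurable_pair1.
  have := nu_ae streamsD Ff (rest i w); apply: filterS => p [_ _ /eqP pr] _.
  by rewrite /h/= (negbTE pr).
have mE : measurable E.
  rewrite (_ : E = (fun w => S3 i w == rest i w) @^-1` [set true]).
    suff : measurable_fun setT (fun w => S3 i w == rest i w).
      by move=> /(_ measurableT [set true]); rewrite setTI; exact.
    apply: measurable_fun_eqr => //.
    apply: (@mfun_subT _ _ (past D i) _ R (rest i)) => //; exact: past_meas.
  by apply/seteqP; split => w /= /eqP.
move=> PE; have : P E = 0%E.
  rewrite -(setIT E) -integral_indic// -[RHS]PE; apply: eq_integral => w _.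
  rewrite /h indicE; case: eqP => e; first by rewrite mem_set.
  by rewrite memNset.
move=> PE0; exists E; split => // w /= /contrapT; exact.
Qed.

Lemma holding_gt0 k : {ae P, forall w, 0 < S3 k w}.
Proof.
have m0 : measurable ([set 0] : set R) by exact: measurable_set1.
exists (S3 k @^-1` [set 0]); split; first exact: measurable_funPTI.
  by rewrite (prob_holding streamsD)//; exact: muS_set1.
move=> w /= /negP; rewrite -leNgt => S0; apply/eqP; rewrite eq_le S0.
exact: holding_ge0.
Qed.

Lemma T3_unbounded : {ae P, forall w, exists k, t0 < T3 k w}.
Proof.
pose E k := [set w | T3 k w <= t0].
have mE k : measurable (E k) by apply: measurable_sublevel; exact: measurable_T3.
have mI : measurable (\bigcap_k E k) by exact: bigcapT_measurable.
exists (\bigcap_k E k); split => //; last first.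
  by move=> w /= nk k _; rewrite /E/= leNgt; apply/negP => tT; apply: nk; exists k.
apply/eqP; rewrite eq_le measure_ge0 andbT -[P _]fineK ?fin_num_measure// lee_fin.
apply: (le_of_prob_T3 streamsD payoffD Ft0 (K := 1) (i := 0)) => // k.
rewrite add0e mul1e fineK ?fin_num_measure// add0n.
by apply: le_measure; rewrite ?inE//; [exact: (mE k)|move=> w Ew; exact: (Ew k)].
Qed.

Lemma bounded_integral_fin A (f : T -> R) C : measurable A -> measurable_fun setT f ->
  (forall w, 0 <= f w <= C) -> (\int[P]_(w in A) (f w)%:E)%E \is a fin_num.
Proof.
move=> mA mf fC; apply: integrable_fin_num => //.
apply: (@integrableS _ _ _ _ setT) => //.
apply: (@bounded_integrable _ _ _ P f C) => // w.
by have /andP[f0 fC'] := fC w; rewrite ger0_norm.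
Qed.

Lemma integral_upper_limit n A sigma : stopping_time D sigma ->
  measurable_fun setT (fun w => Zplus D (sigma w) w) -> <<s past D n >> A ->
  (forall w, A w -> ((T3 n w)%:E <= sigma w)%E) ->
  (\int[P]_(w in A) (Zplus D (sigma w) w)%:E <= \int[P]_(w in A) (gain n w)%:E)%E.
Proof.
move=> st mZ pA Ts; have mA := past_measurable pA.
have [K K0 ZK] := Zplus_bounded streamsD payoffD.
have [K' K'0 gK] := gain_bounded payoffD y_fix.
have [s_sigma _] := st.
have f1 := bounded_integral_fin mA mZ (fun w => introT andP (conj (Zplus_ge0 streamsD payoffD w (s_sigma w)) (ZK _ w (s_sigma w)))).
have f2 := bounded_integral_fin mA (measurable_gain streamsD payoffD y_fix n)
  (fun w => introT andP (conj (gain_ge0 streamsD payoffD Ft0 Ff y_fix n w) (gK n w))).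
rewrite -(fineK f1) -(fineK f2) lee_fin.
apply: (le_of_prob_T3 streamsD payoffD Ft0 K0 (i := n)) => k; rewrite !fineK//.
exact: (integral_upper streamsD payoffD Ft0 Ff y_fix).
Qed.

Lemma integral_lower_limit n A : <<s past D n >> A ->
  (\int[P]_(w in A) (gain n w)%:E <= \int[P]_(w in A) (Zplus D (tau n w)%:E w)%:E)%E.
Proof.
move=> pA; have mA := past_measurable pA.
have [K K0 ZK] := Zplus_bounded streamsD payoffD.
have [K' K'0 gK] := gain_bounded payoffD y_fix.
have s_tau w : (s%:E <= (tau n w)%:E)%E.
  by rewrite lee_fin (s_le_tau streamsD payoffD Ft0 Ff y_fix r_max).
have mZ := measurable_Zplus_tau streamsD payoffD Ft0 Ff y_fix r_max n.
have f1 := bounded_integral_fin mA mZ (fun w => introT andP (conj (Zplus_ge0 streamsD payoffD w (s_tau w)) (ZK _ w (s_tau w)))).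
have f2 := bounded_integral_fin mA (measurable_gain streamsD payoffD y_fix n)
  (fun w => introT andP (conj (gain_ge0 streamsD payoffD Ft0 Ff y_fix n w) (gK n w))).
rewrite -(fineK f1) -(fineK f2) lee_fin.
apply: (le_of_prob_T3 streamsD payoffD Ft0 K'0 (i := n)) => k; rewrite !fineK//.
exact: (integral_lower streamsD payoffD Ft0 Ff y_fix r_max).
Qed.

Lemma eta_ge n K w : (n <= K)%N -> (n <= Defs.eta D r n K w)%N.
Proof.
move=> nK; rewrite /Defs.eta big_seq_cond; apply: (big_ind (fun x => n <= x)%N) => //.
- by move=> i j ni nj; rewrite leq_min ni.
- by move=> i /andP[]; rewrite mem_index_iota => /andP[].
Qed.

Lemma tau_nKE n K w : (n < K)%N -> tau_nK D r n K w =
  if Rstar D r K n w < S3 n w then T3 n w + Rstar D r K n w else tau_nK D r n.+1 K w.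
Proof.
move=> nK; rewrite /tau_nK; suff -> : Defs.eta D r n K w =
    if Rstar D r K n w < S3 n w then n else Defs.eta D r n.+1 K w by case: ifP.
rewrite {1}/Defs.eta big_ltn_cond// -/(Defs.eta D r n.+1 K w); case: ifP => // _.
by apply/minn_idPl; apply: leq_trans (eta_ge w nK).
Qed.

(** Backward induction from an event after [t0], where all rules stop. Before it, either the limit
    waiting time is shorter than the holding time and every stage [K > n] stops there, or it is
    longer and all large [K] pass on to the next event. *)
Lemma tau_nK_cvg w : (forall k, 0 < S3 k w) -> (exists k, t0 < T3 k w) ->
  (forall k, S3 k w <> rest k w) -> forall n, tau_nK D r n K w @[K --> \oo] --> tau n w.
Proof.
move=> S_gt0 [k tT] S_ne n.
have TS i : T3 i w < T3 i.+1 w by rewrite T3S ltrDl.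
(* Positive holding times make the event times distinct, so exactly [i] events are counted at
   [T3 i]. *)
have MsT i : Ms D (T3 i w) w - M D s w = reward_sum D i w.
  rewrite MsE ?T3_ge// addrC addKr (@total_in _ (fun k => T3 k w) _ _ i) ?lexx ?TS//.
  exact: T3_nd.
have over i : t0 < T3 i w -> tau_nK D r i K w @[K --> \oo] --> tau i w.
  move=> tTi; have -> : tau i w = T3 i w.
    rewrite (tauE streamsD payoffD Ft0 Ff y_fix r_max) /plan.
    by rewrite (rest_out _ tTi) addr0 TS.
  apply: cvg_near_cst; exists i.+1 => // K /= iK.
  rewrite tau_nKE// /Rstar leNgt tTi/= S_gt0 addr0//.
have {tT} : t0 < T3 (n + k) w by apply: lt_le_trans tT _; apply: T3_nd => //; exact: leq_addl.
elim: k n => [|k IH] n; first by rewrite addn0; exact: over.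
rewrite addnS -addSn => /IH {}IH; have [Tt|] := leP (T3 n w) t0; last exact: over.
have dT := dom_T3 streamsD payoffD Tt.
have RE K : Rstar D r K n w = r (K - n)%N (reward_sum D n w) (T3 n w - s) (t0 - T3 n w).
  by rewrite /Rstar Tt MsT.
have R_cvg : Rstar D r K n w @[K --> \oo] --> rest n w.
  rewrite restE//.
  have := max_fun_cvg streamsD payoffD Ft0 Ff y_fix r_max dT.
  rewrite -(@cvg_centern n); apply: cvg_trans; apply: near_eq_cvg.
  by apply: nearW => K; rewrite RE.
have R_le K : Rstar D r K n w <= rest n w.
  by rewrite RE restE//; exact: (max_fun_le_rinf streamsD payoffD Ft0 Ff y_fix r_max).
rewrite (tauE streamsD payoffD Ft0 Ff y_fix r_max) /plan T3S ltrD2l.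
case: ltP => [rS|Sr].
  have : T3 n w + Rstar D r K n w @[K --> \oo] --> T3 n w + rest n w.
    by apply: cvgD => //; exact: cvg_cst.
  apply: cvg_trans; apply: near_eq_cvg; exists n.+1 => // K /= nK.
  by rewrite tau_nKE// (le_lt_trans (R_le K) rS).
have {}Sr : S3 n w < rest n w.
  by rewrite lt_neqAle Sr andbT; apply/eqP; exact: S_ne.
apply: cvg_trans IH; apply: near_eq_cvg; near=> K.
rewrite [RHS]tau_nKE; last by near: K; exists n.+1.
rewrite ifN// -leNgt; near: K; exact: (cvgr_ge _ R_cvg _ Sr).
Unshelve. all: by end_near. Qed.

Definition terminal (n : nat) (w : T) : R :=
  gamma D y (M D s w) (Ms D (T3 n w) w) (T3 n w).

Lemma terminalE n w : terminal n w + Ctot D = contval D y (base D w)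
  (total (fun k => T3 k w) (fun k => X3 k w) (T3 n w)) (T3 n w - s).
Proof.
rewrite /terminal /gamma /contval lerD2r; case: ifP => Tt; last by rewrite addNr.
have sT := T3_ge streamsD n w.
rewrite (baseE streamsD payoffD _ (le_trans sT Tt)) /wb MsE// (addrC (M D s w)) addrK.
have t_ge0 : 0 <= total (fun k => T3 k w) (fun k => X3 k w) (T3 n w).
  by apply: total_ge0 => k; exact: reward_ge0.
have s_ge := s_ge0 payoffD.
rewrite gbcE// cbcE; last by rewrite subr_ge0 sT/=; lra.
have -> : t0 - s - (T3 n w - s) = t0 - T3 n w by ring.
rewrite on_domE; first by ring.
by split => //=; [rewrite subr_ge0|rewrite subr_ge0|lra].
Qed.

Lemma terminal_gain n w : 0 < S3 n w -> terminal n w + Ctot D = gain n w.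
Proof.
move=> Sn; rewrite terminalE (@total_in _ (fun k => T3 k w) _ _ n)//.
  exact: T3_nd.
by rewrite lexx T3S ltrDl.
Qed.

(** The measurability is exact, so the almost sure identity with [gain] is no help: up to time [t],
    [terminal] is rewritten with observed event times and rewards. *)
Lemma Fsn_terminal n (B : set R) : measurable B -> Fsn D n (terminal n @^-1` B).
Proof.
move=> mB t st; pose GT := g_sigma_algebraType (Fst D t).
pose o k w := obs_time t (T3 k w).
pose x k w := obs_reward t (T3 k.+1 w) (X3 k w).
pose g w := contval D y (base D w) (total (fun k => o k w) (fun k => x k w) (o n w)) (o n w - s) - Ctot D.
have mg : measurable_wrt (Fst D t) g.
  apply: (@measurable_funB _ GT) => //.
  apply: (@measurable_contval _ _ _ _ _ payoffD _ y_fix _ GT).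
  - by apply: (mfun_base payoffD); exact: mfun_M_Fst.
  - apply: (@measurable_total _ _ GT).
    + by move=> w i j ij; apply: obs_time_nd; exact: T3_nd.
    + by move=> k; exact: mfun_obs_time.
    + by move=> k; exact: mfun_obs_reward.
    + exact: mfun_obs_time.
  - by apply: (@measurable_funB _ GT) => //; exact: mfun_obs_time.
rewrite (_ : _ `&` _ = g @^-1` B `&` [set w | T3 n w <= t]).
  rewrite -Fst_id; apply: (@measurableI _ GT); first exact: mfun_preimage.
  by apply: sub_sigma_algebra; exact: Fst_T3_le.
have ge w : T3 n w <= t -> g w = terminal n w.
  move=> Tt; rewrite -[RHS](addrK (Ctot D)) terminalE /g {2 3}/o /obs_time Tt.
  congr (contval _ _ _ _ _ - _); apply/esym/eq_total => //; first exact: T3_nd.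
    by move=> k; rewrite /o obs_time_le.
  by move=> k Tk; rewrite /x /obs_reward (le_trans Tk Tt).
by apply/seteqP; split => w /= [Bw Tt]; split => //; move: Bw; rewrite ge.
Qed.

(** [Fsn_past] identifies [A] with [A'] where the next holding time is positive, so they differ by a
    null set. *)
Lemma integral_Fsn n A : Fsn D n A -> exists2 A', <<s past D n >> A' &
  forall f : T -> R, measurable_fun setT f ->
    (\int[P]_(w in A) (f w)%:E = \int[P]_(w in A') (f w)%:E)%E.
Proof.
move=> FA; have [A' pA' AA'] := Fsn_past streamsD FA; exists A' => // f mf.
have mA := Fsn_measurable FA; have mA' := past_measurable pA'.
have mEf : measurable_fun setT (EFin \o f) by exact/measurable_EFinP.
rewrite integral_mkcond [RHS]integral_mkcond; apply: ae_eq_integral => //.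
- by apply/(measurable_restrictT _ mA); exact: measurable_funTS.
- by apply/(measurable_restrictT _ mA'); exact: measurable_funTS.
- have := holding_gt0 n; apply: filterS => w /AA' [h1 h2] _.
  rewrite !patchE; case: ifPn => [/set_mem/h1/mem_set->//|nA].
  by rewrite memNset// => /h2/mem_set; exact/negP.
Qed.

Lemma integralD_cst (f : T -> R) c A : P.-integrable setT (EFin \o f) -> measurable A ->
  (\int[P]_(w in A) (f w + c)%:E = \int[P]_(w in A) (f w)%:E + c%:E * P A)%E.
Proof.
move=> fi mA; rewrite -(integral_cst _ mA).
have fiA : P.-integrable A (EFin \o f) by exact: integrableS fi.
rewrite -integralD//; apply: (@integrableS _ _ _ _ setT) => //.
exact: (@bounded_integrable _ _ _ P (cst c) `|c|).
Qed.

Lemma measurable_terminal n : measurable_fun setT (terminal n).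
Proof.
move=> _ B mB; rewrite setTI; apply: (@Fsn_measurable _ _ _ _ D n).
exact: Fsn_terminal.
Qed.

Lemma integrable_terminal n : P.-integrable setT (EFin \o terminal n).
Proof.
have [Kb bK] := base_bounded payoffD; have [Kg gK] := gbc_bounded payoffD.
have [Ky Ky0 yK] := y_bound payoffD y_fix.
apply: (@bounded_integrable _ _ _ P (terminal n) (`|Ctot D| + (`|Kb| + `|Kg| + Ky))).
  exact: measurable_terminal.
move=> w; rewrite -[terminal n w](addrK (Ctot D)) addrC; apply: (le_trans (ler_normD _ _)).
rewrite normrN lerD2l terminalE.
rewrite ger0_norm; last by apply: contval_ge0 => //; exact: base_ge.
have a1 := ler_norm Kb; have a2 := ler_norm Kg.
rewrite /contval; case: ifP => _; last by rewrite !addr_ge0.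
set t := total _ _ _; have := bK w; have := gK t.
have := on_dom_bounded yK Ky0 (t, T3 n w - s, t0 - s - (T3 n w - s)).
by move=> /ler_normlP[_]; have /andP[] := cbc_range payoffD (T3 n w - s); lra.
Qed.

Lemma integral_gain_terminal n A : Fsn D n A ->
  (\int[P]_(w in A) (gain n w)%:E = \int[P]_(w in A) (terminal n w)%:E + (Ctot D)%:E * P A)%E.
Proof.
move=> FA; have mA := Fsn_measurable FA.
rewrite -(integralD_cst _ (integrable_terminal n) mA); apply: ae_eq_integral => //.
- by apply: measurable_funTS; apply/measurable_EFinP; exact: measurable_gain.
- apply: measurable_funTS; apply/measurable_EFinP; apply: measurable_funD => //.
  exact: measurable_terminal.
- by have := holding_gt0 n; apply: filterS => w Sn _; rewrite terminal_gain.
Qed.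

Lemma integral_Z_le n A sigma : stopping_time_after D n sigma ->
  P.-integrable setT (EFin \o (fun w => Z D (sigma w) w)) -> Fsn D n A ->
  (\int[P]_(w in A) (Z D (sigma w) w)%:E <= \int[P]_(w in A) (terminal n w)%:E)%E.
Proof.
move=> [st Ts] Zi FA; have mA := Fsn_measurable FA.
have fC : ((Ctot D)%:E * P A)%E \is a fin_num by rewrite fin_numM// fin_num_measure.
rewrite -(leeD2rE _ _ fC) -integral_gain_terminal// -integralD_cst//.
have mZ : measurable_fun setT (fun w => Zplus D (sigma w) w).
  by apply: measurable_funD => //; have /measurable_int/measurable_EFinP := Zi.
have [A' pA' AA'] := integral_Fsn FA.
rewrite (AA' _ mZ) AA'; last exact: measurable_gain.
exact: integral_upper_limit.
Qed.

Lemma integrable_Z_tau n : P.-integrable setT (EFin \o (fun w => Z D (tau n w)%:E w)).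
Proof.
have [K K0 ZK] := Zplus_bounded streamsD payoffD.
have mZ := measurable_Zplus_tau streamsD payoffD Ft0 Ff y_fix r_max n.
have ZE w : Z D (tau n w)%:E w = Zplus D (tau n w)%:E w - Ctot D by rewrite /Zplus addrK.
have s_tau w : (s%:E <= (tau n w)%:E)%E.
  by rewrite lee_fin (s_le_tau streamsD payoffD Ft0 Ff y_fix r_max).
apply: (@bounded_integrable _ _ _ P _ (K + `|Ctot D|)).
  rewrite (_ : (fun _ => _) = fun w => Zplus D (tau n w)%:E w - Ctot D); last exact/funext.
  exact: measurable_funB.
move=> w; rewrite ZE; apply: (le_trans (ler_normB _ _)).
by rewrite lerD2r ger0_norm ?Zplus_ge0// ZK.
Qed.

Lemma tau_stopping_after n : stopping_time_after D n (EFin \o tau n).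
Proof.
split; first exact: (tau_stopping streamsD payoffD Ft0 Ff y_fix r_max).
by move=> w; rewrite lee_fin (tau_ge streamsD payoffD Ft0 Ff y_fix r_max).
Qed.

(** The lower bound holds for [tau], and the upper bound, valid for every rule, applies to [tau]
    too. *)
Lemma integral_Z_tau n A : Fsn D n A ->
  (\int[P]_(w in A) (terminal n w)%:E = \int[P]_(w in A) (Z D (tau n w)%:E w)%:E)%E.
Proof.
move=> FA; have mA := Fsn_measurable FA.
have Zi := integrable_Z_tau n.
apply/eqP; rewrite eq_le; apply/andP; split; last first.
  exact: (integral_Z_le (tau_stopping_after n)).
have fC : ((Ctot D)%:E * P A)%E \is a fin_num by rewrite fin_numM// fin_num_measure.
rewrite -(leeD2rE _ _ fC) -integral_gain_terminal// -integralD_cst//.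
have [A' pA' AA'] := integral_Fsn FA.
rewrite AA'; last exact: measurable_gain.
rewrite [leRHS]AA'; last exact: (measurable_Zplus_tau streamsD payoffD Ft0 Ff y_fix r_max).
exact: integral_lower_limit.
Qed.

End conclusion.

(** Tested on the event where [V < U], which lies in [G], the inequality forces the integral of the
    positive function [U - V] to be 0 there. *)
Lemma ae_le_of_integral_le (d : measure_display) (T : measurableType d) (R : realType)
    (P : probability T R) (G : set (set T)) (U V : T -> R) :
  sigma_algebra setT G -> G `<=` measurable ->
  P.-integrable setT (EFin \o U) -> P.-integrable setT (EFin \o V) ->
  (forall B : set R, measurable B -> G (U @^-1` B)) ->
  (forall B : set R, measurable B -> G (V @^-1` B)) ->
  (forall A, G A -> (\int[P]_(w in A) (U w)%:E <= \int[P]_(w in A) (V w)%:E)%E) ->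
  {ae P, forall w, U w <= V w}.
Proof.
move=> sG GT Ui Vi GU GV UV; pose A := [set w | V w < U w].
have GA : G A.
  rewrite -(sigma_algebra_id sG) (_ : A = (fun w => V w < U w) @^-1` [set true])//.
  apply: (@mfun_preimage _ _ G _ bool) => //.
  by apply: (@measurable_fun_ltr _ (g_sigma_algebraType G)) => _ B mB; rewrite setTI;
    apply: sub_sigma_algebra; [exact: GV|exact: GU].
have mA : measurable A by exact: GT.
have UiA : P.-integrable A (EFin \o U) by exact: integrableS Ui.
have ViA : P.-integrable A (EFin \o V) by exact: integrableS Vi.
have mUV : measurable_fun A (fun w => (U w - V w)%:E).
  apply/measurable_EFinP; apply: measurable_funB.
    by have /measurable_int/measurable_EFinP := UiA.
  by have /measurable_int/measurable_EFinP := ViA.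
have : (\int[P]_(w in A) `|(U w - V w)%:E| = 0)%E.
  transitivity (\int[P]_(w in A) ((U w)%:E - (V w)%:E))%E.
    apply: eq_integral => w /set_mem Aw; rewrite -EFinB gee0_abs// lee_fin.
    by rewrite subr_ge0 ltW.
  apply/eqP; rewrite eq_le; apply/andP; split.
    by rewrite integralB// sube_le0 UV.
  apply: integral_ge0 => w Aw; rewrite -EFinB lee_fin subr_ge0.
  exact: ltW.
move=> /(ae_eq_integral_abs P mA mUV); apply: filterS => w h.
rewrite leNgt; apply/negP => VU; have := h VU => /= -[/eqP].
by rewrite subr_eq0 gt_eqF.
Qed.

Theorem theorem2 (d : measure_display) (T : measurableType d) (R : realType)
    (P : probability T R) (D : problem P)
    (y : R -> R -> R -> R) (r : nat -> R -> R -> R -> R) (n : nat)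
    (streamsD : renewal_reward_streams D)
    (payoffD : payoff_assumptions D)
    (Ft0 : F D (t0 D) < 1)
    (Ff : has_density (F D) (density D))
    (y_fix : fixed_point D y)
    (r_max : maximizing_functions D r) :
  exists tau : T -> R,
    [/\ {ae P, forall w, tau_nK D r n K w @[K --> \oo] --> tau w},
        {ae P, forall w, T3 D n w <= t0 D -> tau w <= t0 D},
        optimal_after D n (EFin \o tau) &
        cond_expectation P (Fsn D n) (fun w => Z D (tau w)%:E w)
          (fun w => gamma D y (M D (s0 D) w) (Ms D (T3 D n w) w) (T3 D n w))].
Proof.
have Z_term := integral_Z_tau streamsD payoffD Ft0 Ff y_fix r_max (n := n).
have tau_after := tau_stopping_after streamsD payoffD Ft0 Ff y_fix r_max n.
exists (tau D r n); split.
- have a1 := ae_foralln (holding_gt0 streamsD Ff).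
  have a2 := T3_unbounded streamsD payoffD Ft0.
  have a3 := ae_foralln (holding_ne_rest streamsD payoffD Ft0 Ff y_fix r_max).
  apply: filterS3 a1 a2 a3 => w h1 h2 h3.
  exact: (tau_nK_cvg streamsD payoffD Ft0 Ff y_fix r_max h1 h2 h3).
- apply: aeW => w Tt; have := tau_le_t0 streamsD payoffD Ft0 Ff y_fix r_max n w.
  by rewrite max_r.
- split=> // sigma st_sigma U V [Zi Ui GU UE] [_ Vi GV VE].
  apply: (@ae_le_of_integral_le _ _ _ P (Fsn D n) U V) => //.
  - exact: Fsn_sigma_algebra.
  - by move=> A; exact: Fsn_measurable.
 
  (* The version [V] integrates over [A] like the pay-off of [tau], hence like [terminal], which
     bounds every rule. *)
  move=> A FA; rewrite UE// VE// -Z_term//.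
  exact: (integral_Z_le streamsD payoffD Ft0 Ff y_fix st_sigma Zi FA).
- split.
  + exact: (integrable_Z_tau streamsD payoffD Ft0 Ff y_fix r_max).
  + exact: (integrable_terminal streamsD payoffD Ft0 Ff y_fix).
  + by move=> B mB; exact: Fsn_terminal.
  + exact: Z_term.
Qed.
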